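(* Let $(A,\alpha)$ and $(B,\beta)$ be C*-dynamical systems (unital C*-algebras $A$, $B$ with unital $*$-endomorphisms $\alpha\in\operatorname{End}(A)$, $\beta\in\operatorname{End}(B)$). Suppose that $\alpha$ is either injective or surjective. Then the semicrossed products $A\times_\alpha \mathbb{Z}_+$ and $B\times_\beta \mathbb{Z}_+$ are isometrically isomorphic if and only if $(A,\alpha)$ and $(B,\beta)$ are outer conjugate.
   Context: A C*-dynamical system $(A,\alpha)$ is a unital C*-algebra $A$ together with a unital $*$-endomorphism $\alpha$ of $A$. Semicrossed product: a covariant representation of $(A,\alpha)$ is a pair $(\pi,V)$ where $\pi$ is a $*$-representation of $A$ on a Hilbert space $H$ and $V\in B(H)$ is a contraction with $\pi(a)V=V\pi(\alpha(a))$ for all $a\in A$. Let $\mathcal{P}$ be the algebra of formal polynomials $\sum_{k=0}^n \mathbf{v}^k a_k$ ($a_k\in A$) with multiplication determined by $a\mathbf{v}=\mathbf{v}\alpha(a)$. Each covariant pair gives a representation $(\pi\times V)(\sum \mathbf{v}^k a_k)=\sum V^k\pi(a_k)$ of $\mathcal{P}$. The semicrossed product $A\times_\alpha\mathbb{Z}_+$ is the operator algebra obtained by completing $\mathcal{P}$ in the norm $\|p\|=\sup_{(\pi,V)}\|(\pi\times V)(p)\|$ (and the analogous norms on matrices over $\mathcal{P}$), the supremum being over all covariant representations. Two semicrossed products are isometrically isomorphic if there is a surjective isometric algebra isomorphism between them. $(A,\alpha)$ and $(B,\beta)$ are outer conjugate if there are a $*$-isomorphism $\gamma$ of $A$ onto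 $B$ and a unitary $v\in A$ such that $\alpha(a)=v\,(\gamma^{-1}\beta\gamma(a))\,v^*$ for all $a\in A$. *)

(* Defs.v *)
From HB Require Import structures.
From mathcomp Require Import all_boot all_order all_algebra complex.
From mathcomp Require Import boolp classical_sets functions cardinality fsbigop.
From mathcomp Require Import reals topology normedtype sequences.
From mathcomp Require Import generic_quotient ring lra.

Set Implicit Arguments.
Unset Strict Implicit.
Unset Printing Implicit Defensive.

Import Order.TTheory GRing.Theory Num.Theory numFieldNormedType.Exports.

Local Open Scope classical_set_scope.
Local Open Scope ring_scope.
Local Open Scope complex_scope.

(* MathComp's [algType] excludes the zero algebra and cannot be joined with   *)
(* [normedModType]; unital algebras over C are therefore modules with an      *)
(* additional product.                                                        *)
HB.mixin Record isUnitalAlgebra (R : realType) A & GRing.Lmodule R[i] A := {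
  uone : A;
  umul : A -> A -> A;
  umulA : associative umul;
  umul1l : left_id uone umul;
  umul1r : right_id uone umul;
  umulDl : left_distributive umul +%R;
  umulDr : right_distributive umul +%R;
  umulZl : forall (c : R[i]) a b, umul (c *: a) b = c *: umul a b;
  umulZr : forall (c : R[i]) a b, umul a (c *: b) = c *: umul a b
}.
#[short(type="unitalAlgType")]
HB.structure Definition UnitalAlgebra (R : realType) :=
  {A of isUnitalAlgebra R A & GRing.Lmodule R[i] A}.

Notation "a ** b" := (umul a b) (at level 40, left associativity) : ring_scope.

HB.mixin Record isBanachAlgebra (R : realType) A
    & CompleteNormedModule R[i] A & UnitalAlgebra R A := {
  normuM : forall a b : A, `|a ** b| <= `|a| * `|b|
}.
#[short(type="banachAlgType")]
HB.structure Definition BanachAlgebra (R : realType) :=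
  {A of isBanachAlgebra R A & CompleteNormedModule R[i] A & UnitalAlgebra R A}.

HB.mixin Record isCStarAlgebra (R : realType) A & BanachAlgebra R A := {
  star : A -> A;
  starD : forall a b, star (a + b) = star a + star b;
  starZ : forall (c : R[i]) a, star (c *: a) = Num.conj c *: star a;
  starM : forall a b, star (a ** b) = star b ** star a;
  starK : involutive star;
  cstar_norm : forall a, `|star a ** a| = `|a| ^+ 2
}.
#[short(type="cstarAlgType")]
HB.structure Definition CStarAlgebra (R : realType) :=
  {A of isCStarAlgebra R A & BanachAlgebra R A}.

(* The inner product is linear in its first argument. *)
HB.mixin Record isHilbert (R : realType) H & CompleteNormedModule R[i] H := {
  inner : {dot H for Num.conj};
  inner_norm : forall x, inner x x = `|x| ^+ 2
}.
#[short(type="hilbertType")]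
HB.structure Definition Hilbert (R : realType) :=
  {H of isHilbert R H & CompleteNormedModule R[i] H}.

HB.mixin Record isStarHom (R : realType) (A B : cstarAlgType R)
    (f : A -> B) := {
  starhom1 : f uone = uone;
  starhomM : forall a b, f (a ** b) = f a ** f b;
  starhom_star : forall a, f (star a) = star (f a)
}.
#[short(type="starHom")]
HB.structure Definition StarHom (R : realType) (A B : cstarAlgType R) :=
  {f of @GRing.Linear R[i] A B *:%R f & isStarHom R A B f}.

Section UnitalAlgebraTheory.
Variables (R : realType) (U : unitalAlgType R).
Implicit Types a b : U.

Lemma umul0l a : 0 ** a = 0.
Proof. by apply: (addIr (0 ** a)); rewrite -umulDl !add0r. Qed.

Lemma umul0r a : a ** 0 = 0.
Proof. by apply: (addIr (a ** 0)); rewrite -umulDr !add0r. Qed.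

Lemma umulNl a b : (- a) ** b = - (a ** b).
Proof. by rewrite -scaleN1r umulZl scaleN1r. Qed.

Lemma umulNr a b : a ** (- b) = - (a ** b).
Proof. by rewrite -scaleN1r umulZr scaleN1r. Qed.

Lemma umul_suml I (s : seq I) (P : pred I) (F : I -> U) a :
  (\sum_(i <- s | P i) F i) ** a = \sum_(i <- s | P i) F i ** a.
Proof.
apply: (big_morph (fun x => x ** a)) => [x y|]; [exact: umulDl|exact: umul0l].
Qed.

Lemma umul_sumr I (s : seq I) (P : pred I) (F : I -> U) a :
  a ** (\sum_(i <- s | P i) F i) = \sum_(i <- s | P i) a ** F i.
Proof.
apply: (big_morph (fun x => a ** x)) => [x y|]; [exact: umulDr|exact: umul0r].
Qed.

End UnitalAlgebraTheory.

Section Sums.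
Variable V : zmodType.

Lemma sum_triangle N (G : nat -> nat -> V) :
  \sum_(j < N) \sum_(l < j.+1) G j l =
  \sum_(l < N) \sum_(i < N - l) G (l + i)%N l.
Proof.
under eq_bigr => j _ do rewrite (big_ord_widen N (G j))//.
rewrite (exchange_big_dep xpredT) //=; apply: eq_bigr => l _.
rewrite -(big_mkord (fun j => l < j.+1)%N (fun j => G j l)).
rewrite (big_cat_nat (leq0n l) (ltnW (ltn_ord l))) /=.
rewrite big_nat_cond big1 ?add0r; last first.
  by move=> i /andP[/andP[_ il]]; rewrite ltnS leqNgt il.
rewrite big_nat_cond (eq_bigl (fun i => (l <= i < N)%N && true)); last first.
  by move=> i; rewrite andbT; apply: andb_idr => /andP[].
rewrite -big_nat_cond -{1}[l : nat]add0n big_addn big_mkord.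
by apply: eq_bigr => i _; rewrite addnC.
Qed.

Lemma sum_truncate n m (f : nat -> V) : (n <= m)%N ->
  (forall i, (n <= i)%N -> f i = 0) -> \sum_(i < m) f i = \sum_(i < n) f i.
Proof.
move=> nm f0; rewrite -!(big_mkord xpredT f) (big_cat_nat (leq0n n) nm) /=.
have -> : \sum_(n <= i < m) f i = 0; last by rewrite addr0.
by rewrite big_nat_cond big1// => i /andP[/andP[/f0]].
Qed.

End Sums.

(* The algebra of formal polynomials \sum_k v^k a_k, with a v = v (alpha a).  *)
Record twisted_poly (R : realType) (A : cstarAlgType R) (alpha : starHom A A) :=
  TwistedPoly {
    coef :> nat -> A;
    coef_fin : exists n, forall k, (n <= k)%N -> coef k = 0
  }.
Arguments TwistedPoly {R A} alpha {coef}.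

Section TwistedPolynomials.
Variables (R : realType) (A : cstarAlgType R) (alpha : starHom A A).

HB.instance Definition _ := gen_eqMixin (twisted_poly alpha).
HB.instance Definition _ := gen_choiceMixin (twisted_poly alpha).

Implicit Types p q r : twisted_poly alpha.

Lemma twisted_polyP p q : p =1 q -> p = q.
Proof.
case: p q => [p hp] [q hq] /= /funext pq; subst q.
by congr TwistedPoly; exact: Prop_irrelevance.
Qed.

Fact tpoly0_fin : exists n, forall k, (n <= k)%N -> (0 : A) = 0.
Proof. by exists 0%N. Qed.

Fact tpolyN_fin p : exists n, forall k, (n <= k)%N -> - p k = 0.
Proof. by have [n hn] := coef_fin p; exists n => k /hn ->; rewrite oppr0. Qed.

Fact tpolyD_fin p q : exists n, forall k, (n <= k)%N -> p k + q k = 0.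
Proof.
have [n hn] := coef_fin p; have [m hm] := coef_fin q.
by exists (maxn n m) => k; rewrite geq_max => /andP[/hn -> /hm ->]; rewrite addr0.
Qed.

Fact tpolyZ_fin (c : R[i]) p : exists n, forall k, (n <= k)%N -> c *: p k = 0.
Proof. by have [n hn] := coef_fin p; exists n => k /hn ->; rewrite scaler0. Qed.

Fact tpolyC_fin (a : A) :
  exists n, forall k, (n <= k)%N -> (if k == 0%N then a else 0) = 0.
Proof. by exists 1%N; case. Qed.

Lemma iter_starhom0 j : iter j alpha 0 = 0.
Proof. by elim: j => //= j ->; rewrite linear0. Qed.

Fact tpolyM_fin p q : exists n, forall k, (n <= k)%N ->
  \sum_(j < k.+1) iter j alpha (p (k - j)%N) ** q j = 0.
Proof.
have [n hn] := coef_fin p; have [m hm] := coef_fin q.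
exists (n + m)%N => k nmk; apply: big1 => j _.
have [mj|jm] := leqP m j; first by rewrite hm// umul0r.
rewrite hn ?iter_starhom0 ?umul0l// leq_subRL; last by rewrite -ltnS.
by apply: leq_trans nmk; rewrite addnC leq_add2l ltnW.
Qed.

Definition tpoly0 := TwistedPoly alpha tpoly0_fin.
Definition tpolyN p := TwistedPoly alpha (tpolyN_fin p).
Definition tpolyD p q := TwistedPoly alpha (tpolyD_fin p q).
Definition tpolyZ c p := TwistedPoly alpha (tpolyZ_fin c p).
Definition tpoly1 := TwistedPoly alpha (tpolyC_fin uone).
(* (v^i a) (v^j b) = v^(i + j) (alpha^j a) b *)
Definition tpolyM p q := TwistedPoly alpha (tpolyM_fin p q).

Fact tpolyDA : associative tpolyD.
Proof. by move=> p q r; apply: twisted_polyP => k /=; rewrite addrA. Qed.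
Fact tpolyDC : commutative tpolyD.
Proof. by move=> p q; apply: twisted_polyP => k /=; rewrite addrC. Qed.
Fact tpoly0D : left_id tpoly0 tpolyD.
Proof. by move=> p; apply: twisted_polyP => k /=; rewrite add0r. Qed.
Fact tpolyND : left_inverse tpoly0 tpolyN tpolyD.
Proof. by move=> p; apply: twisted_polyP => k /=; rewrite addNr. Qed.

HB.instance Definition _ :=
  GRing.isZmodule.Build (twisted_poly alpha) tpolyDA tpolyDC tpoly0D tpolyND.

Fact tpolyZA c d p : tpolyZ c (tpolyZ d p) = tpolyZ (c * d) p.
Proof. by apply: twisted_polyP => k /=; rewrite scalerA. Qed.
Fact tpoly1Z : left_id 1 tpolyZ.
Proof. by move=> p; apply: twisted_polyP => k /=; rewrite scale1r. Qed.
Fact tpolyZDr : right_distributive tpolyZ +%R.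
Proof. by move=> c p q; apply: twisted_polyP => k /=; rewrite scalerDr. Qed.
Fact tpolyZDl p : {morph tpolyZ^~ p : c d / c + d}.
Proof. by move=> c d; apply: twisted_polyP => k /=; rewrite scalerDl. Qed.

HB.instance Definition _ := GRing.Zmodule_isLmodule.Build R[i] (twisted_poly alpha)
  tpolyZA tpoly1Z tpolyZDr tpolyZDl.

Lemma iter_starhom1 j : iter j alpha uone = uone.
Proof. by elim: j => //= j ->; rewrite starhom1. Qed.
Lemma iter_starhomD j : {morph iter j alpha : a b / a + b}.
Proof. by elim: j => //= j IH a b /=; rewrite IH linearD. Qed.
Lemma iter_starhomZ j c a : iter j alpha (c *: a) = c *: iter j alpha a.
Proof. by elim: j => //= j ->; rewrite linearZ. Qed.
Lemma iter_starhomM j : {morph iter j alpha : a b / a ** b}.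
Proof. by elim: j => //= j IH a b /=; rewrite IH starhomM. Qed.

Fact tpolyM1l : left_id tpoly1 tpolyM.
Proof.
move=> p; apply: twisted_polyP => k /=.
rewrite big_ord_recr /= subnn eqxx iter_starhom1 umul1l big1 ?add0r// => j _.
by rewrite subn_eq0 leqNgt ltn_ord /= iter_starhom0 umul0l.
Qed.
Fact tpolyM1r : right_id tpoly1 tpolyM.
Proof.
move=> p; apply: twisted_polyP => k /=.
by rewrite big_ord_recl /= subn0 umul1r big1 ?addr0// => j _; rewrite umul0r.
Qed.
Fact tpolyMDl : left_distributive tpolyM +%R.
Proof.
move=> p q r; apply: twisted_polyP => k /=; rewrite -big_split /=.
by apply: eq_bigr => j _; rewrite iter_starhomD umulDl.
Qed.
Fact tpolyMDr : right_distributive tpolyM +%R.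
Proof.
move=> p q r; apply: twisted_polyP => k /=; rewrite -big_split /=.
by apply: eq_bigr => j _; rewrite umulDr.
Qed.
Fact tpolyMZl c p q : tpolyM (c *: p) q = c *: tpolyM p q.
Proof.
apply: twisted_polyP => k /=; rewrite scaler_sumr.
by apply: eq_bigr => j _; rewrite iter_starhomZ umulZl.
Qed.
Fact tpolyMZr c p q : tpolyM p (c *: q) = c *: tpolyM p q.
Proof.
apply: twisted_polyP => k /=; rewrite scaler_sumr.
by apply: eq_bigr => j _; rewrite umulZr.
Qed.
Fact tpolyMA : associative tpolyM.
Proof.
move=> p q r; apply: twisted_polyP => k /=.
pose F a b c := iter (b + c) alpha (p a) ** iter c alpha (q b) ** r c.
transitivity (\sum_(j < k.+1) \sum_(l < j.+1) F (k - j)%N (j - l)%N l).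
  apply: eq_bigr => j _; rewrite umul_sumr; apply: eq_bigr => l _.
  by rewrite /F subnK -1?ltnS// umulA.
rewrite (sum_triangle k.+1 (fun j l => F (k - j)%N (j - l)%N l)).
apply: eq_bigr => l _; rewrite subSn -1?ltnS//; rewrite -umul_suml; congr (_ ** _).
rewrite (big_morph (iter l alpha) (iter_starhomD l) (iter_starhom0 l)).
apply: eq_bigr => i _; rewrite iter_starhomM -iterD subnDA; congr (_ ** _).
  by rewrite addKn addnC.
by rewrite addKn.
Qed.

HB.instance Definition _ := isUnitalAlgebra.Build R (twisted_poly alpha)
  tpolyMA tpolyM1l tpolyM1r tpolyMDl tpolyMDr tpolyMZl tpolyMZr.

End TwistedPolynomials.

Section RealNorm.
Variable R : realType.

Definition rnorm (V : normedZmodType R[i]) (x : V) : R := complex.Re `|x|.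

Lemma rnormE (V : normedZmodType R[i]) (x : V) : (rnorm x)%:C = `|x|.
Proof. by rewrite /rnorm RRe_real// normr_real. Qed.

Lemma rnorm_le (V W : normedZmodType R[i]) (x : V) (y : W) :
  (rnorm x <= rnorm y) = (`|x| <= `|y|).
Proof. by rewrite -lecR !rnormE. Qed.

Section NormedZmod.
Variable V : normedZmodType R[i].
Implicit Types x y : V.

Lemma rnorm_ge0 x : 0 <= rnorm x.
Proof. by rewrite -ler0c rnormE normr_ge0. Qed.

Lemma rnorm0 : rnorm (0 : V) = 0.
Proof. by rewrite /rnorm normr0. Qed.

Lemma rnorm0_eq0 x : rnorm x = 0 -> x = 0.
Proof. by move=> x0; apply: normr0_eq0; rewrite -rnormE x0. Qed.

Lemma rnormN x : rnorm (- x) = rnorm x.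
Proof. by rewrite /rnorm normrN. Qed.

Lemma rnormB x y : rnorm (x - y) = rnorm (y - x).
Proof. by rewrite -rnormN opprB. Qed.

Lemma rnormD x y : rnorm (x + y) <= rnorm x + rnorm y.
Proof. by rewrite -lecR rmorphD /= !rnormE ler_normD. Qed.

Lemma rnorm_tri z x y : rnorm (x - y) <= rnorm (x - z) + rnorm (z - y).
Proof. by apply: le_trans (rnormD _ _); rewrite addrA subrK. Qed.

End NormedZmod.

Lemma rnormZ (V : normedModType R[i]) (c : R[i]) (x : V) :
  rnorm (c *: x) = rnorm c * rnorm x.
Proof.
by apply: (complexI (R := R)); rewrite rmorphM /= !rnormE normrZ.
Qed.

Lemma rnorm_real (r : R) : rnorm (r%:C : R[i]) = `|r|.
Proof.
by apply: (complexI (R := R)); rewrite rnormE normc_def /= expr0n addr0 sqrtr_sqr.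
Qed.

Lemma rnormM (A : banachAlgType R) (a b : A) :
  rnorm (a ** b) <= rnorm a * rnorm b.
Proof. by rewrite -lecR rmorphM /= !rnormE normuM. Qed.

Lemma rnorm_star (A : cstarAlgType R) (a : A) : rnorm (star a) = rnorm a.
Proof.
have le b : rnorm b <= rnorm (star b :> A).
  have [->|b0] := eqVneq (rnorm b) 0; first exact: rnorm_ge0.
  have bp : 0 < rnorm b by rewrite lt_neqAle eq_sym b0 rnorm_ge0.
  rewrite -(ler_pM2r bp); apply: le_trans (rnormM _ _).
  by rewrite -lecR rnormE cstar_norm -rnormE expr2 rmorphM.
by apply/eqP; rewrite eq_le le -{2}[a]starK le.
Qed.

Lemma rnorm_cvg (V : completeNormedModType R[i]) (u : nat -> V) :
  (forall e : R, 0 < e ->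
     exists n, forall i j, (n <= i)%N -> (n <= j)%N -> rnorm (u i - u j) < e) ->
  exists l, forall e : R, 0 < e ->
    exists n, forall i, (n <= i)%N -> rnorm (l - u i) < e.
Proof.
move=> uC; have : cauchy (u @ \oo).
  apply: cauchy_exP => e e0 /=.
  have eE : e = (complex.Re e)%:C by rewrite RRe_real// gtr0_real.
  have [|n hn] := uC (complex.Re e); first by rewrite -ltcR -eE.
  exists (u n); exists n => // i /= ni.
  by rewrite -ball_normE /= eE -rnormE ltcR hn.
move=> /cauchy_cvg /cvg_ex[l ul]; exists l => e e0.
move/cvgrPdist_lt : ul => /(_ e%:C); rewrite ltcR => /(_ e0)[n _ hn].
by exists n => i /hn /=; rewrite -rnormE ltcR.
Qed.

Lemma geometric_cvg (V : completeNormedModType R[i]) (u : nat -> V) (r : R) :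
  0 <= r < 1 -> (forall n, rnorm (u n.+1 - u n) <= r ^+ n) ->
  exists l, forall e : R, 0 < e ->
    exists n, forall i, (n <= i)%N -> rnorm (l - u i) < e.
Proof.
move=> /andP[r0 r1] ur; apply: rnorm_cvg => e e0.
have r1p : 0 < 1 - r by rewrite subr_gt0.
have unk n k : rnorm (u (n + k)%N - u n) <= r ^+ n / (1 - r) * (1 - r ^+ k).
  elim: k => [|k IH]; first by rewrite addn0 subrr rnorm0 expr0 subrr mulr0.
  apply: le_trans (rnorm_tri (u (n + k)%N) _ _) _; rewrite addnS.
  apply: le_trans (lerD (ur _) IH) _; rewrite exprD exprS.
  rewrite le_eqVlt; apply/orP; left; apply/eqP.
  by field; rewrite gt_eqF.
have unk' n k : rnorm (u (n + k)%N - u n) <= r ^+ n / (1 - r).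
  apply: le_trans (unk n k) _; apply: ler_piMr.
    by apply: divr_ge0; [exact: exprn_ge0|exact: ltW].
  by rewrite gerBl exprn_ge0.
have : GRing.exp r @ \oo --> (0 : R) by apply: cvg_expr; rewrite ger0_norm.
move=> /cvgrPdist_lt /(_ (e / 2 * (1 - r))).
rewrite pmulr_lgt0// divr_gt0// => /(_ isT)[n _ hn].
have rn : r ^+ n / (1 - r) < e / 2.
  rewrite ltr_pdivrMr//; have := hn n (leqnn _).
  by rewrite /= sub0r normrN ger0_norm// exprn_ge0.
exists n => i j ni nj; apply: le_lt_trans (rnorm_tri (u n) _ _) _.
rewrite [e]splitr ltrD//; apply: le_lt_trans rn.
  by rewrite -(subnKC ni).
by rewrite rnormB -(subnKC nj).
Qed.

End RealNorm.

Section Representations.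
Variable R : realType.

(* Not assumed nondegenerate: (pi uone) is a projection that commutes with    *)
(* the contraction of a covariant pair, and polynomials vanish off its range. *)
Record star_rep (A : cstarAlgType R) (H : hilbertType R) := StarRep {
  rep_op :> A -> {linear H -> H};
  rep_bounded : forall a, continuous (rep_op a);
  rep_linear : forall (c : R[i]) a b x,
    rep_op (c *: a + b) x = c *: rep_op a x + rep_op b x;
  repM : forall a b x, rep_op (a ** b) x = rep_op a (rep_op b x);
  rep_star : forall a x y, inner (rep_op a x) y = inner x (rep_op (star a) y)
}.

Section Contractive.
Variables (A : cstarAlgType R) (H : hilbertType R) (pi : star_rep A H).

Lemma repD a b x : pi (a + b) x = pi a x + pi b x.
Proof. by rewrite -[a]scale1r rep_linear !scale1r. Qed.

Lemma rep0 x : pi 0 x = 0.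
Proof. by apply: (addIr (pi 0 x)); rewrite -repD !add0r. Qed.

Lemma repZ c a x : pi (c *: a) x = c *: pi a x.
Proof. by rewrite -[c *: a]addr0 rep_linear rep0 addr0. Qed.

Lemma repN a x : pi (- a) x = - pi a x.
Proof. by rewrite -scaleN1r repZ scaleN1r. Qed.

Lemma star0 : star 0 = 0 :> A.
Proof. by apply: (addIr (star 0)); rewrite -starD !add0r. Qed.

Lemma star1 : star uone = uone :> A.
Proof. by rewrite -[LHS]umul1r -{2}[uone]starK -starM umul1r starK. Qed.

Lemma starN a : star (- a) = - star a :> A.
Proof. by apply: (addIr (star a)); rewrite -starD !addNr star0. Qed.

(* y solves y = (c + y^2) / 2, so that 1 - c = (1 - y)^2. *)
Lemma half_sqrt (c : A) : star c = c -> rnorm c < 1 ->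
  exists y : A, star y = y /\ y = 2^-1 *: (c + y ** y).
Proof.
move=> cs c1; set r := rnorm c; have r0 : 0 <= r := rnorm_ge0 c.
pose T (y : A) := (2^-1 : R[i]) *: (c + y ** y).
pose u n := iter n T 0.
have n2 : rnorm (2^-1 : R[i]) = 2^-1.
  have -> : (2^-1 : R[i]) = (2^-1 : R)%:C by rewrite fmorphV rmorph_nat.
  by rewrite rnorm_real ger0_norm// invr_ge0.
have TB y z : T y - T z = (2^-1 : R[i]) *: (y ** (y - z) + (y - z) ** z).
  rewrite /T -scalerBr; congr (_ *: _).
  rewrite umulDr umulDl umulNr umulNl addrA subrK.
  by rewrite opprD addrACA subrr add0r.
have Tlip y z : rnorm (T y - T z) <= (rnorm y + rnorm z) / 2 * rnorm (y - z).
  rewrite TB rnormZ n2 mulrC mulrAC ler_pM2r ?invr_gt0//.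
  apply: le_trans (rnormD _ _) _; rewrite mulrDl lerD ?rnormM//.
  by rewrite mulrC rnormM.
have ur n : rnorm (u n) <= r.
  elim: n => [|n IH]; first by rewrite rnorm0.
  rewrite /= /T rnormZ n2.
  have := rnormD c (u n ** u n); have := rnormM (u n) (u n).
  have := rnorm_ge0 (u n); rewrite -/r; nra.
have us n : star (u n) = u n.
  elim: n => [|n IH]; first exact: star0.
  by rewrite /= /T starZ starD starM cs IH fmorphV rmorph_nat.
have [|n|y hy] := @geometric_cvg _ _ u r; first by apply/andP.
  elim: n => [|n IH].
    by rewrite expr0 /u /= subr0; apply: le_trans (ltW c1); exact: (ur 1%N).
  apply: le_trans (Tlip _ _) _; rewrite exprS.
  apply: ler_pM => //; first by rewrite divr_ge0// addr_ge0 ?rnorm_ge0.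
    exact: rnorm_ge0.
  by rewrite ler_pdivrMr// mulr_natr mulr2n; apply: lerD; [exact: (ur n.+1)|exact: (ur n)].
have small (x : A) (M : R) : 0 <= M ->
    (forall e : R, 0 < e -> rnorm x <= M * e) -> x = 0.
  move=> M0 hx; apply: rnorm0_eq0; apply/eqP; rewrite eq_le rnorm_ge0 andbT.
  apply/ler_addgt0Pr => e e0; rewrite add0r.
  have M1 : 0 < M + 1 by rewrite ltr_pwDr.
  apply: le_trans (hx (e / (M + 1)) _) _; first by rewrite divr_gt0.
  rewrite mulrA ler_pdivrMr// mulrC ler_wpM2l ?ltW//; lra.
exists y; split.
  apply/eqP; rewrite -subr_eq0; apply/eqP; apply: (small _ 2) => // e e0.
  have [n hn] := hy e e0; have {}hn := hn n (leqnn n).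
  have -> : star y - y = star (y - u n) - (y - u n).
    by rewrite starD starN us opprB addrA subrK.
  apply: le_trans (rnormD _ _) _; rewrite rnormN rnorm_star.
  by rewrite mulr_natl mulr2n lerD// ltW.
apply/eqP; rewrite -subr_eq0; apply/eqP.
apply: (small _ (1 + (r + rnorm y) / 2)) => [|e e0].
  by rewrite addr_ge0// divr_ge0// addr_ge0// rnorm_ge0.
have [n hn] := hy e e0.
apply: le_trans (rnorm_tri (u n.+1) _ _) _; rewrite mulrDl mul1r lerD//.
  by rewrite ltW// hn.
apply: le_trans (Tlip _ _) _; apply: ler_pM => //; try exact: rnorm_ge0.
- by rewrite divr_ge0// addr_ge0 ?rnorm_ge0.
- by rewrite ler_pM2r ?invr_gt0// lerD2r.
- by rewrite rnormB ltW// hn.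
Qed.

Lemma inner_rnorm (x : H) : inner x x = (rnorm x ^+ 2)%:C.
Proof. by rewrite inner_norm -rnormE rmorphXn. Qed.

Lemma inner_rep1 x : inner (pi uone x) (pi uone x) = inner x (pi uone x).
Proof. by rewrite [LHS]rep_star star1 -repM umul1l. Qed.

Lemma rep1_contractive x : rnorm (pi uone x) <= rnorm x.
Proof.
rewrite -(ler_pXn2r (n := 2)) ?nnegrE ?rnorm_ge0// -lecR -!inner_rnorm.
rewrite -subr_ge0.
have e2 : inner (pi uone x) x = inner x (pi uone x) by rewrite rep_star star1.
have -> : inner x x - inner (pi uone x) (pi uone x) =
    inner (x - pi uone x) (x - pi uone x).
  rewrite linearBl linearBr /= linearBr /= inner_rep1 e2; ring.
by rewrite inner_rnorm ler0c sqr_ge0.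
Qed.

Lemma rep_contractive a x : rnorm (pi a x) <= rnorm a * rnorm x.
Proof.
have lt1 b : rnorm b < 1 -> rnorm (pi b x) <= rnorm x.
  move=> b1; pose c := star b ** b.
  have c1 : rnorm c < 1.
    rewrite -ltcR rnormE cstar_norm -rnormE -rmorphXn ltcR.
    by rewrite exprn_ilt1// rnorm_ge0.
  have cs : star c = c by rewrite starM starK.
  have [y [ys yE]] := half_sqrt cs c1.
  have yy : y + y = c + y ** y.
    have := congr1 (fun z => (2 : R[i]) *: z) yE.
    by rewrite scalerA divff ?pnatr_eq0// scale1r scaler_nat mulr2n.
  pose d := uone - y.
  have ds : star d = d by rewrite starD starN star1 ys.
  have cE : c = uone - d ** d.
    rewrite -[LHS](addrK (y ** y)) -yy /d umulDl umulNl umul1l umulDr umulNr.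
    by rewrite umul1r opprD !opprB addrA [uone + _]addrC subrK addrA.
  rewrite -(ler_pXn2r (n := 2)) ?nnegrE ?rnorm_ge0// -lecR -!inner_rnorm.
  rewrite rep_star -repM -/c cE repD repN linearBr /=.
  rewrite repM -{1}ds -rep_star -inner_rep1 !inner_rnorm -rmorphB lecR.
  apply: le_trans (_ : rnorm (pi uone x) ^+ 2 <= _).
    by rewrite gerBl sqr_ge0.
  by rewrite ler_pXn2r ?nnegrE ?rnorm_ge0// rep1_contractive.
have lt_t (t : R) : rnorm a < t -> rnorm (pi a x) <= t * rnorm x.
  move=> ta; have t0 : 0 < t := le_lt_trans (rnorm_ge0 a) ta.
  have tV : rnorm ((t^-1)%:C : R[i]) = t^-1.
    by rewrite rnorm_real ger0_norm// invr_ge0 ltW.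
  have := lt1 ((t^-1)%:C *: a); rewrite repZ !rnormZ tV.
  by rewrite ![t^-1 * _]mulrC ltr_pdivrMr// mul1r ler_pdivrMr// mulrC => /(_ ta).
apply/ler_addgt0Pr => e e0; set r := rnorm x.
have r0 : 0 <= r := rnorm_ge0 x.
have r1 : 0 < r + 1 by rewrite ltr_wpDl.
apply: le_trans (lt_t (rnorm a + e / (r + 1)) _) _.
  by rewrite ltrDl divr_gt0.
rewrite mulrDl lerD2l mulrAC -mulrA -[leRHS]mulr1 ler_pM2l//.
by rewrite ler_pdivrMr// mul1r lerDl.
Qed.

End Contractive.

Record covariant_rep (A : cstarAlgType R) (alpha : starHom A A)
    (H : hilbertType R) := CovariantRep {
  cov_rep : star_rep A H;
  cov_op : {linear H -> H};
  cov_contraction : forall x, `|cov_op x| <= `|x|;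
  covariance : forall a x, cov_rep a (cov_op x) = cov_op (cov_rep (alpha a) x)
}.

Arguments covariant_rep {A} alpha H.

Section SemicrossedNorm.
Variables (A : cstarAlgType R) (alpha : starHom A A).

(* (pi x V)(p); the sum has finite support. *)
Definition cov_eval (H : hilbertType R) (rho : covariant_rep alpha H)
    (p : twisted_poly alpha) (x : H) : H :=
  \sum_(k \in [set: nat]) iter k (cov_op rho) (cov_rep rho (p k) x).

Definition opnorm (H : hilbertType R) (T : H -> H) : R :=
  sup [set rnorm (T x) | x in [set x : H | `|x| <= 1]].

(* [sup] is 0 on unbounded sets; [cov_eval_bound] bounds this set and those   *)
(* in [opnorm].                                                               *)
Definition semicrossed_norm (p : twisted_poly alpha) : R :=
  sup [set r | exists (H : hilbertType R) (rho : covariant_rep alpha H),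
                 r = opnorm (cov_eval rho p)].

Section Eval.
Variables (H : hilbertType R) (rho : covariant_rep alpha H).
Let V := cov_op rho.
Let pi := cov_rep rho.
Implicit Types p q : twisted_poly alpha.

Lemma iter_cov0 k : iter k V 0 = 0.
Proof. by elim: k => //= k ->; rewrite linear0. Qed.
Lemma iter_covD k : {morph iter k V : x y / x + y}.
Proof. by elim: k => //= k IH x y /=; rewrite IH linearD. Qed.
Lemma iter_covZ k c x : iter k V (c *: x) = c *: iter k V x.
Proof. by elim: k => //= k ->; rewrite linearZ. Qed.
Lemma iter_cov_le k x : rnorm (iter k V x) <= rnorm x.
Proof.
by elim: k => //= k; apply: le_trans; rewrite rnorm_le cov_contraction.
Qed.
Lemma rep_iter_cov k a x : pi a (iter k V x) = iter k V (pi (iter k alpha a) x).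
Proof. by elim: k a => //= k IH a; rewrite covariance IH -iterSr. Qed.

Lemma cov_evalE p n x : (forall k, (n <= k)%N -> p k = 0) ->
  cov_eval rho p x = \sum_(k < n) iter k V (pi (p k) x).
Proof.
move=> pn; rewrite /cov_eval.
rewrite (fsbig_ord _ n (fun k => iter k V (pi (p k) x))).
apply/esym/fsbig_widen => // k [_ /= /negP]; rewrite -leqNgt => nk.
by rewrite pn// rep0 iter_cov0.
Qed.

Lemma cov_eval_le p n x : (forall k, (n <= k)%N -> p k = 0) ->
  rnorm (cov_eval rho p x) <= (\sum_(k < n) rnorm (p k)) * rnorm x.
Proof.
move=> /cov_evalE ->; elim: n => [|n IH]; first by rewrite !big_ord0 rnorm0 mul0r.
rewrite !big_ord_recr /= mulrDl; apply: le_trans (rnormD _ _) (lerD IH _).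
exact: le_trans (iter_cov_le _ _) (rep_contractive _ _ _).
Qed.

Lemma coef_fin2 p q : exists n,
  (forall k, (n <= k)%N -> p k = 0) /\ (forall k, (n <= k)%N -> q k = 0).
Proof.
have [n hn] := coef_fin p; have [m hm] := coef_fin q; exists (maxn n m).
by split=> k; rewrite geq_max => /andP[? ?]; [exact: hn|exact: hm].
Qed.

Lemma cov_evalD p q x : cov_eval rho (p + q) x = cov_eval rho p x + cov_eval rho q x.
Proof.
have [n [pn qn]] := coef_fin2 p q.
rewrite (cov_evalE _ pn) (cov_evalE _ qn) (@cov_evalE _ n) => [|k nk].
  by rewrite -big_split; apply: eq_bigr => k _; rewrite /= repD iter_covD.
by rewrite /= pn// qn// addr0.
Qed.

Lemma cov_evalZ c p x : cov_eval rho (c *: p) x = c *: cov_eval rho p x.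
Proof.
have [n pn] := coef_fin p.
rewrite (cov_evalE _ pn) (@cov_evalE _ n) => [|k nk].
  by rewrite scaler_sumr; apply: eq_bigr => k _; rewrite /= repZ iter_covZ.
by rewrite /= pn// scaler0.
Qed.

Lemma cov_eval_lin p c x y :
  cov_eval rho p (c *: x + y) = c *: cov_eval rho p x + cov_eval rho p y.
Proof.
have [n pn] := coef_fin p.
rewrite !(cov_evalE _ pn) scaler_sumr -big_split /=; apply: eq_bigr => k _.
by rewrite linearP iter_covD iter_covZ.
Qed.

Lemma cov_evalM p q x : cov_eval rho (p ** q) x = cov_eval rho p (cov_eval rho q x).
Proof.
have [n [pn qn]] := coef_fin2 p q.
have pqn k : (n + n <= k)%N -> (p ** q : twisted_poly alpha) k = 0.
  move=> nk; apply: big1 => j _; have [nj|jn] := leqP n j.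
    by rewrite qn// umul0r.
  rewrite pn ?iter_starhom0 ?umul0l// leq_subRL; last by rewrite -ltnS.
  by apply: leq_trans nk; rewrite addnC leq_add2l ltnW.
rewrite (cov_evalE _ pqn) (cov_evalE _ pn) (cov_evalE _ qn).
pose F i j := iter (i + j) V (pi (iter j alpha (p i) ** q j) x).
transitivity (\sum_(k < n + n) \sum_(j < k.+1) F (k - j)%N j).
  apply: eq_bigr => k _ /=.
  rewrite (big_morph (fun a => pi a x) (fun a b => repD pi a b x) (rep0 pi x)).
  rewrite (big_morph _ (iter_covD k) (iter_cov0 k)).
  by apply: eq_bigr => j _; rewrite /F subnK// -ltnS.
transitivity (\sum_(i < n) \sum_(j < n) F i j); last first.
  apply: eq_bigr => i _; rewrite linear_sum.
  rewrite (big_morph _ (iter_covD i) (iter_cov0 i)); apply: eq_bigr => j _.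
  by rewrite /F iterD repM rep_iter_cov.
have F0 i j : (n <= i)%N || (n <= j)%N -> F i j = 0.
  move=> /orP[/pn|/qn] nij; rewrite /F nij ?iter_starhom0 ?umul0l ?umul0r.
    by rewrite rep0 iter_cov0.
  by rewrite rep0 iter_cov0.
rewrite (sum_triangle (n + n) (fun k j => F (k - j)%N j)) exchange_big /=.
rewrite (@sum_truncate _ n _
  (fun l => \sum_(i < n + n - l) F (l + i - l)%N l)) ?leq_addr//; last first.
  by move=> l nl; apply: big1 => i _; rewrite F0// nl orbT.
apply: eq_bigr => l _; rewrite (@sum_truncate _ n _ (fun i => F (l + i - l)%N l)).
- by apply: eq_bigr => i _; rewrite addKn.
- by rewrite leq_subRL ?(leq_trans (ltnW (ltn_ord l)) (leq_addr _ _))// leq_add2r ltnW.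
- by move=> i ni; rewrite addKn F0// ni.
Qed.

End Eval.

Lemma opnorm_le (H : hilbertType R) (T : H -> H) (M : R) : 0 <= M ->
  (forall x, rnorm (T x) <= M * rnorm x) -> opnorm T <= M.
Proof.
move=> M0 TM; apply: ge_sup.
  by exists (rnorm (T 0)); exists 0 => //=; rewrite normr0 ler01.
move=> _ [x /= x1 <-]; apply: le_trans (TM x) _.
by rewrite ler_piMr// -lecR rnormE.
Qed.

Lemma le_opnorm (H : hilbertType R) (T : H -> H) (M : R) : 0 <= M ->
  (forall (c : R[i]) x, T (c *: x) = c *: T x) ->
  (forall x, rnorm (T x) <= M * rnorm x) ->
  forall x, rnorm (T x) <= opnorm T * rnorm x.
Proof.
move=> M0 TZ TM x; have [x0|x0] := eqVneq (rnorm x) 0.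
  by apply: le_trans (TM x) _; rewrite x0 !mulr0.
have xp : 0 < rnorm x by rewrite lt_neqAle eq_sym x0 rnorm_ge0.
have xV : rnorm ((rnorm x)^-1%:C : R[i]) = (rnorm x)^-1.
  by rewrite rnorm_real ger0_norm// invr_ge0 ltW.
rewrite -ler_pdivrMr// mulrC -{1}xV -rnormZ -TZ; apply: ub_le_sup.
  exists M => _ [y /= y1 <-]; apply: le_trans (TM y) _.
  by rewrite ler_piMr// -lecR rnormE.
by exists ((rnorm x)^-1%:C *: x) => //=; rewrite -rnormE rnormZ xV mulVf.
Qed.

Implicit Types p q : twisted_poly alpha.

Lemma cov_eval_bound p : exists2 M : R, 0 <= M &
  forall H (rho : covariant_rep alpha H) x, rnorm (cov_eval rho p x) <= M * rnorm x.
Proof.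
have [n pn] := coef_fin p; exists (\sum_(k < n) rnorm (p k)).
  by apply: sumr_ge0 => k _; exact: rnorm_ge0.
by move=> H rho x; exact: cov_eval_le.
Qed.

Lemma cov_eval_scale H (rho : covariant_rep alpha H) p (c : R[i]) x :
  cov_eval rho p (c *: x) = c *: cov_eval rho p x.
Proof.
have e0 : cov_eval rho p 0 = 0.
  by have := cov_eval_lin rho p (-1) 0 0; rewrite scaler0 addr0 scaleN1r addNr.
by have := cov_eval_lin rho p c x 0; rewrite e0 !addr0.
Qed.

Lemma semicrossed_norm_le p (M : R) : 0 <= M ->
  (forall H (rho : covariant_rep alpha H) x, rnorm (cov_eval rho p x) <= M * rnorm x) ->
  semicrossed_norm p <= M.
Proof.
move=> M0 hM; rewrite /semicrossed_norm; set S := (X in sup X).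
have [->|S0] := eqVneq S set0; first by rewrite sup0.
apply: ge_sup; first by apply/set0P.
by move=> _ [H [rho ->]]; apply: opnorm_le => // x; exact: hM.
Qed.

Lemma le_semicrossed_norm p H (rho : covariant_rep alpha H) x :
  rnorm (cov_eval rho p x) <= semicrossed_norm p * rnorm x.
Proof.
have [M M0 hM] := cov_eval_bound p.
apply: le_trans (le_opnorm M0 (cov_eval_scale rho p) (hM H rho) x) _.
rewrite ler_wpM2r ?rnorm_ge0//; apply: ub_le_sup; last by exists H, rho.
by exists M => _ [K [sigma ->]]; exact: opnorm_le.
Qed.

Lemma semicrossed_norm_ge0 p : 0 <= semicrossed_norm p.
Proof.
rewrite /semicrossed_norm; set S := (X in sup X).
have [->|/set0P[r Sr]] := eqVneq S set0; first by rewrite sup0.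
have [M M0 hM] := cov_eval_bound p.
have SM : has_ubound S by exists M => _ [K [sigma ->]]; exact: opnorm_le.
apply: le_trans (ub_le_sup SM Sr); case: Sr => H [rho ->].
apply: le_trans (rnorm_ge0 (cov_eval rho p 0)) _; apply: ub_le_sup.
  exists M => _ [y /= y1 <-]; apply: le_trans (hM H rho y) _.
  by rewrite ler_piMr// -lecR rnormE.
by exists 0 => //=; rewrite normr0 ler01.
Qed.

Fact semicrossed_normD p q :
  semicrossed_norm (p + q) <= semicrossed_norm p + semicrossed_norm q.
Proof.
apply: semicrossed_norm_le => [|H rho x]; first by rewrite addr_ge0 ?semicrossed_norm_ge0.
rewrite cov_evalD mulrDl; apply: le_trans (rnormD _ _) _.
by apply: lerD; exact: le_semicrossed_norm.
Qed.

Fact semicrossed_normM p q :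
  semicrossed_norm (p ** q) <= semicrossed_norm p * semicrossed_norm q.
Proof.
apply: semicrossed_norm_le => [|H rho x]; first by rewrite mulr_ge0 ?semicrossed_norm_ge0.
rewrite cov_evalM -mulrA; apply: le_trans (le_semicrossed_norm _ _ _) _.
by rewrite ler_wpM2l ?semicrossed_norm_ge0// le_semicrossed_norm.
Qed.

Fact semicrossed_normZ (c : R[i]) p :
  semicrossed_norm (c *: p) = rnorm c * semicrossed_norm p.
Proof.
have le d q : semicrossed_norm (d *: q) <= rnorm d * semicrossed_norm q.
  apply: semicrossed_norm_le => [|H rho x].
    by rewrite mulr_ge0 ?semicrossed_norm_ge0 ?rnorm_ge0.
  by rewrite cov_evalZ rnormZ -mulrA ler_wpM2l ?rnorm_ge0// le_semicrossed_norm.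
apply/eqP; rewrite eq_le le /=; have [->|c0] := eqVneq c 0.
  by rewrite rnorm0 mul0r semicrossed_norm_ge0.
have cp : 0 < rnorm c.
  rewrite lt_neqAle rnorm_ge0 andbT eq_sym; apply: contra_neq c0.
  exact: rnorm0_eq0.
have cV : rnorm (c^-1) = (rnorm c)^-1.
  by apply: (complexI (R := R)); rewrite rnormE normfV -rnormE fmorphV.
by rewrite mulrC -ler_pdivlMr// mulrC -cV -{1}[p](scale1r p) -(mulVf c0) -scalerA le.
Qed.

End SemicrossedNorm.
End Representations.

HB.mixin Record isSeminormedAlgebra (R : realType) P & UnitalAlgebra R P := {
  seminorm : P -> R;
  seminormD : forall p q, seminorm (p + q) <= seminorm p + seminorm q;
  seminormZ : forall (c : R[i]) p, seminorm (c *: p) = rnorm c * seminorm p;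
  seminormM : forall p q, seminorm (p ** q) <= seminorm p * seminorm q
}.
#[short(type="seminormedAlgType")]
HB.structure Definition SeminormedAlgebra (R : realType) :=
  {P of isSeminormedAlgebra R P & UnitalAlgebra R P}.

Section SeminormTheory.
Variables (R : realType) (P : seminormedAlgType R).
Implicit Types p q : P.

Lemma seminorm0 : seminorm (0 : P) = 0.
Proof. by rewrite -(scale0r (0 : P)) seminormZ rnorm0 mul0r. Qed.

Lemma seminormN p : seminorm (- p) = seminorm p.
Proof.
by rewrite -scaleN1r seminormZ rnormN -[1]/(1%:C) rnorm_real normr1 mul1r.
Qed.

Lemma seminorm_ge0 p : 0 <= seminorm p.
Proof.
rewrite -(pmulr_rge0 _ (ltr0Sn R 1)) mulr_natl mulr2n -{2}[p]opprK seminormN.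
by apply: le_trans (seminormD _ _); rewrite subrr seminorm0.
Qed.

Lemma seminormB p q : seminorm (p - q) = seminorm (q - p).
Proof. by rewrite -seminormN opprB. Qed.

Lemma seminorm_tri q p r : seminorm (p - r) <= seminorm (p - q) + seminorm (q - r).
Proof. by apply: le_trans (seminormD _ _); rewrite addrA subrK. Qed.

Lemma seminorm_dist p q : `|seminorm p - seminorm q| <= seminorm (p - q).
Proof.
have le x y : seminorm x - seminorm y <= seminorm (x - y).
  by rewrite lerBlDr -{1}[x](subrK y) seminormD.
by rewrite ler_norml le andbT lerNl opprB seminormB le.
Qed.

Lemma seminorm_mulB p q p' q' : seminorm (p ** q - p' ** q') <=
  seminorm p * seminorm (q - q') + seminorm (p - p') * seminorm q'.
Proof.
have -> : p ** q - p' ** q' = p ** (q - q') + (p - p') ** q'.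
  by rewrite umulDr umulDl umulNr umulNl addrA subrK.
by apply: le_trans (seminormD _ _) _; apply: lerD; exact: seminormM.
Qed.

End SeminormTheory.

Definition cauchy_seq (R : realType) (P : seminormedAlgType R) (s : nat -> P) :=
  forall e : R, 0 < e -> exists n, forall i j,
    (n <= i)%N -> (n <= j)%N -> seminorm (s i - s j) < e.

Definition null_seq (R : realType) (P : seminormedAlgType R) (s : nat -> P) :=
  forall e : R, 0 < e -> exists n, forall i, (n <= i)%N -> seminorm (s i) < e.

(* The completion of a seminormed algebra: Cauchy sequences modulo null       *)
(* sequences, with the pointwise operations and the norm lim |s_n|.           *)
Section Completion.
Variables (R : realType) (P : seminormedAlgType R).

Record cseq := CSeq { cseq_fun :> nat -> P; cseqP : cauchy_seq cseq_fun }.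

HB.instance Definition _ := gen_eqMixin cseq.
HB.instance Definition _ := gen_choiceMixin cseq.

Implicit Types s t u : cseq.

Definition cseq_equiv s t : bool := `[< null_seq (fun n => s n - t n) >].

Lemma cseq_equiv_refl : reflexive cseq_equiv.
Proof.
by move=> s; apply/asboolP => e e0; exists 0%N => i _; rewrite subrr seminorm0.
Qed.

Lemma cseq_equiv_sym : symmetric cseq_equiv.
Proof.
have sub s t : cseq_equiv s t -> cseq_equiv t s.
  move=> /asboolP st; apply/asboolP => e /st[n hn].
  by exists n => i /hn; rewrite seminormB.
by move=> s t; apply/idP/idP => /sub.
Qed.

Lemma cseq_equiv_trans : transitive cseq_equiv.
Proof.
move=> t s u /asboolP st /asboolP tu; apply/asboolP => e e0.
have [|n hn] := st (e / 2); first by rewrite divr_gt0.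
have [|m hm] := tu (e / 2); first by rewrite divr_gt0.
exists (maxn n m) => i; rewrite geq_max => /andP[/hn ? /hm ?].
by rewrite [e]splitr; apply: le_lt_trans (seminorm_tri (t i) _ _) (ltrD _ _).
Qed.

Canonical cseq_equiv_rel :=
  EquivRel cseq_equiv cseq_equiv_refl cseq_equiv_sym cseq_equiv_trans.

Definition completion := {eq_quot cseq_equiv_rel}%qT.
HB.instance Definition _ := Choice.on completion.

Definition cclass s : completion := (\pi s)%qT.

Lemma cclassP s t : reflect (null_seq (fun n => s n - t n)) (cclass s == cclass t).
Proof. by rewrite /cclass eqmodE; exact: asboolP. Qed.

Lemma cclass_repr (x : completion) : cclass (repr x) = x.
Proof. exact: reprK. Qed.

Lemma repr_cclass s : null_seq (fun n => repr (cclass s) n - s n).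
Proof. by apply/cclassP; rewrite cclass_repr. Qed.

Lemma eq_cclass s t : s =1 t -> cclass s = cclass t.
Proof.
move=> st; apply/eqP/cclassP => e e0; exists 0%N => i _.
by rewrite st subrr seminorm0.
Qed.

Lemma cseq_bound s : exists2 M : R, 0 < M & forall i, seminorm (s i) <= M.
Proof.
have [n hn] := cseqP s ltr01.
exists (\sum_(i < n.+1) seminorm (s i) + 1) => [|i].
  by rewrite ltr_wpDl// sumr_ge0// => i _; exact: seminorm_ge0.
have [ni|] := leqP i n.
  rewrite (bigD1 (Ordinal (ni : (i < n.+1)%N)))//=.
  rewrite -addrA lerDl addr_ge0// sumr_ge0// => j _; exact: seminorm_ge0.
move=> /ltnW ni; rewrite -[s i](subrK (s n)); apply: le_trans (seminormD _ _) _.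
rewrite addrC; apply: lerD; last exact: ltW (hn _ _ ni (leqnn n)).
by rewrite big_ord_recr /= lerDr sumr_ge0// => j _; exact: seminorm_ge0.
Qed.

Fact cauchy_cst (p : P) : cauchy_seq (fun=> p).
Proof. by move=> e e0; exists 0%N => i j _ _; rewrite subrr seminorm0. Qed.

Fact cauchy_opp s : cauchy_seq (fun n => - s n).
Proof.
move=> e /(cseqP s)[n hn]; exists n => i j ni nj.
by rewrite -opprB seminormN opprK addrC hn.
Qed.

Fact cauchy_add s t : cauchy_seq (fun n => s n + t n).
Proof.
move=> e e0; have e2 : 0 < e / 2 by rewrite divr_gt0.
have [n hn] := cseqP s e2; have [m hm] := cseqP t e2.
exists (maxn n m) => i j; rewrite !geq_max => /andP[ni mi] /andP[nj mj].
rewrite opprD addrACA [e]splitr; apply: le_lt_trans (seminormD _ _) (ltrD _ _).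
  exact: hn.
exact: hm.
Qed.

Fact cauchy_scale (c : R[i]) s : cauchy_seq (fun n => c *: s n).
Proof.
move=> e e0; have c1 : 0 < rnorm c + 1 by rewrite ltr_wpDl// rnorm_ge0.
have [|n hn] := cseqP s (e := e / (rnorm c + 1)); first by rewrite divr_gt0.
exists n => i j ni nj; rewrite -scalerBr seminormZ.
apply: le_lt_trans (_ : (rnorm c + 1) * seminorm (s i - s j) < e).
  by rewrite ler_wpM2r ?seminorm_ge0// lerDl.
by rewrite mulrC -ltr_pdivlMr// hn.
Qed.

Fact cauchy_mul s t : cauchy_seq (fun n => s n ** t n).
Proof.
move=> e e0; have [M M0 hM] := cseq_bound s; have [N N0 hN] := cseq_bound t.
have [|n hn] := cseqP t (e := e / 2 / M); first by rewrite !divr_gt0.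
have [|m hm] := cseqP s (e := e / 2 / N); first by rewrite !divr_gt0.
exists (maxn n m) => i j; rewrite !geq_max => /andP[ni mi] /andP[nj mj].
apply: le_lt_trans (seminorm_mulB _ _ _ _) _; rewrite [e]splitr; apply: ltrD.
  apply: le_lt_trans (_ : M * seminorm (t i - t j) < _).
    by rewrite ler_wpM2r ?seminorm_ge0.
  by rewrite mulrC -ltr_pdivlMr// hn.
apply: le_lt_trans (_ : seminorm (s i - s j) * N < _).
  by rewrite ler_wpM2l ?seminorm_ge0.
by rewrite -ltr_pdivlMr// hm.
Qed.

Definition completion_incl (p : P) := cclass (CSeq (cauchy_cst p)).

Definition completion_opp (x : completion) := cclass (CSeq (cauchy_opp (repr x))).
Definition completion_add (x y : completion) :=
  cclass (CSeq (cauchy_add (repr x) (repr y))).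
Definition completion_scale c (x : completion) :=
  cclass (CSeq (cauchy_scale c (repr x))).
Definition completion_mul (x y : completion) :=
  cclass (CSeq (cauchy_mul (repr x) (repr y))).

Lemma completion_oppE s : completion_opp (cclass s) = cclass (CSeq (cauchy_opp s)).
Proof.
apply/eqP/cclassP => e /(repr_cclass s)[n hn]; exists n => i /hn /=.
by rewrite -opprD seminormN.
Qed.

Lemma completion_addE s t :
  completion_add (cclass s) (cclass t) = cclass (CSeq (cauchy_add s t)).
Proof.
apply/eqP/cclassP => e e0; have e2 : 0 < e / 2 by rewrite divr_gt0.
have [n hn] := repr_cclass s e2; have [m hm] := repr_cclass t e2.
exists (maxn n m) => i; rewrite geq_max => /andP[/hn ? /hm ?] /=.
by rewrite opprD addrACA [e]splitr; apply: le_lt_trans (seminormD _ _) (ltrD _ _).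
Qed.

Lemma completion_scaleE c s :
  completion_scale c (cclass s) = cclass (CSeq (cauchy_scale c s)).
Proof.
apply/eqP/cclassP => e e0; have c1 : 0 < rnorm c + 1 by rewrite ltr_wpDl// rnorm_ge0.
have [|n hn] := repr_cclass s (e := e / (rnorm c + 1)); first by rewrite divr_gt0.
exists n => i ni /=; rewrite -scalerBr seminormZ.
apply: le_lt_trans (_ : (rnorm c + 1) * seminorm (repr (cclass s) i - s i) < e).
  by rewrite ler_wpM2r ?seminorm_ge0// lerDl.
by rewrite mulrC -ltr_pdivlMr// hn.
Qed.

Lemma completion_mulE s t :
  completion_mul (cclass s) (cclass t) = cclass (CSeq (cauchy_mul s t)).
Proof.
apply/eqP/cclassP => e e0 /=.
have [M M0 hM] := cseq_bound (repr (cclass s)); have [N N0 hN] := cseq_bound t.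
have [|n hn] := repr_cclass t (e := e / 2 / M); first by rewrite !divr_gt0.
have [|m hm] := repr_cclass s (e := e / 2 / N); first by rewrite !divr_gt0.
exists (maxn n m) => i; rewrite geq_max => /andP[ni mi].
apply: le_lt_trans (seminorm_mulB _ _ _ _) _; rewrite [e]splitr; apply: ltrD.
  apply: le_lt_trans (_ : M * seminorm (repr (cclass t) i - t i) < _).
    by rewrite ler_wpM2r ?seminorm_ge0.
  by rewrite mulrC -ltr_pdivlMr// hn.
apply: le_lt_trans (_ : seminorm (repr (cclass s) i - s i) * N < _).
  by rewrite ler_wpM2l ?seminorm_ge0.
by rewrite -ltr_pdivlMr// hm.
Qed.

Lemma completionW (Q : completion -> Prop) : (forall s, Q (cclass s)) -> forall x, Q x.
Proof. by move=> h x; rewrite -(cclass_repr x). Qed.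

Fact completion_addA : associative completion_add.
Proof.
elim/completionW => s; elim/completionW => t; elim/completionW => u.
by rewrite !completion_addE; apply: eq_cclass => n /=; rewrite addrA.
Qed.
Fact completion_addC : commutative completion_add.
Proof.
elim/completionW => s; elim/completionW => t.
by rewrite !completion_addE; apply: eq_cclass => n /=; rewrite addrC.
Qed.
Fact completion_add0 : left_id (completion_incl 0) completion_add.
Proof.
elim/completionW => s.
by rewrite completion_addE; apply: eq_cclass => n /=; rewrite add0r.
Qed.
Fact completion_addN : left_inverse (completion_incl 0) completion_opp completion_add.
Proof.
elim/completionW => s; rewrite completion_oppE.
by rewrite completion_addE; apply: eq_cclass => n /=; rewrite addNr.
Qed.

HB.instance Definition _ := GRing.isZmodule.Build completion
  completion_addA completion_addC completion_add0 completion_addN.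

Lemma cclassD s t : cclass s + cclass t = cclass (CSeq (cauchy_add s t)).
Proof. exact: completion_addE. Qed.
Lemma cclassN s : - cclass s = cclass (CSeq (cauchy_opp s)).
Proof. exact: completion_oppE. Qed.

Fact completion_scaleA c d x :
  completion_scale c (completion_scale d x) = completion_scale (c * d) x.
Proof.
elim/completionW: x => s.
by rewrite !completion_scaleE; apply: eq_cclass => n /=; rewrite scalerA.
Qed.
Fact completion_scale1 : left_id 1 completion_scale.
Proof.
elim/completionW => s.
by rewrite completion_scaleE; apply: eq_cclass => n /=; rewrite scale1r.
Qed.
Fact completion_scaleDr : right_distributive completion_scale +%R.
Proof.
move=> c; elim/completionW => s; elim/completionW => t.
rewrite cclassD !completion_scaleE cclassD.
by apply: eq_cclass => n /=; rewrite scalerDr.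
Qed.
Fact completion_scaleDl x : {morph completion_scale^~ x : c d / c + d}.
Proof.
elim/completionW: x => s c d /=; rewrite !completion_scaleE cclassD.
by apply: eq_cclass => n /=; rewrite scalerDl.
Qed.

HB.instance Definition _ := GRing.Zmodule_isLmodule.Build R[i] completion
  completion_scaleA completion_scale1 completion_scaleDr completion_scaleDl.

Lemma cclassZ c s : c *: cclass s = cclass (CSeq (cauchy_scale c s)).
Proof. exact: completion_scaleE. Qed.

Fact completion_mulA : associative completion_mul.
Proof.
elim/completionW => s; elim/completionW => t; elim/completionW => u.
by rewrite !completion_mulE; apply: eq_cclass => n /=; rewrite umulA.
Qed.
Fact completion_mul1l : left_id (completion_incl uone) completion_mul.
Proof.
elim/completionW => s.
by rewrite completion_mulE; apply: eq_cclass => n /=; rewrite umul1l.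
Qed.
Fact completion_mul1r : right_id (completion_incl uone) completion_mul.
Proof.
elim/completionW => s.
by rewrite completion_mulE; apply: eq_cclass => n /=; rewrite umul1r.
Qed.
Fact completion_mulDl : left_distributive completion_mul +%R.
Proof.
elim/completionW => s; elim/completionW => t; elim/completionW => u.
rewrite cclassD !completion_mulE cclassD.
by apply: eq_cclass => n /=; rewrite umulDl.
Qed.
Fact completion_mulDr : right_distributive completion_mul +%R.
Proof.
elim/completionW => s; elim/completionW => t; elim/completionW => u.
rewrite cclassD !completion_mulE cclassD.
by apply: eq_cclass => n /=; rewrite umulDr.
Qed.
Fact completion_mulZl (c : R[i]) x y :
  completion_mul (c *: x) y = c *: completion_mul x y.
Proof.
elim/completionW: x => s; elim/completionW: y => t.
rewrite cclassZ !completion_mulE cclassZ.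
by apply: eq_cclass => n /=; rewrite umulZl.
Qed.
Fact completion_mulZr (c : R[i]) x y :
  completion_mul x (c *: y) = c *: completion_mul x y.
Proof.
elim/completionW: x => s; elim/completionW: y => t.
rewrite cclassZ !completion_mulE cclassZ.
by apply: eq_cclass => n /=; rewrite umulZr.
Qed.

HB.instance Definition _ := isUnitalAlgebra.Build R completion
  completion_mulA completion_mul1l completion_mul1r completion_mulDl
  completion_mulDr completion_mulZl completion_mulZr.

Lemma cclassM s t : cclass s ** cclass t = cclass (CSeq (cauchy_mul s t)).
Proof. exact: completion_mulE. Qed.

Definition completion_rnorm (x : completion) : R :=
  lim ((fun n => seminorm (repr x n)) @ \oo).

Lemma cvg_seminorm s :
  (fun n => seminorm (s n)) @ \oo --> completion_rnorm (cclass s).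
Proof.
have cv t : cvg ((fun n => seminorm (t n)) @ \oo).
  apply: cauchy_cvg; apply: cauchy_exP => e /= /(cseqP t)[n hn].
  exists (seminorm (t n)); exists n => // i /= ni.
  by rewrite -ball_normE /=; apply: le_lt_trans (seminorm_dist _ _) (hn _ _ _ _).
have := cv (repr (cclass s)); rewrite -/(completion_rnorm _).
move=> /cvgrPdist_lt cl; apply/cvgrPdist_lt => e e0.
have e2 : 0 < e / 2 by rewrite divr_gt0.
have [n _ hn] := cl _ e2; have [m hm] := repr_cclass s e2.
exists (maxn n m) => // i /=; rewrite geq_max => /andP[ni mi].
rewrite [e]splitr; apply: le_lt_trans (ler_distD (seminorm (repr (cclass s) i)) _ _) _.
by apply: ltrD; [exact: hn|apply: le_lt_trans (seminorm_dist _ _) (hm _ mi)].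
Qed.

Lemma completion_rnorm_ge0 x : 0 <= completion_rnorm x.
Proof.
elim/completionW: x => s; apply: limr_ge; first by apply/cvg_ex; eexists; exact: cvg_seminorm.
by exists 0%N => // n _; exact: seminorm_ge0.
Qed.

Lemma completion_rnorm_lt s (e : R) : completion_rnorm (cclass s) < e ->
  exists n, forall i, (n <= i)%N -> seminorm (s i) < e.
Proof.
move=> se; have /cvgrPdist_lt := @cvg_seminorm s.
have e0 : 0 < e - completion_rnorm (cclass s) by rewrite subr_gt0.
move=> /(_ _ e0)[n _ hn]; exists n => i /hn /=.
by rewrite distrC => /(le_lt_trans (ler_norm _)); rewrite ltrD2r.
Qed.

Lemma completion_rnorm_le s (e : R) :
  (exists n, forall i, (n <= i)%N -> seminorm (s i) <= e) ->
  completion_rnorm (cclass s) <= e.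
Proof.
move=> [n hn]; apply/ler_addgt0Pr => d d0.
have /cvgrPdist_lt := @cvg_seminorm s => /(_ _ d0)[m _ hm].
have := hm _ (leq_maxr n m); have := hn _ (leq_maxl n m) => /= h.
by move=> /(le_lt_trans (ler_norm _)) => h'; lra.
Qed.

Fact completion_rnormD x y :
  completion_rnorm (x + y) <= completion_rnorm x + completion_rnorm y.
Proof.
elim/completionW: x => s; elim/completionW: y => t; rewrite cclassD.
apply/ler_addgt0Pr => e e0; have e2 : 0 < e / 2 by rewrite divr_gt0.
have [|n hn] := @completion_rnorm_lt s (completion_rnorm (cclass s) + e / 2).
  by rewrite ltrDl.
have [|m hm] := @completion_rnorm_lt t (completion_rnorm (cclass t) + e / 2).
  by rewrite ltrDl.
apply: completion_rnorm_le; exists (maxn n m) => i.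
rewrite geq_max => /andP[/hn ? /hm ?]; apply: le_trans (seminormD _ _) _.
lra.
Qed.

Fact completion_rnormM x y :
  completion_rnorm (x ** y) <= completion_rnorm x * completion_rnorm y.
Proof.
elim/completionW: x => s; elim/completionW: y => t; rewrite cclassM.
have hs := @cvg_seminorm s; have ht := @cvg_seminorm t.
have hst := @cvg_seminorm (CSeq (cauchy_mul s t)).
have hM : (fun n => seminorm (s n) * seminorm (t n)) @ \oo -->
    completion_rnorm (cclass s) * completion_rnorm (cclass t) by exact: cvgM.
rewrite -(cvg_lim _ hst)// -(cvg_lim _ hM)//; apply: ler_lim.
- by apply/cvg_ex; eexists; exact: hst.
- by apply/cvg_ex; eexists; exact: hM.
- by exists 0%N => // n _; exact: seminormM.
Qed.

Fact completion_rnormZ (c : R[i]) x :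
  completion_rnorm (c *: x) = rnorm c * completion_rnorm x.
Proof.
elim/completionW: x => s; rewrite cclassZ.
have h := @cvg_seminorm (CSeq (cauchy_scale c s)).
have h' : (fun n => rnorm c * seminorm (s n)) @ \oo -->
    rnorm c * completion_rnorm (cclass s).
  by apply: cvgM; [exact: cvg_cst|exact: cvg_seminorm].
rewrite -(cvg_lim _ h)// -(cvg_lim _ h')//; congr (lim (_ @ \oo)).
by apply/funext => n /=; rewrite seminormZ.
Qed.

Fact completion_rnorm0_eq0 x : completion_rnorm x = 0 -> x = 0.
Proof.
elim/completionW: x => s s0; apply/eqP; rewrite /GRing.zero /=; apply/cclassP => e e0.
have [|n hn] := @completion_rnorm_lt s e; first by rewrite s0.
by exists n => i /hn; rewrite /= subr0.
Qed.

Definition completion_norm x : R[i] := (completion_rnorm x)%:C.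

Fact completion_normD x y :
  completion_norm (x + y) <= completion_norm x + completion_norm y.
Proof. by rewrite -rmorphD lecR completion_rnormD. Qed.
Fact completion_normZ (c : R[i]) x :
  completion_norm (c *: x) = `|c| * completion_norm x.
Proof. by rewrite /completion_norm completion_rnormZ rmorphM /= rnormE. Qed.
Fact completion_norm0_eq0 x : completion_norm x = 0 -> x = 0.
Proof. by move=> /(@complexI _ _ 0); exact: completion_rnorm0_eq0. Qed.

HB.instance Definition _ := Lmodule_isNormed.Build R[i] completion
  completion_normD completion_normZ completion_norm0_eq0.

Lemma completion_normE (x : completion) : `|x| = (completion_rnorm x)%:C.
Proof. by []. Qed.

Lemma completion_incl_norm (p : P) : `|completion_incl p| = (seminorm p)%:C.
Proof.
rewrite completion_normE; congr (_%:C).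
have h := @cvg_seminorm (CSeq (cauchy_cst p)).
have h' : (fun _ : nat => seminorm p) @ \oo --> seminorm p by exact: cvg_cst.
by rewrite -[LHS](cvg_lim _ h)// -[RHS](cvg_lim _ h').
Qed.

Lemma completion_dense (x : completion) (e : R) : 0 < e ->
  exists p, `|x - completion_incl p| < e%:C.
Proof.
elim/completionW: x => s e0.
have [|n hn] := cseqP s (e := e / 2); first by rewrite divr_gt0.
exists (s n); rewrite completion_normE ltcR cclassN cclassD.
apply: le_lt_trans (_ : e / 2 < e); last by lra.
by apply: completion_rnorm_le; exists n => i ni; apply/ltW/hn.
Qed.

Fact completion_complete (F : set_system completion) :
  ProperFilter F -> cauchy F -> cvg F.
Proof.
move=> FF /cauchyP Fc.
have d0 n : 0 < n.+1%:R^-1 :> R by rewrite invr_gt0 ltr0Sn.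
have near_p n : exists p : P,
    \forall x \near F, `|x - completion_incl p| < (n.+1%:R^-1 : R)%:C.
  have d2 : 0 < n.+1%:R^-1 / 2 :> R by rewrite divr_gt0.
  have [|x Fx] := Fc ((n.+1%:R^-1 : R) / 2)%:C; first by rewrite ltcR.
  have [p xp] := completion_dense x d2; exists p.
  apply: filterS Fx => y; rewrite -ball_normE /= distrC => yx.
  rewrite [n.+1%:R^-1]splitr rmorphD /=.
  rewrite -[y](subrK x) -addrA; by apply: le_lt_trans (ler_normD _ _) (ltrD _ _).
pose p n := sval (cid (near_p n)).
have pF n : \forall x \near F, `|x - completion_incl (p n)| < (n.+1%:R^-1 : R)%:C.
  exact: (svalP (cid (near_p n))).
have inclB q r : completion_incl q - completion_incl r = completion_incl (q - r).
  by rewrite cclassN cclassD; exact: eq_cclass.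
have small (e : R) : 0 < e -> exists n, forall i, (n <= i)%N -> i.+1%:R^-1 < e.
  move=> e0; have := @cvg_harmonic R => /cvgrPdist_lt /(_ _ e0)[n _ hn].
  exists n => i /hn; rewrite /= sub0r normrN ger0_norm// invr_ge0 ler0n//.
have pC : cauchy_seq p.
  move=> e e0; have [|n hn] := small (e / 2); first by rewrite divr_gt0.
  exists n => i j ni nj; have [x [xi xj]] := filter_ex (filterI (pF i) (pF j)).
  rewrite -ltcR -completion_incl_norm -inclB.
  rewrite -(subrK x (completion_incl (p i))) -addrA.
  apply: le_lt_trans (ler_normD _ _) _; rewrite [e]splitr rmorphD /=.
  apply: ltrD; [rewrite distrC; apply: lt_trans xi _|apply: lt_trans xj _].
    by rewrite ltcR hn.
  by rewrite ltcR hn.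
apply/cvg_ex; exists (cclass (CSeq pC)); apply/fcvgrPdist_lt => e e0 /=.
have eE : e = (complex.Re e)%:C by rewrite RRe_real// gtr0_real.
have e1 : 0 < complex.Re e by rewrite -ltcR -eE.
have e2 : 0 < complex.Re e / 2 by rewrite divr_gt0.
have e3 : 0 < complex.Re e / 2 / 2 by rewrite divr_gt0.
have [n hn] := small _ e2; have [m hm] := pC _ e3.
pose k := maxn n m.
apply: filterS (pF k) => x xk; rewrite eE -(subrK (completion_incl (p k)) (cclass _)).
rewrite -addrA [complex.Re e]splitr rmorphD /=.
apply: le_lt_trans (ler_normD _ _) (ltrD _ _); last first.
  by rewrite distrC; apply: lt_trans xk _; rewrite ltcR hn// leq_maxl.
rewrite completion_normE ltcR cclassN cclassD.
apply: le_lt_trans (_ : complex.Re e / 2 / 2 < _).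
  apply: completion_rnorm_le; exists m => i mi.
  by apply/ltW/hm => //=; exact: leq_maxr.
by rewrite [ltRHS]splitr ltrDl.
Qed.

HB.instance Definition _ := Uniform_isComplete.Build completion completion_complete.

Fact completion_normM (x y : completion) : `|x ** y| <= `|x| * `|y|.
Proof. by rewrite !completion_normE -rmorphM lecR completion_rnormM. Qed.

HB.instance Definition _ := isBanachAlgebra.Build R completion completion_normM.

End Completion.

HB.instance Definition _ (R : realType) (A : cstarAlgType R)
    (alpha : starHom A A) :=
  isSeminormedAlgebra.Build R (twisted_poly alpha)
    (@semicrossed_normD R A alpha) (@semicrossed_normZ R A alpha)
    (@semicrossed_normM R A alpha).

Definition semicrossed_product (R : realType) (A : cstarAlgType R)
  (alpha : starHom A A) : banachAlgType R := completion (twisted_poly alpha).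

Definition isometrically_isomorphic (R : realType) (X Y : banachAlgType R) :=
  exists phi : {linear X -> Y},
    [/\ bijective phi, forall x y, phi (x ** y) = phi x ** phi y &
        forall x, `|phi x| = `|x|].

Definition unitary (R : realType) (A : cstarAlgType R) (v : A) :=
  star v ** v = uone /\ v ** star v = uone.

Definition outer_conjugate (R : realType) (A B : cstarAlgType R)
    (alpha : starHom A A) (beta : starHom B B) :=
  exists (gamma : starHom A B) (gammaV : B -> A) (v : A),
    [/\ cancel gamma gammaV, cancel gammaV gamma, unitary v &
        forall a, alpha a = v ** gammaV (beta (gamma a)) ** star v].

(* Main.v *)
(* Let [phi] be an isometric isomorphism of the semicrossed products. A       *)
(* contraction with contractive inverse has no Fourier coefficient of positive *)
(* degree, so [phi] maps unitaries of [A] into [B] and restricts to a          *)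
(* star-isomorphism [gamma : A -> B]. Write [T] for the image of the generator *)
(* of the first product, [W] for the generator of the second one, and          *)
(* [T = t0 + W t1 + ...]. Then [beta (gamma a) t1 = t1 gamma (alpha a)], so if *)
(* [t1] is invertible its unitary part implements the outer conjugacy.         *)
(* A Schwarz-Pick argument gives [|t0| < 1]; since left multiplication by [T]  *)
(* is isometric, [T - t0] is bounded below. The elements without constant      *)
(* coefficient are the limits of elements of [(T - t0) Y], because the product *)
(* [Y] is also generated by [B] and [T]. Applied to [W], this makes [t1]       *)
(* almost right invertible; applied twice to [(T - t0) x - W t1 x], which      *)
(* vanishes to second order, it bounds [x] by a multiple of [t1 x].            *)
(* That the coefficient maps are contractive requires enough Hilbert space     *)
(* representations, i.e. the Gelfand-Naimark theorem: positivity of            *)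
(* [star x ** x] (Kelley-Vaught), norming states, and the GNS construction.    *)

(* The converse implication is a change of generator. Given [gamma] and [v], put
   [u = star (gamma v)] and let [W] be the generator of the second product: [a] goes to [gamma a]
   and the first generator to [W u], which on polynomials is [twist]. Covariant representations of
   either system can be transported to the other along this substitution, so [twist] preserves the
   norm ([twist_norm]) and extends to the completions ([isometric_extension]).

   For the direct implication, coefficient maps are needed. A covariant pair on a mere semi-inner
   product space already bounds the norm from below ([peval_le]): orbit representations give
   [coef_le] and [fcoef_pair_le], a weighted shift gives [schwarz_le], and a dilation of the
   contraction makes left multiplication by the generator isometric ([rnorm_svarM]). Estimates in a
   coefficient algebra are tested on GNS vectors ([rnorm_le_gns]), hence rest on [norming_state] and
   [pos_star_mul].

   With these tools [iso_sconst] and [diag_star] show that the isomorphism carries [A] onto [B],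
   star included. Then [rnorm_t0_lt1], [t1_below] and [t1_inverse] make the first coefficient of the
   image [T] of the generator invertible, and [polar_unitary] replaces it by a unitary with the same
   intertwining relation ([outer_conjugate_of_iso]). *)
From HB Require Import structures.
Require Import Defs.
From mathcomp Require Import all_boot all_order all_algebra complex.
From mathcomp Require Import boolp classical_sets functions.
From mathcomp Require Import reals topology normedtype sequences.
From mathcomp Require Import ring lra.

Set Implicit Arguments.
Unset Strict Implicit.
Unset Printing Implicit Defensive.

Import Order.TTheory GRing.Theory Num.Theory numFieldNormedType.Exports.

Local Open Scope ring_scope.
Local Open Scope complex_scope.

(* A module embeds in its trivial extension, where [ring] proves linear        *)
(* identities between module elements.                                        *)
Section TrivialExtension.
Variables (K : comNzRingType) (E : lmodType K).

Definition trivext := (K^o * E)%type.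
HB.instance Definition _ := GRing.Lmodule.on trivext.
Definition trivext_mul (u v : trivext) : trivext :=
  (u.1 * v.1 , (u.1 : K) *: v.2 + (v.1 : K) *: u.2).
Definition trivext_one : trivext := (1, 0).

Fact trivext_mulA : associative trivext_mul.
Proof.
move=> [a x] [b y] [c z]; rewrite /trivext_mul /= mulrA; congr pair.
by rewrite !scalerDr !scalerA addrA [a * c]mulrC [b * c]mulrC.
Qed.
Fact trivext_mulC : commutative trivext_mul.
Proof. by move=> [a x] [b y]; rewrite /trivext_mul /= mulrC addrC. Qed.
Fact trivext_mul1 : left_id trivext_one trivext_mul.
Proof. by move=> [a x]; rewrite /trivext_mul /= mul1r scale1r scaler0 addr0. Qed.
Fact trivext_mulD : left_distributive trivext_mul +%R.
Proof.
move=> [a x] [b y] [c z]; rewrite /trivext_mul /= mulrDl scalerDl scalerDr.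
by congr pair; rewrite addrACA.
Qed.
Fact trivext_1_neq0 : trivext_one != 0.
Proof. by apply/eqP => -[/eqP]; rewrite oner_eq0. Qed.

HB.instance Definition _ := GRing.Zmodule_isComNzRing.Build trivext
  trivext_mulA trivext_mulC trivext_mul1 trivext_mulD trivext_1_neq0.

Definition trivl (c : K) : trivext := (c, 0).
Definition trivr (x : E) : trivext := (0, x).

Lemma trivr_inj : injective trivr. Proof. by move=> x y []. Qed.
Lemma trivrD x y : trivr (x + y) = trivr x + trivr y.
Proof. by congr pair; rewrite /= ?addr0. Qed.
Lemma trivrN x : trivr (- x) = - trivr x.
Proof. by congr pair; rewrite /= ?oppr0. Qed.
Lemma trivr0 : trivr 0 = 0. Proof. by []. Qed.
Lemma trivrZ c x : trivr (c *: x) = trivl c * trivr x.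
Proof. by congr pair; rewrite /= ?mulr0// scale0r addr0. Qed.

Fact trivlB : {morph trivl : c d / c - d}.
Proof. by move=> c d; congr pair; rewrite /= ?subr0. Qed.
Fact trivlM : monoid_morphism trivl.
Proof. by split=> // c d; congr pair; rewrite /= !scaler0 addr0. Qed.
HB.instance Definition _ := GRing.isZmodMorphism.Build K trivext trivl trivlB.
HB.instance Definition _ := GRing.isMonoidMorphism.Build K trivext trivl trivlM.

End TrivialExtension.

Definition trivrE := (trivrD, trivrN, trivr0, trivrZ).

Ltac module := apply: trivr_inj; rewrite !trivrE; ring.
Ltac expand := rewrite ?(umulDl, umulDr, umulNl, umulNr, umulZl, umulZr, umulA,
  umul1l, umul1r, umul0l, umul0r).

(** * Positive elements of a C*-algebra *)

Section Scalars.
Variable R : realType.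

Lemma conj_real (t : R) : Num.conj (t%:C : R[i]) = t%:C.
Proof. by apply: conj_Creal; rewrite realE !lecR; case: leP => //= /ltW ->. Qed.

Lemma conj_i : Num.conj ('i : R[i]) = - 'i.
Proof. by rewrite conjCi. Qed.

Lemma rnorm_i : rnorm ('i : R[i]) = 1.
Proof. by apply: (complexI (R := R)); rewrite rnormE normCi. Qed.

Lemma rnormZr (V : normedModType R[i]) (t : R) (x : V) :
  rnorm (t%:C *: x) = `|t| * rnorm x.
Proof. by rewrite rnormZ rnorm_real. Qed.

Lemma rnorm_small (V : normedZmodType R[i]) (x : V) (M : R) : 0 <= M ->
  (forall e : R, 0 < e -> rnorm x <= M * e) -> x = 0.
Proof.
move=> M0 hx; apply: rnorm0_eq0; apply/eqP; rewrite eq_le rnorm_ge0 andbT.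
apply/ler_addgt0Pr => e e0; rewrite add0r.
have M1 : 0 < M + 1 by rewrite ltr_pwDr.
apply: le_trans (hx (e / (M + 1)) _) _; first by rewrite divr_gt0.
by rewrite mulrA ler_pdivrMr// mulrC ler_wpM2l ?(ltW e0)// lerDl.
Qed.

Lemma ler_small (x y M : R) : 0 <= M ->
  (forall e : R, 0 < e -> x <= y + M * e) -> x <= y.
Proof.
move=> M0 h; apply/ler_addgt0Pr => e e0.
have M1 : 0 < M + 1 by rewrite ltr_pwDr.
apply: le_trans (h (e / (M + 1)) _) _; first by rewrite divr_gt0.
by rewrite lerD2l mulrA ler_pdivrMr// mulrC ler_wpM2l ?(ltW e0)// lerDl.
Qed.

End Scalars.

Section CStar.
Variables (R : realType) (A : cstarAlgType R).
Implicit Types a b c d h k x y : A.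

Lemma starB a b : star (a - b) = star a - star b :> A.
Proof. by rewrite starD starN. Qed.

Lemma starZr (t : R) a : star (t%:C *: a) = t%:C *: star a.
Proof. by rewrite starZ conj_real. Qed.

Lemma rnorm_cstar a : rnorm (star a ** a) = rnorm a ^+ 2.
Proof.
by apply: (complexI (R := R)); rewrite rnormE cstar_norm -rnormE rmorphXn.
Qed.

Lemma rnorm_sq h : star h = h -> rnorm (h ** h) = rnorm h ^+ 2.
Proof. by move=> hs; rewrite -{1}hs rnorm_cstar. Qed.

Lemma rnorm1_le1 : rnorm (uone : A) <= 1.
Proof.
have := rnorm_cstar uone; rewrite star1 umul1l => h.
have := rnorm_ge0 (uone : A); nra.
Qed.

Lemma rnorm_scalar (t : R) : rnorm (t%:C *: (uone : A)) <= `|t|.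
Proof. by rewrite rnormZr ler_piMr// rnorm1_le1. Qed.

Lemma star_scalar (t : R) : star (t%:C *: (uone : A)) = t%:C *: uone.
Proof. by rewrite starZr star1. Qed.

(** Since [c = 2 y - y^2], the commutator [z] of [b] and [y] satisfies [2 z = z y + y z]; as
    [|y| < 1], this forces [z = 0]. *)
Lemma commute_sqrt c y b : rnorm y < 1 -> y = 2^-1 *: (c + y ** y) ->
  b ** c = c ** b -> b ** y = y ** b.
Proof.
move=> y1 yE bc.
have cE : c = 2 *: y - y ** y.
  by rewrite {1}yE scalerA divff ?pnatr_eq0// scale1r addrK.
pose z := b ** y - y ** b.
have zE : 2 *: z = z ** y + y ** z.
  move: bc; rewrite cE !(umulDr, umulDl, umulNr, umulNl, umulZl, umulZr, umulA).
  move=> /eqP; rewrite -subr_eq0 => /eqP bc; rewrite /z; expand.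
  apply/eqP; rewrite -subr_eq0 -bc; apply/eqP; module.
have n2 : rnorm (2 : R[i]) = 2.
  have -> : (2 : R[i]) = (2 : R)%:C by rewrite rmorph_nat.
  by rewrite rnorm_real ger0_norm.
apply/eqP; rewrite -subr_eq0 -/z; apply/eqP/rnorm0_eq0.
have := congr1 (@rnorm R A) zE; rewrite rnormZ n2 => z2.
have := rnormD (z ** y) (y ** z); have := rnormM z y; have := rnormM y z.
have := rnorm_ge0 z; have := rnorm_ge0 y; nra.
Qed.

(** With [d = 1 - y] the equation [d^2 = 1 - c] becomes [y = (c + y^2) / 2], whose right-hand side
    contracts the ball of radius [|c|] with ratio [|c|]. *)
Lemma sqrt1B c : star c = c -> rnorm c < 1 ->
  exists d, [/\ star d = d, d ** d = uone - c, rnorm (uone - d) <= rnorm c &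
    forall b, b ** c = c ** b -> b ** d = d ** b].
Proof.
move=> cs c1; set r := rnorm c; have r0 : 0 <= r := rnorm_ge0 c.
pose T y : A := (2^-1 : R)%:C *: (c + y ** y).
have T2 y : T y = (2^-1 : R[i]) *: (c + y ** y) by rewrite /T fmorphV rmorph_nat.
have n2 : `|2^-1 : R| = 2^-1 by rewrite ger0_norm// invr_ge0.
have Tr y : rnorm y <= r -> rnorm (T y) <= r.
  move=> yr; rewrite /T rnormZr n2.
  have := rnormD c (y ** y); have := rnormM y y; have := rnorm_ge0 y.
  rewrite -/r; nra.
have TB y z : rnorm y <= r -> rnorm z <= r -> rnorm (T y - T z) <= r * rnorm (y - z).
  move=> yr zr.
  have -> : T y - T z = (2^-1 : R)%:C *: (y ** (y - z) + (y - z) ** z).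
    by rewrite /T; expand; module.
  rewrite rnormZr n2.
  have := rnormD (y ** (y - z)) ((y - z) ** z).
  have := rnormM y (y - z); have := rnormM (y - z) z; have := rnorm_ge0 (y - z).
  nra.
pose u n := iter n T 0.
have ur n : rnorm (u n) <= r by elim: n => [|n IH]; rewrite ?rnorm0//; exact: Tr.
have us n : star (u n) = u n.
  elim: n => [|n IH]; first exact: star0.
  by rewrite /= /T starZr starD starM cs IH.
have [|n|y hy] := @geometric_cvg _ _ u r; first by apply/andP.
  elim: n => [|n IH].
    by rewrite expr0 /u /= subr0; apply: le_trans (ltW c1); exact: (ur 1%N).
  rewrite exprS; apply: le_trans (TB (u n.+1) (u n) (ur _) (ur _)) _.
  by rewrite ler_wpM2l.
have yr : rnorm y <= r.
  apply/ler_addgt0Pr => e /hy[n hn]; have := hn n (leqnn n).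
  have := rnormD (y - u n) (u n); rewrite subrK; have := ur n; lra.
have ys : star y = y.
  apply/eqP; rewrite -subr_eq0; apply/eqP; apply: (@rnorm_small _ _ _ 2) => // e e0.
  have [n hn] := hy e e0; have {}hn := hn n (leqnn n).
  have := rnorm_tri (star (u n)) (star y) y; rewrite -starB rnorm_star us.
  rewrite (rnormB (u n)); lra.
have yE : y = T y.
  apply/eqP; rewrite -subr_eq0; apply/eqP; apply: (@rnorm_small _ _ _ 2) => // e e0.
  have [n hn] := hy e e0; have h1 := hn _ (leqnSn n); have {}hn := hn n (leqnn n).
  have := rnorm_tri (u n.+1) y (T y); have := TB (u n) y (ur n) yr.
  rewrite (rnormB (u n)) /=; have := rnorm_ge0 (y - u n); nra.
exists (uone - y); split.
- by rewrite starB star1 ys.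
- have -> : c = 2 *: y - y ** y.
    by rewrite {1}yE T2 scalerA divff ?pnatr_eq0// scale1r addrK.
  by expand; module.
- by rewrite opprB addrC subrK.
- move=> b bc; have := commute_sqrt (le_lt_trans yr c1) (etrans yE (T2 y)) bc.
  by move=> byb; expand; rewrite byb.
Qed.

(* [pos h] is the usual spectral positivity of a self-adjoint element. *)
Definition pos h := star h = h /\ exists s : R, rnorm (s%:C *: uone - h) <= s.

Lemma posD h k : pos h -> pos k -> pos (h + k).
Proof.
move=> [hs [s hS]] [ks [t kt]]; split; first by rewrite starD hs ks.
exists (s + t); apply: le_trans (lerD hS kt).
have -> : (s + t)%:C *: uone - (h + k) = s%:C *: uone - h + (t%:C *: uone - k).
  by module.
exact: rnormD.
Qed.

Lemma posZ (t : R) h : 0 <= t -> pos h -> pos (t%:C *: h).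
Proof.
move=> t0 [hs [s hS]]; split; first by rewrite starZr hs.
exists (t * s); have -> : (t * s)%:C *: uone - t%:C *: h =
  t%:C *: (s%:C *: uone - h) by module.
by rewrite rnormZr ger0_norm// ler_wpM2l.
Qed.

Lemma pos_scalarB (t : R) h : star h = h -> rnorm h <= t -> pos (t%:C *: uone - h).
Proof.
move=> hs ht; split; first by rewrite starB star_scalar hs.
by exists t; rewrite opprB addrC subrK.
Qed.

Lemma pos_scalar (t : R) : 0 <= t -> pos (t%:C *: uone).
Proof.
move=> t0; rewrite -[_ *: _]subr0; apply: pos_scalarB; first exact: star0.
by rewrite rnorm0.
Qed.

(** For [u = b + i d] one has [star u ** u = t], hence [|u|^2 <= t], and [b] is the real part of
    [u]. *)
Lemma rnorm_sum_sq (t : R) b d : star b = b -> star d = d -> b ** d = d ** b ->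
  0 <= t -> b ** b + d ** d = t%:C *: uone -> rnorm b ^+ 2 <= t.
Proof.
move=> bs ds bd t0 bdt; pose u := b + 'i *: d.
have usE : star u = b - 'i *: d by rewrite starD starZ conj_i bs ds scaleNr.
have uu : star u ** u = t%:C *: uone.
  by rewrite usE /u -bdt; expand; rewrite bd !scalerA -expr2 sqrCi; module.
have ut : rnorm u ^+ 2 <= t.
  by rewrite -rnorm_cstar uu; apply: le_trans (rnorm_scalar _) _; rewrite ger0_norm.
have := rnormD u (star u); rewrite rnorm_star.
have -> : u + star u = (2 : R)%:C *: b.
  by rewrite usE /u rmorph_nat scaler_nat mulr2n; module.
rewrite rnormZr ger0_norm//; have := rnorm_ge0 b; have := rnorm_ge0 u; nra.
Qed.

(** When [|k|^2 < s], the element [s - k^2] is the square of a self-adjoint element commuting with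
    [k], and [rnorm_sum_sq] applies to the two squares. The case of equality is a limit. *)
Lemma pos_sq_le (s : R) k : star k = k -> rnorm k ^+ 2 <= s ->
  rnorm (s%:C *: uone - k ** k) <= s.
Proof.
move=> ks; wlog lt : s / rnorm k ^+ 2 < s => [hw ksS|_].
  apply: (@ler_small _ _ _ 2) => // e e0.
  have := hw (s + e); rewrite (le_lt_trans ksS) ?ltrDl//.
  rewrite (le_trans ksS) ?lerDl ?(ltW e0)// => /(_ isT isT) h.
  have := rnormB (s%:C *: uone - k ** k) (e%:C *: - uone).
  have := rnormD ((s + e)%:C *: uone - k ** k) (e%:C *: - uone).
  have -> : (s + e)%:C *: uone - k ** k + e%:C *: - uone = s%:C *: uone - k ** k.
    by module.
  have := rnorm_scalar e; rewrite scalerN rnormN ger0_norm ?(ltW e0)//; lra.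
have s0 : 0 < s by apply: le_lt_trans lt; rewrite sqr_ge0.
have cs : star ((s^-1)%:C *: (k ** k)) = (s^-1)%:C *: (k ** k).
  by rewrite starZr starM ks.
have [|d [ds dd _ dk]] := sqrt1B cs.
  rewrite rnormZr rnorm_sq// ger0_norm ?invr_ge0 ?(ltW s0)//.
  by rewrite mulrC ltr_pdivrMr// mul1r.
pose q := Num.sqrt s; have qq : q * q = s by rewrite -expr2 sqr_sqrtr ?ltW.
have skE : s%:C *: uone - k ** k = (q%:C *: d) ** (q%:C *: d).
  rewrite umulZl umulZr scalerA -rmorphM qq dd scalerBr scalerA -rmorphM.
  by rewrite divff ?gt_eqF// scale1r.
rewrite skE rnorm_sq ?starZr ?ds//; apply: (@rnorm_sum_sq _ _ k) => //.
- by rewrite starZr ds.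
- by rewrite umulZl umulZr dk// umulZl umulZr umulA.
- exact: ltW.
- by rewrite -skE subrK.
Qed.

Lemma pos_sq k : star k = k -> pos (k ** k).
Proof.
move=> ks; split; first by rewrite starM ks.
by exists (rnorm k ^+ 2); exact: pos_sq_le.
Qed.

(** The shift by [e] makes [(s - h) / (s + e)] a strict contraction, as [sqrt1B] requires. Users of
    these shifted roots let [e] tend to 0. *)
Lemma pos_root h (e : R) : pos h -> 0 < e ->
  exists b, [/\ pos b, b ** b = h + e%:C *: uone &
    forall x, x ** h = h ** x -> x ** b = b ** x].
Proof.
move=> [hs [s hS]] e0; have s0 : 0 <= s := le_trans (rnorm_ge0 _) hS.
have se0 : 0 < s + e by rewrite ltr_wpDl.
pose c := ((s + e)^-1)%:C *: (s%:C *: uone - h).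
have cs : star c = c by rewrite starZr starB star_scalar hs.
have c1 : rnorm c < 1.
  rewrite rnormZr ger0_norm ?invr_ge0 ?(ltW se0)//.
  by rewrite mulrC ltr_pdivrMr// mul1r (le_lt_trans hS)// ltrDl.
have [d [ds dd dc dcomm]] := sqrt1B cs c1.
pose q := Num.sqrt (s + e); have qq : q * q = s + e by rewrite -expr2 sqr_sqrtr ?ltW.
exists (q%:C *: d); split.
- apply: posZ; first exact: sqrtr_ge0.
  by split=> //; exists 1; rewrite scale1r (le_trans dc)// ltW.
- rewrite umulZl umulZr scalerA -rmorphM qq dd /c scalerBr scalerA -rmorphM.
  by rewrite divff ?gt_eqF// scale1r; module.
- move=> x xh; rewrite umulZr umulZl dcomm// /c; expand.
  by rewrite xh.
Qed.

(** Frees [pos] from its particular witness. Up to [e], [h] is a square, so [pos_sq_le] gives the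
    bound for every large [s]. *)
Lemma pos_le (s : R) h : pos h -> rnorm h <= s -> rnorm (s%:C *: uone - h) <= s.
Proof.
move=> hp hS; apply: (@ler_small _ _ _ 1) => // e e0; rewrite mul1r.
have [b [[bs _] bb _]] := pos_root hp e0.
have := @pos_sq_le (s + e) b bs; rewrite -rnorm_sq// bb.
have -> : (s + e)%:C *: uone - (h + e%:C *: uone) = s%:C *: uone - h by module.
apply; apply: le_trans (rnormD _ _) _; apply: lerD => //.
by apply: le_trans (rnorm_scalar _) _; rewrite ger0_norm// ltW.
Qed.

(** By [pos_le] all approximants share the constant [|h| + 1], so the defining inequality passes to
    the limit. *)
Lemma pos_closed h : star h = h ->
  (forall e : R, 0 < e -> exists2 k, pos k & rnorm (h - k) <= e) -> pos h.
Proof.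
move=> hs hk; split=> //; exists (rnorm h + 1).
apply/ler_addgt0Pr => e e0; pose d := Num.min e 1.
have d0 : 0 < d by rewrite lt_min e0 ltr01.
have [de d1] : d <= e /\ d <= 1 by split; rewrite ge_min lexx ?orbT.
have [k kp hkd] := hk d d0.
have kh : rnorm k <= rnorm h + 1.
  have := rnormD (k - h) h; rewrite subrK rnormB; lra.
have := pos_le kp kh => h1.
have := rnormD ((rnorm h + 1)%:C *: uone - k) (k - h); rewrite addrA subrK.
rewrite (rnormB k); lra.
Qed.

(** The shifted roots of [h] and [k] commute, so [(h + f)(k + f)] is the square of a self-adjoint
    element; [f] is chosen to bring it within [e] of [h k]. *)
Lemma posM h k : pos h -> pos k -> h ** k = k ** h -> pos (h ** k).
Proof.
move=> hp kp hk; apply: pos_closed; first by rewrite starM hp.1 kp.1 hk.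
move=> e e0; pose M := rnorm h + rnorm k + 1.
have M0 : 0 < M by rewrite ltr_wpDl// addr_ge0 ?rnorm_ge0.
pose f := Num.min 1 (e / M).
have f0 : 0 < f by rewrite lt_min ltr01 divr_gt0.
have f1 : f <= 1 by rewrite ge_min lexx.
have fe : f * M <= e by rewrite -ler_pdivlMr// ge_min lexx orbT.
have [b [[bs _] bb bc]] := pos_root hp f0; have [d [[ds _] dd dc]] := pos_root kp f0.
have bd : b ** d = d ** b by rewrite dc// bc.
exists ((b ** d) ** (b ** d)); first by apply: pos_sq; rewrite starM bs ds bd.
have -> : (b ** d) ** (b ** d) = (h + f%:C *: uone) ** (k + f%:C *: uone).
  by rewrite -bb -dd; expand; rewrite -[b ** d ** b]umulA -bd umulA.
have -> : h ** k - (h + f%:C *: uone) ** (k + f%:C *: uone) =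
   - f%:C *: (h + k + f%:C *: uone) by expand; module.
rewrite scaleNr rnormN rnormZr ger0_norm ?(ltW f0)//; apply: le_trans fe.
rewrite ler_wpM2l ?(ltW f0)//; apply: le_trans (rnormD _ _) _.
apply: lerD; first exact: rnormD.
by apply: le_trans (rnorm_scalar _) _; rewrite ger0_norm// ltW.
Qed.

(** Up to [e], [h] and [t - h] are squares of commuting self-adjoint elements with sum [t], the
    situation of [rnorm_sum_sq]. *)
Lemma pos_rnorm_le (t : R) h : 0 <= t -> pos h -> pos (t%:C *: uone - h) ->
  rnorm h <= t.
Proof.
move=> t0 hp thp; apply: (@ler_small _ _ _ 3) => // e e0.
have [b [[bs _] bb bc]] := pos_root hp e0.
have [d [[ds _] dd dc]] := pos_root thp e0.
have bd : b ** d = d ** b.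
  by rewrite dc//; expand; rewrite -(bc h).
have := @rnorm_sum_sq (t + 2 * e) b d bs ds bd; rewrite -rnorm_sq// bb dd.
have -> : 0 <= t + 2 * e by rewrite addr_ge0// mulr_ge0// ltW.
have -> : (t + 2 * e)%:C = t%:C + e%:C + e%:C by rewrite -!rmorphD; congr _%:C; ring.
move=> /(_ isT) H.
have {}H : rnorm (h + e%:C *: uone) <= t + 2 * e by apply: H; module.
have := rnormD (h + e%:C *: uone) (e%:C *: - uone).
have -> : h + e%:C *: uone + e%:C *: - uone = h by module.
have := rnorm_scalar e; rewrite scalerN rnormN ger0_norm ?(ltW e0)//; lra.
Qed.

End CStar.

(** * Positivity of [star x ** x] *)

Section KelleyVaught.
Variables (R : realType) (A : cstarAlgType R).
Implicit Types a b c d h k x y z : A.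

Definition upow a n := iter n (umul a) uone.

Lemma upowS a n : upow a n.+1 = a ** upow a n. Proof. by []. Qed.

Lemma upowD a m n : upow a (m + n) = upow a m ** upow a n.
Proof. by elim: m => [|m IH]; rewrite ?umul1l// addSn !upowS IH umulA. Qed.

Lemma rnorm_upow a n : rnorm (upow a n) <= rnorm a ^+ n.
Proof.
elim: n => [|n IH]; first exact: rnorm1_le1.
rewrite upowS exprS; apply: le_trans (rnormM _ _) _.
by rewrite ler_wpM2l ?rnorm_ge0.
Qed.

Lemma star_upow z n : star z = z -> star (upow z n) = upow z n.
Proof.
move=> zs; elim: n => [|n IH]; first exact: star1.
by rewrite upowS starM IH zs -{2}[z]umul1r -(upowD z n 1) addn1.
Qed.

(** The C*-identity, iterated; it stands in for the equality of norm and spectral radius. *)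
Lemma rnorm_upow2 z n : star z = z -> rnorm (upow z (2 ^ n)) = rnorm z ^+ (2 ^ n).
Proof.
move=> zs; elim: n => [|n IH]; first by rewrite expn0 upowS umul1r expr1.
rewrite expnS mul2n -addnn upowD rnorm_sq ?star_upow// IH -exprM muln2.
by rewrite addnn.
Qed.

(** If [q = 1 + d] with [d > 0], Bernoulli's inequality at a power [M] of 2, squared, gives
    [q^(2M) >= (1 + M d)^2], which outgrows the linear bound [1 + 2 C M]. *)
Lemma geometric_bound (q C : R) : 0 <= q -> 0 <= C ->
  (forall n : nat, q ^+ (2 ^ n) <= 1 + C * (2 ^ n)%:R) -> q <= 1.
Proof.
move=> q0 C0 hq; rewrite leNgt; apply/negP => q1.
pose d := q - 1; have d0 : 0 < d by rewrite subr_gt0.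
have bern n : 1 + n%:R * d <= q ^+ n.
  elim: n => [|n IH]; first by rewrite mul0r addr0 expr0.
  rewrite exprS -natr1; apply: le_trans (ler_wpM2l q0 IH).
  have n0 : 0 <= n%:R :> R by []; have := mulr_ge0 n0 (sqr_ge0 d).
  have -> : q * (1 + n%:R * d) = 1 + (n%:R + 1) * d + n%:R * d ^+ 2.
    by rewrite /d; ring.
  by rewrite lerDl.
have [N hN] : exists N : nat, 2 * C / d ^+ 2 < N%:R.
  by exists (Num.bound (2 * C / d ^+ 2)); rewrite archi_boundP// divr_ge0 ?sqr_ge0// mulr_ge0.
have {}hN : 2 * C < N%:R * d ^+ 2 by rewrite -ltr_pdivrMr// exprn_gt0.
have N2 : N%:R <= (2 ^ N)%:R :> R by rewrite ler_nat ltnW// ltn_expl.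
move: (hq N.+1) (bern (2 ^ N)%N); rewrite expnS mul2n -addnn exprD natrD.
set M := (2 ^ N)%:R in N2 *; set Q := q ^+ _.
have M0 : 0 < M by rewrite ltr0n expn_gt0.
have : 2 * C < M * d ^+ 2.
  by apply: lt_le_trans hN _; rewrite ler_wpM2r// sqr_ge0.
move=> hM QQ hQ; have : (1 + M * d) ^+ 2 <= Q * Q.
  by rewrite expr2 ler_pM// addr_ge0// mulr_ge0// ltW.
have : M * (2 * C) <= M * (M * d ^+ 2) by rewrite ler_pM2l// ltW.
have : 0 < M * d by rewrite mulr_gt0.
rewrite expr2 in hM *; nra.
Qed.

Lemma intertwine_upow y z w n : y ** z = w ** y -> y ** upow z n = upow w n ** y.
Proof.
move=> h; elim: n => [|n IH]; first by rewrite umul1r umul1l.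
by rewrite !upowS umulA h -umulA IH umulA.
Qed.

(* A form of: the spectra of [y ** star y] and [star y ** y] agree up to 0.   *)
(* Iterating [z^n.+1 = s z^n - (star y ** y) z^n], where the last term is     *)
(* [star y ** w^n ** y], shows that [|z^n|] grows at most like [n rho^n].     *)
Lemma rnorm_scalarB_star (s rho : R) y : 0 <= s -> s <= rho ->
  rnorm (s%:C *: uone - y ** star y) <= rho ->
  rnorm (s%:C *: uone - star y ** y) <= rho.
Proof.
move=> s0; set w := _ - y ** star y; set z := _ - star y ** y.
wlog rho0 : rho / 0 < rho => [hw srho wrho|].
  apply: (@ler_small _ _ _ 1) => // e e0; rewrite mul1r.
  apply: hw; first by rewrite ltr_wpDl// (le_trans s0).
    by rewrite (le_trans srho)// lerDl ltW.
  by rewrite (le_trans wrho)// lerDl ltW.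
move=> srho wrho.
have zs : star z = z by rewrite starB star_scalar starM starK.
have yz : y ** z = w ** y by rewrite /z /w; expand.
pose C := rnorm y ^+ 2; have C0 : 0 <= C := sqr_ge0 _.
have zn n : rho * rnorm (upow z n) <= rho ^+ n * (rho + n%:R * C).
  elim: n => [|n IH].
    rewrite expr0 mul0r addr0 mul1r; apply: (le_trans _ (_ : rho * 1 <= _)).
      by rewrite ler_wpM2l ?rnorm1_le1// ltW.
    by rewrite mulr1.
  have : rnorm (upow z n.+1) <= rho * rnorm (upow z n) + C * rho ^+ n.
    have -> : upow z n.+1 = s%:C *: upow z n - star y ** (upow w n ** y).
      by rewrite -(intertwine_upow n yz) upowS /z; expand.
    apply: le_trans (rnormD _ _) _; rewrite rnormN rnormZr ger0_norm//.
    apply: lerD; first by rewrite ler_wpM2r ?rnorm_ge0.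
    apply: le_trans (rnormM _ _) _; rewrite rnorm_star /C expr2 -mulrA.
    rewrite ler_wpM2l ?rnorm_ge0// mulrC; apply: le_trans (rnormM _ _) _.
    rewrite ler_wpM2r ?rnorm_ge0//; apply: le_trans (rnorm_upow _ _) _.
    by rewrite lerXn2r// ?nnegrE ?rnorm_ge0// ltW.
  move=> h; rewrite -(ler_pM2l rho0) in h; apply: le_trans h _.
  rewrite mulrDr; apply: le_trans (lerD (ler_wpM2l (ltW rho0) IH) (lexx _)) _.
  rewrite exprS -natr1 le_eqVlt; apply/orP; left; apply/eqP; ring.
rewrite -[leRHS]mul1r -ler_pdivrMr//.
apply: (@geometric_bound _ (C / rho)); rewrite ?divr_ge0 ?rnorm_ge0 ?(ltW rho0)//.
move=> n; rewrite expr_div_n -rnorm_upow2//.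
rewrite ler_pdivrMr ?exprn_gt0// -(ler_pM2l rho0); apply: le_trans (zn _) _.
rewrite le_eqVlt; apply/orP; left; apply/eqP; field; exact: lt0r_neq0.
Qed.

(** Positivity of [e + x] amounts to [|s - e - x| <= s] for a large [s], a bound that
    [rnorm_scalarB_star] carries from [y ** star y] to [star y ** y]. *)
Lemma pos_scalarD_star (e : R) y : 0 <= e ->
  pos (e%:C *: uone + y ** star y) -> pos (e%:C *: uone + star y ** y).
Proof.
move=> e0 yp; split; first by rewrite starD star_scalar starM starK.
pose s := rnorm (e%:C *: uone + y ** star y) + e; exists s.
have r0 := rnorm_ge0 (e%:C *: uone + y ** star y).
have sE x : s%:C *: uone - (e%:C *: uone + x) = (s - e)%:C *: uone - x by module.
rewrite sE; apply: rnorm_scalarB_star; rewrite /s; try lra.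
by rewrite -sE; apply: pos_le => //; rewrite lerDl.
Qed.

(** Half of [a^2 + b^2], where [a] and [b] are twice the real and imaginary parts of [y]. *)
Lemma star_mul_pos_sum y : pos (star y ** y + y ** star y).
Proof.
pose a := y + star y; pose b := 'i *: (star y - y).
have as_ : star a = a by rewrite starD starK addrC.
have bs : star b = b.
  by rewrite starZ conj_i starB starK scaleNr -scalerN opprB.
have -> : star y ** y + y ** star y = (2^-1 : R)%:C *: (a ** a + b ** b).
  apply: (@scalerI _ _ (2 : R[i])); first by rewrite pnatr_eq0.
  rewrite scalerA (_ : 2 * (2^-1 : R)%:C = 1) ?scale1r; last first.
    by rewrite fmorphV rmorph_nat divff ?pnatr_eq0.
  rewrite /a /b umulZl umulZr scalerA -expr2 sqrCi; expand; module.
by apply: posZ; [rewrite invr_ge0|apply: posD; exact: pos_sq].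
Qed.

(** Approximate form of: if [- star y ** y] is positive, then [y = 0]. Adding
    [star y ** y + y ** star y] gives [e + y ** star y >= 0], the factors are exchanged by
    [pos_scalarD_star], and [star y ** y] lies between [-e] and [e]. *)
Lemma rnorm_neg_star (e : R) y : 0 <= e ->
  pos (e%:C *: uone - star y ** y) -> rnorm (star y ** y) <= 3 * e.
Proof.
move=> e0 yp; pose z := star y ** y.
have ey : pos (e%:C *: uone + y ** star y).
  have := posD yp (star_mul_pos_sum y); congr pos; module.
have {}ey := pos_scalarD_star e0 ey.
have := @pos_rnorm_le _ _ (2 * e) _ _ ey.
rewrite mulr_ge0// => /(_ isT).
have -> : (2 * e)%:C *: uone - (e%:C *: uone + star y ** y) =
  e%:C *: uone - star y ** y.
  have -> : (2 * e)%:C = e%:C + e%:C by rewrite -rmorphD; congr _%:C; ring.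
  module.
move=> /(_ yp) h; have := rnormD (e%:C *: uone + z) (e%:C *: - uone).
have -> : e%:C *: uone + z + e%:C *: - uone = z by module.
rewrite scalerN rnormN; have := rnorm_scalar A e; rewrite ger0_norm// -/z in h *; lra.
Qed.

(* Kelley and Vaught. With [k = sqrt(h^2 + e)] and [q = k - h], roughly twice *)
(* the negative part of [h], one has [h k q = k (e - q^2) / 2]; so [-star y ** y] *)
(* is almost positive for [y = x (k q)^(1/2)], which forces [q] to be small.  *)
Theorem pos_star_mul x : pos (star x ** x).
Proof.
have [h hE] : exists h, h = star x ** x by eexists.
have hs : star h = h by rewrite hE starM starK.
rewrite -hE; apply: pos_closed => // e0 e0p.
pose H := rnorm h + 1; have H1 : 1 <= H by rewrite lerDr rnorm_ge0.
(* The final estimate reads [|q|^3 <= 16 eta + e |q| <= 34 e H], where [eta = 2 e H]; the factor 40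
   leaves room for it below [e0^3]. *)
pose e := Num.min 1 (e0 ^+ 3 / (40 * H)).
have H0 : 0 < 40 * H by rewrite mulr_gt0// (lt_le_trans ltr01).
have ep : 0 < e by rewrite lt_min ltr01 divr_gt0// exprn_gt0.
have e1 : e <= 1 by rewrite ge_min lexx.
have eH : e * (40 * H) <= e0 ^+ 3 by rewrite -ler_pdivlMr// ge_min lexx orbT.
have [k [kp kk kc]] := pos_root (pos_sq hs) ep.
have kh : h ** k = k ** h by apply: kc; rewrite umulA.
have [q qE] : exists q, q = k - h by eexists.
have qs : star q = q by rewrite qE starB kp.1 hs.
have kqE : k ** q = (2^-1 : R)%:C *: (q ** q + e%:C *: uone).
  apply: (@scalerI _ _ (2 : R[i])); first by rewrite pnatr_eq0.
  rewrite scalerA (_ : 2 * (2^-1 : R)%:C = 1) ?scale1r; last first.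
    by rewrite fmorphV rmorph_nat divff ?pnatr_eq0.
  have -> : e%:C *: uone = k ** k - h ** h by rewrite kk; module.
  by rewrite qE; expand; rewrite kh; module.
have kq : q ** k = k ** q by rewrite qE; expand; rewrite kh.
have kqp : pos (k ** q).
  rewrite kqE; apply: posZ; first by rewrite invr_ge0.
  by apply: posD; [exact: pos_sq|apply: pos_scalar; exact: ltW].
have [g [gp gg gc]] := pos_root kqp ep.
have hg : h ** g = g ** h.
  by apply: gc; rewrite qE; expand; rewrite kh -!umulA kh.
have khn : rnorm k <= H.
  have : rnorm k ^+ 2 <= H ^+ 2.
    rewrite -rnorm_sq ?kp.1// kk; apply: le_trans (rnormD _ _) _.
    have := rnorm_scalar A e; rewrite (ger0_norm (ltW ep)) rnorm_sq// /H.
    have := rnorm_ge0 h; nra.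
  by rewrite ler_pXn2r// nnegrE ?rnorm_ge0// (le_trans ler01).
have hn : rnorm h <= H by rewrite lerDl.
pose y := x ** g.
have yy : star y ** y = g ** h ** g by rewrite /y starM gp.1 hE !umulA.
have hhE : h ** h = k ** k - e%:C *: uone by rewrite kk; module.
have qqk : pos (q ** q ** k).
  by apply: posM => //; [exact: pos_sq|rewrite -umulA kq !umulA kq].
have [r rE] : exists r, r = (2^-1 : R)%:C *: (q ** q ** k) by eexists.
have kqq : k ** q ** q = q ** q ** k by rewrite -kq -umulA -kq umulA.
have halfD (u : A) : u = (2^-1 : R)%:C *: u + (2^-1 : R)%:C *: u.
  by rewrite -scalerDl -rmorphD (_ : 2^-1 + 2^-1 = 1) ?scale1r//; field.
have hkq : h ** (k ** q) = (2^-1 : R)%:C *: (e%:C *: k) - r.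
  have -> : h ** (k ** q) = k ** (k ** q) - q ** (k ** q).
    by rewrite -umulNl -umulDl {2}qE opprB addrCA subrr addr0.
  rewrite {1}kqE -kq umulA [q ** q ** k]halfD; expand.
  by rewrite kqq rE; module.
have yyE : star y ** y = (2^-1 : R)%:C *: (e%:C *: k) + e%:C *: h - r.
  by rewrite yy -hg -umulA gg umulDr hkq; expand; module.
(* As [star y ** y = e k / 2 + e h - r] with [r] positive, [(3/2) e H] dominates it; the remaining
   half of [e H] is slack. *)
pose eta := 2 * e * H.
have eta0 : 0 <= eta by rewrite !mulr_ge0// ?ltW// (lt_le_trans ltr01).
have eyp : pos (eta%:C *: uone - star y ** y).
  have -> : eta%:C *: uone - star y ** y = (2^-1 : R)%:C *: (q ** q ** k) +
      ((2^-1 : R)%:C *: (e%:C *: (H%:C *: uone - k)) + e%:C *: (H%:C *: uone - h)) +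
      (e * H / 2)%:C *: uone.
    rewrite yyE rE /eta.
    have -> : (2 * e * H)%:C = (2^-1)%:C * e%:C * H%:C + e%:C * H%:C + (e * H / 2)%:C.
      by rewrite -!rmorphM -!rmorphD; congr _%:C; field.
    by module.
  apply: posD; last by apply: pos_scalar; rewrite /eta in eta0; nra.
  apply: posD; first by apply: posZ; rewrite ?invr_ge0.
  apply: posD; last by apply: posZ; [exact: ltW|exact: pos_scalarB].
  apply: posZ; first by rewrite invr_ge0.
  by apply: posZ; [exact: ltW|apply: pos_scalarB; rewrite ?kp.1].
have yn := rnorm_neg_star eta0 eyp.
exists k => //; rewrite rnormB -qE.
have r4 : rnorm r <= 4 * eta.
  have -> : r = (2^-1 : R)%:C *: (e%:C *: k) + e%:C *: h - star y ** y.
    by rewrite yyE opprB addrC subrK.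
  have := rnormD ((2^-1 : R)%:C *: (e%:C *: k) + e%:C *: h) (- (star y ** y)).
  have := rnormD ((2^-1 : R)%:C *: (e%:C *: k)) (e%:C *: h).
  rewrite !rnormZr rnormN !ger0_norm ?invr_ge0 ?(ltW ep)//.
  have : e * rnorm k <= e * H by rewrite ler_wpM2l// ltW.
  have : e * rnorm h <= e * H by rewrite ler_wpM2l// ltW.
  have : 0 <= e * H by rewrite mulr_ge0// ltW// (lt_le_trans ltr01).
  rewrite /eta in yn *; lra.
have qn : rnorm q <= 2 * H.
  by have := rnormD k (- h); rewrite rnormN -qE; lra.
(* Multiply [2 k q = q^2 + e] by [q]: the cube of [q] is controlled by the small element [r]. *)
have q3 : q ** q ** q = (4 : R)%:C *: r - e%:C *: q.
  have -> : (4 : R)%:C *: r = (2 : R)%:C *: (q ** (k ** q)).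
    rewrite rE scalerA -rmorphM (_ : 4 * 2^-1 = 2); last by field.
    by rewrite -kq umulA.
  rewrite kqE; expand; rewrite scalerA -rmorphM divff ?pnatr_eq0// rmorph1 scale1r.
  by expand; module.
have q4 : rnorm q ^+ 4 <= rnorm q * (16 * eta + e * rnorm q).
  rewrite (_ : rnorm q ^+ 4 = rnorm (q ** (q ** q ** q))); last first.
    rewrite !umulA -umulA rnorm_sq ?rnorm_sq// ?starM ?qs//.
    by rewrite -exprM.
  apply: le_trans (rnormM _ _) _; rewrite ler_wpM2l ?rnorm_ge0// q3.
  apply: le_trans (rnormD _ _) _; rewrite rnormN !rnormZr !ger0_norm ?(ltW ep)//.
  lra.
rewrite leNgt; apply/negP => qe0.
have q0 : 0 < rnorm q by apply: lt_trans qe0.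
rewrite exprS ler_pM2l// in q4.
have : e * rnorm q <= e * (2 * H) by rewrite ler_wpM2l// ltW.
have : e0 ^+ 3 < rnorm q ^+ 3 by rewrite ltrXn2r// ?nnegrE ltW.
have : 0 < e * H by rewrite mulr_gt0// (lt_le_trans ltr01).
rewrite /eta in q4; lra.
Qed.

End KelleyVaught.

(** * States *)

Section States.
Variables (R : realType) (A : cstarAlgType R).
Implicit Types a b h x y z : A.

Local Notation "t %:U" := (t%:C *: (uone : A)) (at level 1, format "t %:U").

(** The value at the unit is only bounded by 1, so that the zero functional is a state of the zero
    algebra. *)
Record state := State {
  state_fun :> A -> R[i];
  stateP : forall c x y, state_fun (c *: x + y) = c * state_fun x + state_fun y;
  state_star : forall x, state_fun (star x) = Num.conj (state_fun x);
  state_ge0 : forall x, 0 <= state_fun (star x ** x);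
  state1_le1 : state_fun uone <= 1
}.

Definition cone (C : set A) :=
  (forall x y, C x -> C y -> C (x + y)) /\
  (forall (t : R) x, 0 <= t -> C x -> C (t%:C *: x)).

(** Contains every skew-adjoint element together with its negative, so an additive real functional
    that is nonnegative on it kills the skew-adjoint part. *)
Definition real_pos : set A := fun x => pos (x + star x).

Lemma cone_real_pos : cone real_pos.
Proof.
split=> [x y xp yp|t x t0 xp]; rewrite /real_pos.
  by rewrite starD addrACA; exact: posD.
by rewrite starZr -scalerDr; exact: posZ.
Qed.

Lemma posN1_trivial : pos (- uone : A) -> (uone : A) = 0.
Proof.
move=> h; apply: rnorm0_eq0; apply/eqP; rewrite eq_le rnorm_ge0 andbT.
apply: pos_rnorm_le => //; last by rewrite scale0r sub0r.
by rewrite -[uone]scale1r; apply: (@pos_scalar _ _ 1).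
Qed.

Section Extension.
Variables (h : A) (n : R).
Hypotheses (hp : pos h) (nE : n = rnorm h) (A1 : (uone : A) <> 0).

(** A linear functional that is nonnegative here and 1 at the unit takes at [h] a value at least
    [n], the norm of [h]. *)
Definition peak_cone : set A :=
  fun x => exists k (s : R), [/\ real_pos k, 0 <= s & x = k + s%:C *: (h - n%:U)].

Lemma cone_peak_cone : cone peak_cone.
Proof.
have [KD KZ] := cone_real_pos; split.
  move=> x y [k [s [kp s0 ->]]] [l [t [lp t0 ->]]].
  exists (k + l), (s + t); split; [exact: KD|exact: addr_ge0|module].
move=> t x t0 [k [s [kp s0 ->]]]; exists (t%:C *: k), (t * s).
by split; [exact: KZ|exact: mulr_ge0|module].
Qed.

Lemma real_pos_peak x : real_pos x -> peak_cone x.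
Proof. by move=> xp; exists x, 0; rewrite lexx scale0r addr0. Qed.

(** Otherwise [s n - 1 - s h >= 0] for some [s >= 0]. If [s n >= 1], the norm [s n] of [s h] would
    be at most [s n - 1]; if [s n < 1], adding [s h] makes [-1] positive and the algebra zero. *)
Lemma peak_coneN1 : ~ peak_cone (- uone).
Proof.
have n0 : 0 <= n by rewrite nE rnorm_ge0.
move=> [k [s [kp s0 E]]].
have {}kp : pos ((s * n - 1)%:U - s%:C *: h).
  have -> : (s * n - 1)%:U - s%:C *: h = (2^-1 : R)%:C *: (k + star k).
    have -> : k = (s * n - 1)%:U - s%:C *: h.
      by rewrite -[k](addrK (s%:C *: (h - n%:U))) -E; module.
    rewrite starB star_scalar starZr hp.1 scalerDr -scalerDl -rmorphD.
    by rewrite (_ : 2^-1 + 2^-1 = 1) ?scale1r//; field.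
  by apply: posZ; rewrite ?invr_ge0.
have shp := posZ s0 hp.
have [sn1|sn1] := leP 1 (s * n).
  have := pos_rnorm_le _ shp kp; rewrite subr_ge0 sn1 => /(_ isT).
  rewrite rnormZr ger0_norm// -nE; lra.
apply/A1/posN1_trivial; have t0 : 0 < 1 - s * n by rewrite subr_gt0.
have : pos (((1 - s * n)^-1)%:C *: (((s * n - 1)%:U - s%:C *: h) + s%:C *: h)).
  by apply: posZ; [rewrite invr_ge0 ltW|exact: posD].
rewrite subrK scalerA -rmorphM (_ : (1 - s * n)^-1 * (s * n - 1) = -1).
  by rewrite rmorphN scaleN1r.
by rewrite -[s * n - 1]opprB mulrN mulVf// gt_eqF.
Qed.

(** Zorn's lemma gives a maximal cone omitting [-1]. For [x] outside it, the cone enlarged by [x]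
    contains [-1 = m + t x], whence [-x = (m + 1) / t] lies in the maximal one. *)
Lemma maximal_cone : exists M : set A, [/\ cone M, forall x, peak_cone x -> M x,
  ~ M (- uone) & forall x, M x \/ M (- x)].
Proof.
pose good C := [/\ cone C, forall x, peak_cone x -> C x & ~ C (- uone)].
pose P C := (forall x, ~ C x) \/ good C.
have [F FP Ftot|M [PM Mmax]] := @Zorn_bigcup A P.
  have [[X [FX [x Xx]]]|nX] := pselect (exists X, F X /\ exists x, X x); last first.
    by left=> x [X FX Xx]; apply: nX; exists X; split=> //; exists x.
  have good_of Y y : F Y -> Y y -> good Y.
    by move=> /FP[nY /nY|].
  right; split; last by move=> [Y FY /[dup] Y1 /(good_of _ _ FY)[]].
    split=> [y z [Y FY Yy] [Z FZ Zz]|t y t0 [Y FY Yy]].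
      have [YZ|ZY] := Ftot _ _ FY FZ.
        exists Z => //; have [[ZD _] _ _] := good_of _ _ FZ Zz.
        by apply: ZD => //; exact: YZ.
      exists Y => //; have [[YD _] _ _] := good_of _ _ FY Yy.
      by apply: YD => //; exact: ZY.
    by exists Y => //; have [[_ YZ] _ _] := good_of _ _ FY Yy; exact: YZ.
  by move=> y yp; exists X => //; have [_ h0 _] := good_of _ _ FX Xx; exact: h0.
have good_peak : good peak_cone.
  by split; [exact: cone_peak_cone| |exact: peak_coneN1].
have [nM|[[MD MZ] MK M1]] := PM.
  exfalso; apply: (Mmax peak_cone); last by right.
  split; first by move=> x /nM.
  move=> h0; apply: (nM 0); apply: h0; apply: real_pos_peak.
  by rewrite /real_pos star0 addr0 -(scale0r uone) -[0 in X in pos X]/(0%:C); exact: pos_scalar.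
exists M; split=> // x; have [Mx|nMx] := pselect (M x); [by left|right].
pose B : set A := fun y => exists m (t : R), [/\ M m, 0 <= t & y = m + t%:C *: x].
have M0 : M 0.
  by rewrite -(scale0r (0 : A)); apply: (MZ 0) => //; apply: MK;
    apply: real_pos_peak; rewrite /real_pos star0 addr0 -(scale0r uone); exact: pos_scalar.
have MB y : M y -> B y by move=> My; exists y, 0; rewrite scale0r addr0 lexx.
have : ~ P B.
  apply: Mmax; split=> // BM; apply: nMx; apply: BM.
  by exists 0, 1; rewrite scale1r add0r.
have [[m [t [Mm t0 E]]] _|nB1] := pselect (B (- uone)); last first.
  case; right; split=> //; last by move=> y /MK; exact: MB.
  split=> [y z [m [t [Mm t0 ->]]] [l [s [Ml s0 ->]]]|s y s0 [m [t [Mm t0 ->]]]].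
    by exists (m + l), (t + s); split; [exact: MD|exact: addr_ge0|module].
  by exists (s%:C *: m), (s * t); split; [exact: MZ|exact: mulr_ge0|module].
have [t1|t1] := eqVneq t 0; first by case: M1; rewrite E t1 scale0r addr0.
have -> : - x = (t^-1)%:C *: (m + uone).
  have -> : m = - uone - t%:C *: x by rewrite E addrK.
  by rewrite addrAC addNr add0r -scalerN scalerA -rmorphM mulVf// scale1r.
apply: MZ; first by rewrite invr_ge0.
apply: MD => //; apply: MK; apply: real_pos_peak.
by rewrite /real_pos star1; apply: posD; rewrite -[uone]scale1r; exact: (@pos_scalar _ _ 1).
Qed.

End Extension.

Section Functional.
Variable M : set A.
Hypotheses (Mcone : cone M) (MK : forall x, real_pos x -> M x) (M1 : ~ M (- uone)).
Hypothesis Mtot : forall x, M x \/ M (- x).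

Let MD x y : M x -> M y -> M (x + y). Proof. by have [h _] := Mcone; exact: h. Qed.
Let MZ (t : R) x : 0 <= t -> M x -> M (t%:C *: x).
Proof. by have [_ h] := Mcone; exact: h. Qed.

Let M_scalar (t : R) : 0 <= t -> M t%:U.
Proof.
move=> t0; apply: MK; rewrite /real_pos star_scalar -scalerDl -rmorphD.
by apply: pos_scalar; rewrite addr_ge0.
Qed.

Let M_scalar_ge0 (t : R) : M t%:U -> 0 <= t.
Proof.
move=> Mt; rewrite leNgt; apply/negP => t0; apply: M1.
have -> : - uone = ((- t)^-1)%:C *: t%:U.
  by rewrite scalerA -rmorphM invrN mulNr mulVf ?lt_eqF// rmorphN scaleN1r.
by apply: MZ => //; rewrite invr_ge0 oppr_ge0 ltW.
Qed.

Let M_norm x : M ((rnorm x)%:U - x).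
Proof.
apply: MK; rewrite /real_pos.
have -> : (rnorm x)%:U - x + star ((rnorm x)%:U - x) =
    (rnorm x + rnorm x)%:U - (x + star x).
  by rewrite starB star_scalar; module.
apply: pos_scalarB; first by rewrite starD starK addrC.
by apply: le_trans (rnormD _ _) _; rewrite rnorm_star.
Qed.

(** A cone that omits [-1] and contains [x] or [-x] for every [x] behaves like a half-space; its
    functional is a Dedekind cut along the unit. *)
Definition cone_fun x : R := sup (fun t : R => M (x - t%:U)).

Lemma cone_fun_bounds x (e : R) : 0 < e ->
  M (x - (cone_fun x - e)%:U) /\ M ((cone_fun x + e)%:U - x).
Proof.
move=> e0; set S : set R := fun t : R => M (x - t%:U).
have Mx t : S t -> t <= rnorm x.
  move=> St; rewrite -subr_ge0; apply: M_scalar_ge0.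
  by have := MD St (M_norm x); congr M; module.
have supS : has_sup S.
  split; last by exists (rnorm x) => t /Mx.
  exists (- rnorm x); have := M_norm (- x); rewrite rnormN /S; congr M; module.
have Sdown t u : u <= t -> S t -> S u.
  move=> ut St; have tu : 0 <= t - u by rewrite subr_ge0.
  by have := MD St (M_scalar tu); rewrite /S; congr M; module.
split.
  have [t St /ltW tS] := sup_adherent e0 supS.
  exact: Sdown tS St.
have [Sp|] := Mtot (x - (cone_fun x + e)%:U); last by rewrite opprB.
have := ub_le_sup supS.2 Sp; rewrite -/S -/(cone_fun x); lra.
Qed.

(** Reduces each linearity rule below to adding or scaling elements of [M]. *)
Lemma cone_fun_unique x (r : R) :
  (forall e : R, 0 < e -> M (x - (r - e)%:U) /\ M ((r + e)%:U - x)) ->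
  cone_fun x = r.
Proof.
move=> h; apply/eqP; rewrite eq_le; apply/andP; split; apply/ler_addgt0Pr => e e0;
  have e2 : 0 < e / 2 by rewrite divr_gt0.
- have [_ h1] := h _ e2; have [h2 _] := cone_fun_bounds x e2.
  rewrite -subr_ge0; apply: M_scalar_ge0; have := MD h1 h2.
  by rewrite [e in r + e - _]splitr; congr M; module.
- have [h1 _] := h _ e2; have [_ h2] := cone_fun_bounds x e2.
  rewrite -subr_ge0; apply: M_scalar_ge0; have := MD h1 h2.
  by rewrite [e in _ + e - _]splitr; congr M; module.
Qed.

Lemma cone_funD x y : cone_fun (x + y) = cone_fun x + cone_fun y.
Proof.
apply: cone_fun_unique => e e0; have e2 : 0 < e / 2 by rewrite divr_gt0.
have [h1 h2] := cone_fun_bounds x e2; have [h3 h4] := cone_fun_bounds y e2.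
rewrite [e]splitr; split.
  by have := MD h1 h3; congr M; module.
by have := MD h2 h4; congr M; module.
Qed.

Lemma cone_funN x : cone_fun (- x) = - cone_fun x.
Proof.
apply: cone_fun_unique => e e0; have [h1 h2] := cone_fun_bounds x e0; split.
  by have := h2; congr M; module.
by have := h1; congr M; module.
Qed.

Lemma cone_fun_ge0 x : M x -> 0 <= cone_fun x.
Proof.
move=> Mx; apply/ler_addgt0Pr => e e0; apply: M_scalar_ge0.
by have [_ h] := cone_fun_bounds x e0; have := MD Mx h; congr M; module.
Qed.

Lemma cone_fun0 x : M x -> M (- x) -> cone_fun x = 0.
Proof.
move=> /cone_fun_ge0 x0 /cone_fun_ge0; rewrite cone_funN oppr_ge0 => x1.
by apply/eqP; rewrite eq_le x0 x1.
Qed.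

Lemma cone_funZ (t : R) x : cone_fun (t%:C *: x) = t * cone_fun x.
Proof.
wlog t0 : t / 0 < t => [hw|].
  have [t0|t0|->] := ltgtP t 0; [|exact: hw|].
    rewrite -[t]opprK rmorphN scaleNr cone_funN hw ?oppr_gt0//.
    by rewrite !mulNr.
  by rewrite rmorph0 scale0r mul0r cone_fun0// ?oppr0 -(scale0r uone); exact: M_scalar.
apply: cone_fun_unique => e e0; have e2 : 0 < e / t by rewrite divr_gt0.
have [h1 h2] := cone_fun_bounds x e2.
have eE : e = t * (e / t) by rewrite mulrC divfK// gt_eqF.
rewrite eE; split.
  by have := MZ (ltW t0) h1; congr M; module.
by have := MZ (ltW t0) h2; congr M; module.
Qed.

Lemma cone_fun1 : cone_fun uone = 1.
Proof.
apply: cone_fun_unique => e e0; split.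
  by have := M_scalar (ltW e0); congr M; module.
by have := M_scalar (ltW e0); congr M; module.
Qed.

Lemma cone_fun_antisa x : star x = - x -> cone_fun x = 0.
Proof.
have pos0 : pos (0 : A) by rewrite -(scale0r uone); exact: pos_scalar.
by move=> xs; apply: cone_fun0; apply: MK; rewrite /real_pos ?starN xs subrr.
Qed.

Lemma cone_fun_star x : cone_fun (star x) = cone_fun x.
Proof.
rewrite -[star x](subrK x) cone_funD cone_fun_antisa ?add0r//.
by rewrite starB starK opprB.
Qed.

(** The usual complexification [f(x) - i f(i x)] of a real functional. *)
Definition cone_state_fun x : R[i] := Complex (cone_fun x) (- cone_fun ('i%C *: x)).

Fact cone_stateP c x y :
  cone_state_fun (c *: x + y) = c * cone_state_fun x + cone_state_fun y.
Proof.
have fZ d z : cone_fun (d *: z) =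
    complex.Re d * cone_fun z + complex.Im d * cone_fun ('i%C *: z).
  rewrite {1}[d]complexE scalerDl cone_funD cone_funZ; congr +%R.
  by rewrite mulrC -scalerA cone_funZ.
rewrite /cone_state_fun scalerDr !cone_funD scalerA (fZ c) (fZ ('i%C * c)).
case: c => u v /=; apply/eqP; rewrite eq_complex /=; apply/andP.
by split; apply/eqP; ring.
Qed.

Fact cone_state_star x : cone_state_fun (star x) = Num.conj (cone_state_fun x).
Proof.
rewrite /cone_state_fun -[Num.conj _]/(conjc _) /= cone_fun_star; congr Complex.
by rewrite -cone_fun_star starZ conj_i starK scaleNr cone_funN.
Qed.

Fact cone_state_ge0 x : 0 <= cone_state_fun (star x ** x).
Proof.
rewrite lecE /= (_ : cone_fun ('i%C *: _) = 0) ?oppr0 ?eqxx /=.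
  apply: cone_fun_ge0; apply: MK; rewrite /real_pos starM starK.
  by apply: posD; exact: pos_star_mul.
by apply: cone_fun_antisa; rewrite starZ starM starK conj_i scaleNr.
Qed.

Fact cone_state1_le1 : cone_state_fun uone <= 1.
Proof.
rewrite lecE /= cone_fun1 lexx andbT (_ : cone_fun _ = 0) ?oppr0//.
by apply: cone_fun_antisa; rewrite starZ star1 conj_i scaleNr.
Qed.

Definition cone_state := State cone_stateP cone_state_star cone_state_ge0 cone_state1_le1.

End Functional.

(** A maximal cone above the peak cone of [star a ** a] forces the value at [star a ** a] to reach
    its norm, which is [|a|^2] by the C*-identity. *)
Theorem norming_state a : exists f : state, (rnorm a ^+ 2)%:C <= f (star a ** a).
Proof.
have [A1|A1] := pselect ((uone : A) = 0).
  have a0 (x : A) : x = 0 by rewrite -[x]umul1l A1 umul0l.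
  have lin0 c (x y : A) : 0 = c * 0 + 0 :> R[i] by rewrite mulr0 addr0.
  unshelve eexists (@State (fun=> 0) lin0 _ _ _).
  - by move=> x; rewrite rmorph0.
  - by move=> x; exact: lexx.
  - exact: ler01.
  by rewrite (a0 a) rnorm0 expr0n /= lexx.
have hp := pos_star_mul a.
have [M [Mc MK M1 Mt]] := maximal_cone hp (erefl _) A1.
have MK' x : real_pos x -> M x by move=> xp; apply: MK; exact: real_pos_peak.
exists (cone_state Mc MK' M1 Mt); rewrite lecE /=.
have := cone_state_ge0 Mc MK' M1 Mt a; rewrite lecE /= => /andP[/eqP -> _].
rewrite eqxx /= -rnorm_cstar -subr_ge0.
have := cone_fun1 Mc MK' M1 Mt => f1.
rewrite -[X in _ - X]mulr1 -f1 -(cone_funZ Mc MK' M1 Mt) -(cone_funN Mc MK' M1 Mt).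
rewrite -(cone_funD Mc MK' M1 Mt); apply: (cone_fun_ge0 Mc MK' M1 Mt).
apply: MK; exists 0, 1; rewrite scale1r add0r; split=> //.
by rewrite /real_pos star0 addr0 -(scale0r uone); exact: pos_scalar.
Qed.

End States.

(** * Semi-inner products and their completion *)

Section SemiInner.
Variables (R : realType) (E : lmodType R[i]).

Record semi_inner := SemiInner {
  form :> E -> E -> R[i];
  formP : forall c x y z, form (c *: x + y) z = c * form x z + form y z;
  formC : forall x y, form y x = Num.conj (form x y);
  form_ge0 : forall x, 0 <= form x x
}.

Variable s : semi_inner.
Implicit Types x y z : E.

Lemma formDl x y z : s (x + y) z = s x z + s y z.
Proof. by rewrite -[x]scale1r formP mul1r scale1r. Qed.
Lemma form0l z : s 0 z = 0.
Proof. by apply: (addIr (s 0 z)); rewrite -formDl !add0r. Qed.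
Lemma formZl c x z : s (c *: x) z = c * s x z.
Proof. by rewrite -[c *: x]addr0 formP form0l addr0. Qed.
Lemma formDr x y z : s z (x + y) = s z x + s z y.
Proof. by rewrite formC formDl rmorphD /= -!formC. Qed.
Lemma formZr c x z : s z (c *: x) = Num.conj c * s z x.
Proof. by rewrite formC formZl rmorphM /= -formC. Qed.
Lemma formNl x z : s (- x) z = - s x z.
Proof. by rewrite -scaleN1r formZl mulN1r. Qed.
Lemma formNr x z : s z (- x) = - s z x.
Proof. by rewrite formC formNl rmorphN /= -formC. Qed.

Definition nsq x : R := complex.Re (s x x).

Lemma nsqE x : s x x = (nsq x)%:C.
Proof. by rewrite /nsq RRe_real// ger0_real// form_ge0. Qed.

Lemma nsq_ge0 x : 0 <= nsq x.
Proof. by rewrite -ler0c -nsqE form_ge0. Qed.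

Lemma nsq0 : nsq 0 = 0. Proof. by rewrite /nsq form0l. Qed.

Lemma nsqZ c x : nsq (c *: x) = rnorm c ^+ 2 * nsq x.
Proof.
apply: (complexI (R := R)); rewrite -nsqE formZl formZr nsqE rmorphM rmorphXn /=.
by rewrite rnormE normCK mulrA.
Qed.

Lemma nsqN x : nsq (- x) = nsq x.
Proof. by rewrite /nsq formNl formNr opprK. Qed.

Lemma Re_form_sym x y : complex.Re (s y x) = complex.Re (s x y).
Proof. by rewrite formC -[Num.conj _]/(conjc _); case: (s x y). Qed.

Lemma nsqD x y : nsq (x + y) = nsq x + 2 * complex.Re (s x y) + nsq y.
Proof.
rewrite /nsq formDl !formDr !raddfD /= (Re_form_sym x y); ring.
Qed.

Lemma nsq_polar x y : complex.Re (s x y) = (nsq (x + y) - nsq (x - y)) / 4.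
Proof.
by rewrite !nsqD nsqN formNr raddfN /=; field.
Qed.

Lemma Im_form x y : complex.Im (s x y) = complex.Re (s x ('i%C *: y)).
Proof.
rewrite formZr -[Num.conj _]/(conjc _); case: (s x y) => u v /=; ring.
Qed.

Lemma cauchy_schwarz_Re x y : complex.Re (s x y) ^+ 2 <= nsq x * nsq y.
Proof.
set w := complex.Re (s x y).
have quad (t : R) : 0 <= nsq x - 2 * t * w + t ^+ 2 * nsq y.
  have := nsq_ge0 (x + (- t)%:C *: y); rewrite nsqD nsqZ rnorm_real formZr conj_real.
  rewrite real_normK ?num_real// sqrrN.
  have -> : complex.Re ((- t)%:C * s x y) = - t * w.
    by rewrite /w; case: (s x y) => u v /=; ring.
  by congr (_ <= _); ring.
have x0 := nsq_ge0 x; have y0 := nsq_ge0 y.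
have [y1|y1] := eqVneq (nsq y) 0; last first.
  have yp : 0 < nsq y by rewrite lt_neqAle eq_sym y1.
  have := quad (w / nsq y).
  have -> : nsq x - 2 * (w / nsq y) * w + (w / nsq y) ^+ 2 * nsq y =
    nsq x - w ^+ 2 / nsq y by field.
  by rewrite subr_ge0 ler_pdivrMr.
rewrite y1 mulr0; have [->|w0] := eqVneq w 0; first by rewrite expr0n.
(* With [nsq y = 0] the quadratic is affine in [t], and this [t] gives it the value -1. *)
have := quad ((nsq x + 1) / (2 * w)); rewrite y1 mulr0 addr0.
have -> : nsq x - 2 * ((nsq x + 1) / (2 * w)) * w = -1 by field.
by rewrite oppr_ge0 ler10.
Qed.

Definition hnorm x : R := Num.sqrt (nsq x).

Lemma hnorm_ge0 x : 0 <= hnorm x. Proof. exact: sqrtr_ge0. Qed.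

Lemma sqr_hnorm x : hnorm x ^+ 2 = nsq x.
Proof. by rewrite sqr_sqrtr// nsq_ge0. Qed.

Lemma hnorm_le x (M : R) : 0 <= M -> (hnorm x <= M) = (nsq x <= M ^+ 2).
Proof.
by move=> M0; rewrite -sqr_hnorm ler_pXn2r ?nnegrE// hnorm_ge0.
Qed.

Lemma hnormZ c x : hnorm (c *: x) = rnorm c * hnorm x.
Proof.
by rewrite /hnorm nsqZ sqrtrM ?sqr_ge0// sqrtr_sqr ger0_norm// rnorm_ge0.
Qed.

Lemma hnormN x : hnorm (- x) = hnorm x. Proof. by rewrite /hnorm nsqN. Qed.

Lemma hnormD x y : hnorm (x + y) <= hnorm x + hnorm y.
Proof.
rewrite hnorm_le ?addr_ge0 ?hnorm_ge0// nsqD sqrrD !sqr_hnorm lerD2r lerD2l.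
rewrite -[leRHS]mulr_natl ler_pM2l//; apply: le_trans (ler_norm _) _.
rewrite -(ler_pXn2r (n := 2)) ?nnegrE ?mulr_ge0 ?hnorm_ge0//.
by rewrite exprMn !sqr_hnorm real_normK ?num_real// cauchy_schwarz_Re.
Qed.

End SemiInner.

(** * Extension of bounded linear maps to completions *)

Section Extension.
Variable R : realType.

Record bounded_linear (P Q : seminormedAlgType R) := BoundedLinear {
  bl_fun :> P -> Q;
  bl_linear : forall (c : R[i]) x y, bl_fun (c *: x + y) = c *: bl_fun x + bl_fun y;
  bl_bound : exists2 M : R, 0 <= M & forall x, seminorm (bl_fun x) <= M * seminorm x
}.

Variables P Q : seminormedAlgType R.
Variable F : bounded_linear P Q.

Lemma blB x y : F (x - y) = F x - F y.
Proof. by rewrite -scaleN1r addrC bl_linear scaleN1r addrC. Qed.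

Fact bl_cauchy (u : cseq P) : cauchy_seq (fun n => F (u n)).
Proof.
have [M M0 hM] := bl_bound F; move=> e e0.
have M1 : 0 < M + 1 by rewrite ltr_wpDl.
have [|n hn] := cseqP u (e := e / (M + 1)); first by rewrite divr_gt0.
exists n => i j ni nj; rewrite -blB; apply: le_lt_trans (hM _) _.
apply: le_lt_trans (_ : (M + 1) * seminorm (u i - u j) < e).
  by rewrite ler_wpM2r ?seminorm_ge0// lerDl.
by rewrite mulrC -ltr_pdivlMr// hn.
Qed.

Definition bl_cseq (u : cseq P) := CSeq (bl_cauchy u).

Definition extend (x : completion P) : completion Q := cclass (bl_cseq (repr x)).

Lemma extend_cclass u : extend (cclass u) = cclass (bl_cseq u).
Proof.
have [M M0 hM] := bl_bound F; apply/eqP/cclassP => e e0.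
have M1 : 0 < M + 1 by rewrite ltr_wpDl.
have [|n hn] := repr_cclass u (e := e / (M + 1)); first by rewrite divr_gt0.
exists n => i ni /=; rewrite -blB; apply: le_lt_trans (hM _) _.
apply: le_lt_trans (_ : (M + 1) * seminorm (repr (cclass u) i - u i) < e).
  by rewrite ler_wpM2r ?seminorm_ge0// lerDl.
by rewrite mulrC -ltr_pdivlMr// hn.
Qed.

Lemma extend_incl p : extend (completion_incl p) = completion_incl (F p).
Proof. by rewrite extend_cclass; apply: eq_cclass. Qed.

Fact extend_linear : linear extend.
Proof.
move=> c; elim/completionW => u; elim/completionW => v.
rewrite cclassZ cclassD !extend_cclass cclassZ cclassD.
by apply: eq_cclass => n /=; rewrite bl_linear.
Qed.

HB.instance Definition _ :=
  GRing.isLinear.Build R[i] (completion P) (completion Q) *:%R extend extend_linear.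

Lemma rnorm_completion (T : seminormedAlgType R) (x : completion T) :
  rnorm x = completion_rnorm x.
Proof. by apply: (complexI (R := R)); rewrite rnormE completion_normE. Qed.

Lemma rnorm_incl (T : seminormedAlgType R) (p : T) :
  rnorm (completion_incl p) = seminorm p.
Proof. by apply: (complexI (R := R)); rewrite rnormE completion_incl_norm. Qed.

Lemma rnorm_extend (M : R) x : 0 <= M ->
  (forall p, seminorm (F p) <= M * seminorm p) -> rnorm (extend x) <= M * rnorm x.
Proof.
move=> M0 hM; rewrite !rnorm_completion; elim/completionW: x => u.
rewrite extend_cclass; apply/ler_addgt0Pr => e e0.
have M1 : 0 < M + 1 by rewrite ltr_wpDl.
have e1 : 0 < e / (M + 1) by rewrite divr_gt0.
have [|n hn] := @completion_rnorm_lt _ _ u (completion_rnorm (cclass u) + e / (M + 1)).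
  by rewrite ltrDl.
apply: completion_rnorm_le; exists n => i /hn ui; apply: le_trans (hM _) _.
apply: le_trans (ler_wpM2l M0 (ltW ui)) _; rewrite mulrDr lerD2l.
by rewrite mulrA ler_pdivrMr// mulrC ler_wpM2l ?(ltW e0)// lerDl.
Qed.

Lemma extend_continuous : continuous extend.
Proof.
have [M M0 hM] := bl_bound F; apply: bounded_linear_continuous.
apply/linear_boundedP; exists M%:C; split; first by rewrite realE lecR M0.
move=> r /ltW Mr x; rewrite -!rnormE.
apply: le_trans (_ : (M * rnorm x)%:C <= _); first by rewrite lecR rnorm_extend.
by rewrite rmorphM /= ler_wpM2r// ler0c rnorm_ge0.
Qed.

End Extension.

(** * The inner product of a completed semi-inner product space *)

Section InnerCompletion.
Variables (R : realType) (P : seminormedAlgType R) (s : semi_inner P).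
Hypothesis seminorm_form : forall p, seminorm p = hnorm s p.

Local Open Scope classical_set_scope.

(** Polarization from the norm of the completion, so that independence of representatives needs no
    argument. *)
Definition rinner (x y : completion P) : R :=
  (completion_rnorm (x + y) ^+ 2 - completion_rnorm (x - y) ^+ 2) / 4.

Lemma cvg_rinner (u v : cseq P) :
  (fun n => complex.Re (s (u n) (v n))) @ \oo --> rinner (cclass u) (cclass v).
Proof.
rewrite /rinner cclassN !cclassD.
set a := CSeq _; set b := CSeq (cauchy_add _ (CSeq _)).
have -> : (fun n => complex.Re (s (u n) (v n))) =
    (fun n => (seminorm (a n) ^+ 2 - seminorm (b n) ^+ 2) / 4).
  by apply/funext => n; rewrite nsq_polar !seminorm_form !sqr_hnorm.
apply: cvgM; last exact: cvg_cst.
by apply: cvgB; rewrite expr2; under eq_fun do rewrite expr2; apply: cvgM;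
  exact: cvg_seminorm.
Qed.

Definition completion_inner (x y : completion P) : R[i] :=
  Complex (rinner x y) (rinner x ('i%C *: y)).

Definition cvgC (f : nat -> R[i]) (l : R[i]) :=
  ((fun n => complex.Re (f n)) @ \oo --> complex.Re l) /\
  ((fun n => complex.Im (f n)) @ \oo --> complex.Im l).

Lemma cvgC_unique f l m : cvgC f l -> cvgC f m -> l = m.
Proof.
case: l m => [l1 l2] [m1 m2] [/= f1 f2] [/= g1 g2].
by congr Complex; [exact: cvg_unique f1 g1|exact: cvg_unique f2 g2].
Qed.

Lemma cvgCMD c f g l m : cvgC f l -> cvgC g m ->
  cvgC (fun n => c * f n + g n) (c * l + m).
Proof.
case: c l m => [a b] [l1 l2] [m1 m2] [/= f1 f2] [/= g1 g2]; split => /=.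
  have -> : (fun n => complex.Re ((a +i* b)%C * f n + g n)) =
      (fun n => a * complex.Re (f n) - b * complex.Im (f n) + complex.Re (g n)).
    by apply/funext => n; case: (f n) (g n) => ? ? [].
  by apply: cvgD => //; apply: cvgB; apply: cvgM => //; exact: cvg_cst.
have -> : (fun n => complex.Im ((a +i* b)%C * f n + g n)) =
    (fun n => a * complex.Im (f n) + b * complex.Re (f n) + complex.Im (g n)).
  by apply/funext => n; case: (f n) (g n) => ? ? [].
by apply: cvgD => //; apply: cvgD; apply: cvgM => //; exact: cvg_cst.
Qed.

Lemma cvgC_conj f l : cvgC f l -> cvgC (fun n => Num.conj (f n)) (Num.conj l).
Proof.
case: l => [l1 l2] [/= f1 f2]; split => /=.
  have -> // : (fun n => complex.Re (Num.conj (f n))) = (fun n => complex.Re (f n)).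
  by apply/funext => n; rewrite -[Num.conj _]/(conjc _); case: (f n).
have -> : (fun n => complex.Im (Num.conj (f n))) = (fun n => - complex.Im (f n)).
  by apply/funext => n; rewrite -[Num.conj _]/(conjc _); case: (f n).
exact: cvgN.
Qed.

Lemma cvg_inner (u v : cseq P) :
  cvgC (fun n => s (u n) (v n)) (completion_inner (cclass u) (cclass v)).
Proof.
split; first exact: cvg_rinner.
rewrite /= cclassZ; under eq_fun do rewrite Im_form.
exact: (@cvg_rinner u (CSeq (cauchy_scale 'i%C v))).
Qed.

Lemma completion_innerP c x y z : completion_inner (c *: x + y) z =
  c * completion_inner x z + completion_inner y z.
Proof.
elim/completionW: x => u; elim/completionW: y => v; elim/completionW: z => w.
apply: cvgC_unique (cvgCMD c (cvg_inner u w) (cvg_inner v w)).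
rewrite cclassZ cclassD; under eq_fun do rewrite -formP.
exact: cvg_inner.
Qed.

Lemma completion_innerC x y : completion_inner y x = Num.conj (completion_inner x y).
Proof.
elim/completionW: x => u; elim/completionW: y => v.
apply: cvgC_unique (cvgC_conj (cvg_inner u v)).
under eq_fun do rewrite -formC; exact: cvg_inner.
Qed.

Lemma completion_inner_norm x : completion_inner x x = `|x| ^+ 2.
Proof.
rewrite completion_normE -rmorphXn /=; congr Complex.
  rewrite /rinner subrr -!rnorm_completion rnorm0.
  have -> : x + x = (2 : R)%:C *: x by rewrite rmorph_nat scaler_nat mulr2n.
  by rewrite rnormZr ger0_norm//; field.
rewrite /rinner -!rnorm_completion.
have -> : x + 'i%C *: x = 'i%C *: (x - 'i%C *: x).
  by rewrite scalerBr scalerA -expr2 sqr_i scaleN1r opprK addrC.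
by rewrite rnormZ rnorm_i mul1r subrr mul0r.
Qed.

End InnerCompletion.

(* The completion of a semi-inner product space [E] is obtained from the       *)
(* completion of seminormed algebras applied to the trivial extension of [E]; *)
(* the factor 2 makes the Hilbert seminorm submultiplicative there.            *)
Definition semihilb (R : realType) (E : lmodType R[i]) (s : semi_inner E) : Type :=
  trivext E.

Section Semihilbert.
Variables (R : realType) (E : lmodType R[i]) (s : semi_inner E).
Local Notation semihilb := (semihilb s).

HB.instance Definition _ := GRing.Lmodule.on semihilb.

Let smul (u v : semihilb) : semihilb := (u : trivext E) * (v : trivext E).

Fact smulZl (c : R[i]) u v : smul (c *: u) v = c *: smul u v.
Proof.
case: u v => [a x] [b y]; rewrite /smul; congr pair; first exact: (esym (mulrA _ _ _)).
by rewrite /= scalerDr !scalerA [b * c]mulrC.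
Qed.
Fact smulZr (c : R[i]) u v : smul u (c *: v) = c *: smul u v.
Proof.
have smulC (a b : semihilb) : smul a b = smul b a by exact: mulrC.
by rewrite smulC smulZl smulC.
Qed.

HB.instance Definition _ := isUnitalAlgebra.Build R semihilb
  (@mulrA (trivext E)) (@mul1r (trivext E)) (@mulr1 (trivext E))
  (@mulrDl (trivext E)) (@mulrDr (trivext E)) smulZl smulZr.

Definition semihilb_form (u v : semihilb) : R[i] :=
  2 * ((u.1 : R[i]) * Num.conj (v.1 : R[i]) + s u.2 v.2).

Fact semihilb_formP c u v w :
  semihilb_form (c *: u + v) w = c * semihilb_form u w + semihilb_form v w.
Proof.
by rewrite /semihilb_form /= formP -[c *: u.1]/(c * u.1); ring.
Qed.
Fact semihilb_formC u v : semihilb_form v u = Num.conj (semihilb_form u v).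
Proof.
rewrite /semihilb_form rmorphM rmorph_nat rmorphD /= rmorphM /= conjCK -formC.
by rewrite [(v.1 : R[i]) * _]mulrC.
Qed.
Fact semihilb_form_ge0 u : 0 <= semihilb_form u u.
Proof.
by rewrite mulr_ge0// addr_ge0 ?form_ge0// -normCK exprn_ge0.
Qed.

Definition semihilb_inner := SemiInner semihilb_formP semihilb_formC semihilb_form_ge0.

Lemma nsq_semihilb u : nsq semihilb_inner u = 2 * (rnorm (u.1 : R[i]) ^+ 2 + nsq s u.2).
Proof.
apply: (complexI (R := R)); rewrite -nsqE /= /semihilb_form nsqE -normCK -rnormE.
by rewrite rmorphM rmorph_nat rmorphD rmorphXn.
Qed.

Fact semihilb_normM (u v : semihilb) : hnorm semihilb_inner (u ** v) <=
  hnorm semihilb_inner u * hnorm semihilb_inner v.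
Proof.
rewrite hnorm_le ?mulr_ge0 ?hnorm_ge0// exprMn !sqr_hnorm !nsq_semihilb.
case: u v => [a x] [b y] /=.
have h : nsq s (a *: y + b *: x) <= 2 * (nsq s (a *: y) + nsq s (b *: x)).
  have := nsq_ge0 s (a *: y - b *: x); rewrite !nsqD nsqN formNr raddfN /=; lra.
have ab : rnorm (a * b) = rnorm a * rnorm b by exact: (@rnormZ R R[i]^o).
rewrite !nsqZ in h; rewrite ab exprMn.
have x0 := nsq_ge0 s x; have y0 := nsq_ge0 s y.
have a0 := sqr_ge0 (rnorm a); have b0 := sqr_ge0 (rnorm b).
have := mulr_ge0 x0 y0; have := mulr_ge0 a0 b0; nra.
Qed.

HB.instance Definition _ := isSeminormedAlgebra.Build R semihilb
  (hnormD semihilb_inner) (fun c p => hnormZ semihilb_inner c p) semihilb_normM.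

Definition hilb : Type := completion semihilb.
HB.instance Definition _ := CompleteNormedModule.on hilb.

Definition hilb_inner (x y : hilb) : R[i] := completion_inner x y.

Fact seminorm_semihilb (p : semihilb) : seminorm p = hnorm semihilb_inner p.
Proof. by []. Qed.

Fact hilb_bilinear : bilinear_for *%R (Num.conj \; *%R) hilb_inner.
Proof.
split=> [z c x y|z c x y] /=; first exact: (completion_innerP seminorm_semihilb).
rewrite /hilb_inner (completion_innerC seminorm_semihilb).
rewrite (completion_innerP seminorm_semihilb) rmorphD rmorphM /=.
by rewrite -!(completion_innerC seminorm_semihilb).
Qed.
HB.instance Definition _ := bilinear_isBilinear.Build R[i] hilb hilb R[i]
  *%R (Num.conj \; *%R) hilb_inner hilb_bilinear.

Fact hilb_hermitian x y : hilb_inner x y = (-1) ^+ false * Num.conj (hilb_inner y x).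
Proof. by rewrite mul1r; exact: (completion_innerC seminorm_semihilb). Qed.
HB.instance Definition _ := isHermitianSesquilinear.Build R[i] hilb false Num.conj
  hilb_inner hilb_hermitian.

Fact hilb_inner_norm x : hilb_inner x x = `|x| ^+ 2.
Proof. exact: completion_inner_norm. Qed.

Fact hilb_dot x : x != 0 -> 0 < hilb_inner x x.
Proof. by move=> x0; rewrite hilb_inner_norm exprn_gt0// normr_gt0. Qed.
HB.instance Definition _ := isDotProduct.Build R[i] hilb hilb_inner hilb_dot.

HB.instance Definition _ := isHilbert.Build R hilb hilb_inner_norm.

End Semihilbert.

(** * Covariant representations on semi-inner product spaces *)

Section PreCovariant.
Variables (R : realType) (A : cstarAlgType R) (alpha : starHom A A).

(** A covariant pair on a space whose form may be degenerate and incomplete. No bound is asked of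
    [pc_op]: [pc_op_le] derives it, and [hilb_covariant] completes the pair to a genuine one. *)
Record precov (E : lmodType R[i]) (s : semi_inner E) := Precov {
  pc_op : A -> E -> E;
  pc_V : E -> E;
  pc_linear : forall a c x y, pc_op a (c *: x + y) = c *: pc_op a x + pc_op a y;
  pc_linearl : forall c a b x, pc_op (c *: a + b) x = c *: pc_op a x + pc_op b x;
  pcM : forall a b x, pc_op (a ** b) x = pc_op a (pc_op b x);
  pc_star : forall a x y, s (pc_op a x) y = s x (pc_op (star a) y);
  pcV_linear : forall c x y, pc_V (c *: x + y) = c *: pc_V x + pc_V y;
  pcV_le : forall x, nsq s (pc_V x) <= nsq s x;
  pc_cov : forall a x, pc_op a (pc_V x) = pc_V (pc_op (alpha a) x)
}.

Variables (E : lmodType R[i]) (s : semi_inner E) (rho : precov s).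
Local Notation op := (pc_op rho).
Local Notation V := (pc_V rho).
Implicit Types (a b : A) (x y : E).

Lemma pcDl a b x : op (a + b) x = op a x + op b x.
Proof. by rewrite -[a]scale1r pc_linearl !scale1r. Qed.
Lemma pc0l x : op 0 x = 0.
Proof. by apply: (addIr (op 0 x)); rewrite -pcDl !add0r. Qed.
Lemma pcZl c a x : op (c *: a) x = c *: op a x.
Proof. by rewrite -[c *: a]addr0 pc_linearl pc0l addr0. Qed.
Lemma pcNl a x : op (- a) x = - op a x.
Proof. by rewrite -[- a]scaleN1r pcZl scaleN1r. Qed.
Lemma pcVD x y : V (x + y) = V x + V y.
Proof. by rewrite -[x]scale1r pcV_linear !scale1r. Qed.
Lemma pcV0 : V 0 = 0.
Proof. by apply: (addIr (V 0)); rewrite -pcVD !add0r. Qed.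

Lemma pc1_le x : nsq s (op uone x) <= nsq s x.
Proof.
have e1 : s (op uone x) (op uone x) = s (op uone x) x.
  by rewrite [RHS]pc_star star1 [LHS]pc_star star1 -pcM umul1l.
have := nsq_ge0 s (x - op uone x); rewrite nsqD nsqN formNr raddfN /=.
rewrite Re_form_sym -e1 -/(nsq s _); lra.
Qed.

(** Write [|a|^2 - star a ** a + e] as [b^2] with [b] self-adjoint and expand the nonnegative number
    [nsq s (op b x)]. The unit may act as a proper projection, whence the appeal to [pc1_le]. *)
Lemma pc_op_le a x : nsq s (op a x) <= rnorm a ^+ 2 * nsq s x.
Proof.
set t := rnorm a ^+ 2; apply: (@ler_small _ _ _ (nsq s x)); first exact: nsq_ge0.
move=> e e0; have := pos_star_mul a => ap.
have tp : pos (t%:C *: uone - star a ** a).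
  by apply: pos_scalarB; [exact: ap.1|rewrite rnorm_cstar].
have [b [[bs _] bb _]] := pos_root tp e0.
have := nsq_ge0 s (op b x); rewrite /nsq pc_star bs -pcM bb.
have -> : t%:C *: uone - star a ** a + e%:C *: uone = (t + e)%:C *: uone - star a ** a.
  by module.
rewrite pcDl pcNl pcZl formDr formNr formZr conj_real pcM -pc_star.
have -> : s x (op uone x) = s (op uone x) (op uone x).
  by rewrite [RHS]pc_star star1 -pcM umul1l.
rewrite !nsqE -rmorphM -rmorphB /= subr_ge0 => h; apply: le_trans h _.
rewrite [nsq s x * e]mulrC -mulrDl ler_wpM2l ?pc1_le// addr_ge0 ?sqr_ge0// ltW//.
Qed.

(** The scalar summand of the trivial extension is killed; this is harmless since representations
    may be degenerate. *)
Definition lift (f : E -> E) (u : semihilb s) : semihilb s := (0, f u.2).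

Fact lift_linear f : (forall c x y, f (c *: x + y) = c *: f x + f y) ->
  forall c u v, lift f (c *: u + v) = c *: lift f u + lift f v.
Proof.
by move=> fl c [a x] [b y]; rewrite /lift /= fl; congr pair; rewrite /= scaler0 addr0.
Qed.

Fact lift_le f (M : R) : 0 <= M -> (forall x, nsq s (f x) <= M ^+ 2 * nsq s x) ->
  forall u, seminorm (lift f u) <= M * seminorm u.
Proof.
move=> M0 fM u; rewrite hnorm_le ?mulr_ge0 ?hnorm_ge0// exprMn sqr_hnorm.
rewrite !nsq_semihilb /= rnorm0 expr0n add0r mulrCA ler_pM2l//.
by apply: le_trans (fM _) _; rewrite ler_wpM2l ?sqr_ge0// lerDr sqr_ge0.
Qed.

Fact lift_bound f (M : R) : 0 <= M -> (forall x, nsq s (f x) <= M ^+ 2 * nsq s x) ->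
  exists2 M : R, 0 <= M & forall u, seminorm (lift f u) <= M * seminorm u.
Proof. by move=> M0 fM; exists M => // u; exact: lift_le. Qed.

Definition lift_op a : bounded_linear (semihilb s) (semihilb s) :=
  BoundedLinear (lift_linear (pc_linear rho a))
    (lift_bound (rnorm_ge0 a) (pc_op_le a)).

Fact pcV_le1 x : nsq s (V x) <= 1 ^+ 2 * nsq s x.
Proof. by rewrite expr1n mul1r pcV_le. Qed.

Definition lift_V : bounded_linear (semihilb s) (semihilb s) :=
  BoundedLinear (lift_linear (pcV_linear rho)) (lift_bound ler01 pcV_le1).

Definition hilb_op a : {linear hilb s -> hilb s} := extend (lift_op a).

Fact hilb_op_linear (c : R[i]) a b (x : hilb s) :
  hilb_op (c *: a + b) x = c *: hilb_op a x + hilb_op b x.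
Proof.
elim/completionW: x => u; rewrite /= !extend_cclass cclassZ cclassD.
apply: eq_cclass => n; rewrite /= /lift pc_linearl.
by congr pair; rewrite /= scaler0 addr0.
Qed.

Fact hilb_opM a b (x : hilb s) : hilb_op (a ** b) x = hilb_op a (hilb_op b x).
Proof.
elim/completionW: x => u; rewrite /= !extend_cclass.
by apply: eq_cclass => n; rewrite /= /lift pcM.
Qed.

Fact hilb_op_star a (x y : hilb s) :
  inner (hilb_op a x) y = inner x (hilb_op (star a) y).
Proof.
elim/completionW: x => u; elim/completionW: y => v.
rewrite /= !extend_cclass.
apply: cvgC_unique (cvg_inner (@seminorm_semihilb _ _ s) _ _) _.
have := cvg_inner (@seminorm_semihilb _ _ s) u (bl_cseq (lift_op (star a)) v).
congr cvgC; apply/funext => n /=.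
by rewrite /semihilb_form /= rmorph0 mulr0 mul0r pc_star.
Qed.

Definition hilb_rep : star_rep A (hilb s) :=
  @StarRep R A (hilb s) hilb_op (fun a => @extend_continuous _ _ _ (lift_op a))
   hilb_op_linear hilb_opM hilb_op_star.

Definition hilb_V : {linear hilb s -> hilb s} := extend lift_V.

Fact hilb_V_le (x : hilb s) : `|hilb_V x| <= `|x|.
Proof.
by rewrite -rnorm_le -[leRHS]mul1r; apply: rnorm_extend => // u; exact: lift_le ler01 pcV_le1 u.
Qed.

Fact hilb_cov a (x : hilb s) : hilb_rep a (hilb_V x) = hilb_V (hilb_rep (alpha a) x).
Proof.
elim/completionW: x => u; rewrite /= !extend_cclass.
by apply: eq_cclass => n; rewrite /= /lift pc_cov.
Qed.

Definition hilb_covariant : covariant_rep alpha (hilb s) :=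
  CovariantRep hilb_V_le hilb_cov.

Definition peval (p : twisted_poly alpha) n x := \sum_(k < n) iter k V (op (p k) x).

Definition hilb_incl x : hilb s := completion_incl ((0, x) : semihilb s).

Lemma hilb_inclD x y : hilb_incl (x + y) = hilb_incl x + hilb_incl y.
Proof.
rewrite /hilb_incl /completion_incl cclassD; apply: eq_cclass => n /=.
by congr pair; rewrite /= addr0.
Qed.

Lemma hilb_eval (p : twisted_poly alpha) n x : (forall k, (n <= k)%N -> p k = 0) ->
  cov_eval hilb_covariant p (hilb_incl x) = hilb_incl (peval p n x).
Proof.
move=> pn; rewrite (cov_evalE _ _ pn) /peval.
have i0 : hilb_incl 0 = 0 by apply: (addIr (hilb_incl 0)); rewrite -hilb_inclD !add0r.
rewrite (big_morph _ hilb_inclD i0); apply: eq_bigr => k _ /=.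
rewrite {2}/hilb_incl extend_incl.
rewrite -[completion_incl _]/(hilb_incl (op (p k) x)); move: (op (p k) x) => y.
by elim: (k : nat) => //= j ->; rewrite extend_incl.
Qed.

Lemma seminorm_incl x : seminorm ((0, x) : semihilb s) ^+ 2 = 2 * nsq s x.
Proof.
by rewrite seminorm_semihilb sqr_hnorm nsq_semihilb /= rnorm0 expr0n add0r.
Qed.

(** Explicit pairs bound the semicrossed norm from below through this inequality. The factor 2 of
    [seminorm_incl] occurs on both sides and cancels. *)
Theorem peval_le (p : twisted_poly alpha) n x : (forall k, (n <= k)%N -> p k = 0) ->
  nsq s (peval p n x) <= semicrossed_norm p ^+ 2 * nsq s x.
Proof.
move=> pn; have := le_semicrossed_norm p hilb_covariant (hilb_incl x).
rewrite (hilb_eval _ pn) !rnorm_incl.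
rewrite -(ler_pXn2r (n := 2)) ?nnegrE ?mulr_ge0 ?seminorm_ge0 ?semicrossed_norm_ge0//.
by rewrite exprMn !seminorm_incl mulrCA ler_pM2l.
Qed.

End PreCovariant.

(** * GNS forms, sums of forms, and the defect form of a contraction *)

Section Forms.
Variable R : realType.

Section GNS.
Variables (A : cstarAlgType R) (f : state A).

Fact gns_formP c x y z : f (star z ** (c *: x + y)) = c * f (star z ** x) + f (star z ** y).
Proof. by rewrite umulDr umulZr stateP. Qed.
Fact gns_formC x y : f (star x ** y) = Num.conj (f (star y ** x)).
Proof. by rewrite -state_star starM starK. Qed.

Definition gns : semi_inner A :=
  SemiInner (form := fun x y => f (star y ** x)) gns_formP gns_formC (state_ge0 f).

Lemma gns_left a x y : gns (a ** x) y = gns x (star a ** y).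
Proof. by rewrite /= starM starK umulA. Qed.

Lemma nsq_gns1 : nsq gns uone <= 1.
Proof.
by rewrite -lecR -nsqE /= star1 umul1l; exact: state1_le1.
Qed.

End GNS.

(** Turns norm inequalities in [A] into scalar inequalities, one for each state. *)
Lemma rnorm_le_gns (A : cstarAlgType R) (a : A) (M : R) : 0 <= M ->
  (forall f : state A, nsq (gns f) a <= M ^+ 2) -> rnorm a <= M.
Proof.
move=> M0 h; have [f fa] := norming_state a.
rewrite -(ler_pXn2r (n := 2)) ?nnegrE ?rnorm_ge0//; apply: le_trans (h f).
by rewrite -lecR -nsqE.
Qed.

Section Pair.
Variables (E1 E2 : lmodType R[i]) (s1 : semi_inner E1) (s2 : semi_inner E2).

Fact pair_formP c (x y z : E1 * E2) :
  s1 (c *: x + y).1 z.1 + s2 (c *: x + y).2 z.2 =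
  c * (s1 x.1 z.1 + s2 x.2 z.2) + (s1 y.1 z.1 + s2 y.2 z.2).
Proof. by rewrite /= !formP; ring. Qed.
Fact pair_formC (x y : E1 * E2) :
  s1 y.1 x.1 + s2 y.2 x.2 = Num.conj (s1 x.1 y.1 + s2 x.2 y.2).
Proof. by rewrite rmorphD /= -!formC. Qed.
Fact pair_form_ge0 (x : E1 * E2) : 0 <= s1 x.1 x.1 + s2 x.2 x.2.
Proof. by rewrite addr_ge0 ?form_ge0. Qed.

Definition pair_inner : semi_inner (E1 * E2)%type :=
  SemiInner (form := fun x y => s1 x.1 y.1 + s2 x.2 y.2)
    pair_formP pair_formC pair_form_ge0.

Lemma nsq_pair x : nsq pair_inner x = nsq s1 x.1 + nsq s2 x.2.
Proof. by rewrite /nsq raddfD. Qed.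

End Pair.

Section Sum.
Variables (E : lmodType R[i]) (s : semi_inner E) (n : nat).

Fact sum_formP c (x y z : nat -> E) : \sum_(i < n) s ((c *: x + y) i) (z i) =
  c * (\sum_(i < n) s (x i) (z i)) + \sum_(i < n) s (y i) (z i).
Proof.
rewrite mulr_sumr -big_split /=; apply: eq_bigr => i _.
by rewrite -formP.
Qed.
Fact sum_formC (x y : nat -> E) :
  \sum_(i < n) s (y i) (x i) = Num.conj (\sum_(i < n) s (x i) (y i)).
Proof. by rewrite rmorph_sum /=; apply: eq_bigr => i _; exact: formC. Qed.
Fact sum_form_ge0 (x : nat -> E) : 0 <= \sum_(i < n) s (x i) (x i).
Proof. by apply: sumr_ge0 => i _; exact: form_ge0. Qed.

(** Sequences are infinite, but only their first [n] entries count; a shift may push entries out of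
    sight. *)
Definition sum_inner : semi_inner (nat -> E) :=
  SemiInner (form := fun x y : nat -> E => \sum_(i < n) s (x i) (y i))
    sum_formP sum_formC sum_form_ge0.

Lemma nsq_sum x : nsq sum_inner x = \sum_(i < n) nsq s (x i).
Proof. by rewrite /nsq raddf_sum. Qed.

End Sum.

Section HilbertForm.
Variable H : hilbertType R.

Fact hilbert_formP c (x y z : H) : inner (c *: x + y) z = c * inner x z + inner y z.
Proof. by rewrite linearPl. Qed.
Fact hilbert_formC (x y : H) : inner y x = Num.conj (inner x y).
Proof. by rewrite (hermitian_subproof y x) mul1r. Qed.
Fact hilbert_form_ge0 (x : H) : 0 <= inner x x.
Proof. by rewrite inner_norm exprn_ge0. Qed.

Definition hilbert_inner : semi_inner H :=
  SemiInner hilbert_formP hilbert_formC hilbert_form_ge0.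

Lemma nsq_hilbert x : nsq hilbert_inner x = rnorm x ^+ 2.
Proof. by rewrite /nsq /= inner_rnorm. Qed.

Variable V : {linear H -> H}.
Hypothesis V_le : forall x, `|V x| <= `|x|.

Definition defect_form (x y : H) : R[i] := inner x y - inner (V x) (V y).

Fact defect_formP c x y z :
  defect_form (c *: x + y) z = c * defect_form x z + defect_form y z.
Proof. by rewrite /defect_form linearP !hilbert_formP; ring. Qed.
Fact defect_formC x y : defect_form y x = Num.conj (defect_form x y).
Proof. by rewrite /defect_form rmorphB /= -!hilbert_formC. Qed.
Fact defect_form_ge0 x : 0 <= defect_form x x.
Proof. by rewrite subr_ge0 !inner_norm lerXn2r// ?nnegrE. Qed.

Definition defect_inner : semi_inner H :=
  SemiInner defect_formP defect_formC defect_form_ge0.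

Lemma nsq_defect x : nsq defect_inner x = rnorm x ^+ 2 - rnorm (V x) ^+ 2.
Proof. by rewrite /nsq /= /defect_form !inner_rnorm -rmorphB. Qed.

End HilbertForm.

End Forms.

Section GNSBound.
Variables (R : realType) (A : cstarAlgType R).

HB.instance Definition _ := isStarHom.Build R A A idfun
  erefl (fun _ _ => erefl) (fun _ => erefl).

(** A device to obtain the bound of left multiplication from [pc_op_le]; hence the trivial
    endomorphism and contraction. *)
Definition gns_precov (f : state A) : precov (A := A) idfun (gns f).
apply: (@Precov _ _ idfun A (gns f) umul (fun=> 0)).
- by move=> b c y z; rewrite umulDr umulZr.
- by move=> c b d y; rewrite umulDl umulZl.
- by move=> b c y; rewrite umulA.
- exact: gns_left.
- by move=> c y z; rewrite scaler0 addr0.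
- by move=> y; rewrite nsq0 nsq_ge0.
- by move=> b y; rewrite umul0r.
Defined.

Lemma nsq_gnsM (f : state A) (a x : A) : nsq (gns f) (a ** x) <= rnorm a ^+ 2 * nsq (gns f) x.
Proof. exact: (pc_op_le (gns_precov f)). Qed.

End GNSBound.

(** * Norm estimates for polynomials from explicit covariant pairs *)

Section PolynomialNorms.
Variables (R : realType) (A : cstarAlgType R) (alpha : starHom A A).
Implicit Types (a b : A) (p q : twisted_poly alpha).

Lemma iter_star i a : iter i alpha (star a) = star (iter i alpha a).
Proof. by elim: i => //= i ->; rewrite starhom_star. Qed.

Section LeftMultiplication.
Variable c : A.
Hypotheses (c1 : rnorm c <= 1) (c_cov : forall a, a ** c = c ** alpha a).

Fact left_le (f : state A) x : nsq (gns f) (c ** x) <= nsq (gns f) x.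
Proof.
apply: le_trans (nsq_gnsM _ _ _) _; rewrite ler_piMl ?nsq_ge0//.
by rewrite exprn_ile1// rnorm_ge0.
Qed.

(* The representation [V = c (x) [[0, 0], [d, r]]]; it gives a Schwarz-Pick   *)
(* estimate for [z |-> \sum_k z^k c^k p_k] between [0] and [r].               *)
Definition schwarz_precov (r d : R) (rd : r ^+ 2 + d ^+ 2 <= 1) (f : state A) :
  precov alpha (pair_inner (gns f) (gns f)).
apply: (@Precov _ _ alpha _ (pair_inner (gns f) (gns f))
  (fun a x => (a ** x.1, a ** x.2))
  (fun x => (0, c ** (d%:C *: x.1 + r%:C *: x.2)))).
- by move=> b e y z; congr pair; rewrite /= umulDr umulZr.
- by move=> e a b y; congr pair; rewrite /= umulDl umulZl.
- by move=> a b y; congr pair; rewrite /= umulA.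
- by move=> a x y; congr +%R; exact: gns_left.
- move=> e x y; congr pair; rewrite /= ?scaler0 ?addr0//.
  by expand; module.
- move=> x; rewrite !nsq_pair nsq0 add0r /=; apply: le_trans (left_le _ _) _.
  set N := nsq (gns f); have N0 y : 0 <= N y := nsq_ge0 _ y.
  apply: (@le_trans _ _ ((r ^+ 2 + d ^+ 2) * (N x.1 + N x.2))); last first.
    by rewrite ler_piMl ?addr_ge0.
  have := N0 (r%:C *: x.1 + (- d)%:C *: x.2).
  rewrite /N !nsqD !nsqZ !rnorm_real !real_normK ?num_real// !formZr !formZl !conj_real.
  set w := gns f x.1 x.2.
  have Re2 (u v : R) : complex.Re (u%:C * (v%:C * w)) = u * v * complex.Re w.
    by case: w => a b /=; ring.
  rewrite !Re2; lra.
- move=> a x; congr pair; rewrite /= ?umul0r//.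
  by rewrite umulA c_cov; expand; rewrite -?umulA.
Defined.

Lemma schwarz_iter (r d : R) (rd : r ^+ 2 + d ^+ 2 <= 1) f k (x : A) :
  iter k (pc_V (schwarz_precov rd f)) (x, 0) =
  if k is j.+1 then (0, (d * r ^+ j)%:C *: (upow c j.+1 ** x)) else (x, 0).
Proof.
elim: k => // k IH; rewrite iterS IH; case: k {IH} => [|k] /=.
  by rewrite expr0 mulr1 umul1r scaler0 addr0 umulZr.
rewrite scaler0 add0r scalerA -rmorphM umulZr !umulA; congr (_, _%:C *: _).
by rewrite exprS; ring.
Qed.

(** At the vector [(1, 0)] the constant term stays in the first summand, while the term of degree
    [k + 1] lands in the second with weight [d r^k c^(k+1)]. *)
Lemma schwarz_le (r d : R) p n f : r ^+ 2 + d ^+ 2 <= 1 ->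
  (forall k, (n < k)%N -> p k = 0) ->
  nsq (gns f) (p 0%N) + d ^+ 2 *
    nsq (gns f) (\sum_(k < n) (r ^+ k)%:C *: (upow c k.+1 ** p k.+1)) <=
  semicrossed_norm p ^+ 2.
Proof.
move=> rd pn; have := peval_le (schwarz_precov rd f) (uone, 0) pn.
have opE k : pc_op (schwarz_precov rd f) (p k) (uone, 0) = (p k, 0).
  by rewrite /= umul1r umul0r.
rewrite /peval; under eq_bigr do rewrite opE schwarz_iter.
have sum0 (F : 'I_n -> A) : \sum_(i < n) ((0, F i) : A * A) = (0, \sum_(i < n) F i).
  elim/big_rec2: _ => // i y z _ ->.
  by congr pair; rewrite /= addr0.
rewrite big_ord_recl /= sum0 !nsq_pair /= addr0 add0r nsq0 addr0.
have -> : \sum_(k < n) (d * r ^+ k)%:C *: (upow c k.+1 ** p k.+1) =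
    d%:C *: \sum_(k < n) (r ^+ k)%:C *: (upow c k.+1 ** p k.+1).
  by rewrite scaler_sumr; apply: eq_bigr => k _; rewrite scalerA -rmorphM.
rewrite nsqZ rnorm_real real_normK ?num_real// => h; apply: le_trans h _.
by rewrite ler_piMr ?sqr_ge0//; exact: nsq_gns1.
Qed.

End LeftMultiplication.

Section Orbit.
Variables (f : state A) (n : nat).

Definition shift (x : nat -> A) : nat -> A := fun i => if i is j.+1 then x j else 0.

(** The shift representation along the orbit of the GNS representation, cut off after [n] places;
    polynomials of degree below [n], applied at place 0, do not notice the cut. *)
Definition orbit_precov : precov alpha (sum_inner (gns f) n).
apply: (@Precov _ _ alpha _ (sum_inner (gns f) n)
  (fun a x => (fun i => iter i alpha a ** x i)) shift).
- by move=> a c x y; apply/funext => i; rewrite umulDr umulZr.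
- move=> c a b x; apply/funext => i.
  by rewrite iter_starhomD iter_starhomZ umulDl umulZl.
- by move=> a b x; apply/funext => i; rewrite iter_starhomM umulA.
- by move=> a x y; apply: eq_bigr => i _; rewrite iter_star; exact: gns_left.
- move=> c x y; apply/funext => -[|i] //.
  by rewrite -[RHS]/(_ *: 0 + 0) scaler0 addr0.
- move=> x; rewrite !nsq_sum; case: n => [|m]; first by rewrite !big_ord0.
  rewrite big_ord_recl nsq0 add0r big_ord_recr /= lerDl; exact: nsq_ge0.
- by move=> a x; apply/funext => -[|i]; rewrite /= ?umul0r// -iterS iterSr.
Defined.

Lemma iter_shift k x : iter k shift x = fun i => if (k <= i)%N then x (i - k)%N else 0.
Proof.
elim: k => [|k IH]; first by apply/funext => i; rewrite subn0.
rewrite iterS IH; apply/funext => -[|i] //.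
Qed.

(** On a vector supported at place 0 the term of degree [k] lands at place [k], so the coefficients
    contribute orthogonally. *)
Lemma orbit_le p (z : A) : (forall k, (n <= k)%N -> p k = 0) ->
  \sum_(k < n) nsq (gns f) (p k ** z) <= semicrossed_norm p ^+ 2 * nsq (gns f) z.
Proof.
move=> pn; pose delta i : A := if i == 0%N then z else 0.
have := peval_le orbit_precov delta pn.
have -> : nsq (sum_inner (gns f) n) (peval orbit_precov p n delta) =
    \sum_(k < n) nsq (gns f) (p k ** z).
  rewrite nsq_sum; apply: eq_bigr => i _; congr nsq.
  rewrite /peval /= fct_sumE; under eq_bigr do rewrite iter_shift.
  rewrite (bigD1 i)//= leqnn subnn /= big1 ?addr0// => k /eqP ki.
  case: ifPn => // lek; rewrite /delta subn_eq0 ifN ?umul0r//.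
  by apply/negP => leik; apply/ki/val_inj/eqP; rewrite eqn_leq lek.
move=> h; apply: le_trans h _; rewrite ler_wpM2l ?sqr_ge0// nsq_sum.
case: (n) => [|m]; first by rewrite big_ord0 nsq_ge0.
by rewrite big_ord_recl /= big1 ?addr0// => i _; rewrite nsq0.
Qed.

End Orbit.

Lemma coef_le p k : rnorm (p k) <= semicrossed_norm p.
Proof.
apply: rnorm_le_gns => [|f]; first exact: semicrossed_norm_ge0.
have [n pn] := coef_fin p; have [kn|/pn ->] := ltnP k n; last first.
  by rewrite nsq0 sqr_ge0.
have := orbit_le f uone pn; rewrite (bigD1 (Ordinal kn))//= umul1r => h.
apply: (@le_trans _ _ (semicrossed_norm p ^+ 2 * nsq (gns f) uone)); last first.
  by rewrite ler_piMr ?sqr_ge0//; exact: nsq_gns1.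
apply: le_trans h; rewrite lerDl sumr_ge0// => i _; exact: nsq_ge0.
Qed.

Section OnHilbert.
Variables (H : hilbertType R) (rho : covariant_rep alpha H).
Local Notation V := (cov_op rho).
Local Notation pi := (cov_rep rho).

Lemma rnorm_cov x : rnorm (V x) <= rnorm x.
Proof. by rewrite rnorm_le cov_contraction. Qed.

Definition scaled_precov (r : R) (r1 : `|r| <= 1) : precov alpha (hilbert_inner H).
apply: (@Precov _ _ alpha _ (hilbert_inner H) (fun a => pi a) (fun x => r%:C *: V x)).
- by move=> a c x y; rewrite linearP.
- by move=> c a b x; rewrite rep_linear.
- by move=> a b x; rewrite repM.
- by move=> a x y; exact: rep_star.
- by move=> c x y; rewrite linearP scalerDr !scalerA mulrC.
- move=> x; rewrite !nsq_hilbert rnormZr lerXn2r ?nnegrE ?mulr_ge0 ?rnorm_ge0//.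
  by apply: le_trans (ler_piMl _ r1) (rnorm_cov _); exact: rnorm_ge0.
- by move=> a x; rewrite linearZ /= covariance.
Defined.

Lemma iter_scaled (r : R) k x : iter k (fun x => r%:C *: V x) x = (r ^+ k)%:C *: iter k V x.
Proof.
elim: k => [|k IH]; first by rewrite expr0 scale1r.
by rewrite /= IH linearZ /= scalerA -rmorphM exprS.
Qed.

(* [x |-> (V x, (1 - V^* V)^(1/2) x)] is isometric; the second summand carries *)
(* the form of the defect operator.                                           *)
Definition dilation_precov :
  precov alpha (pair_inner (hilbert_inner H) (defect_inner (@cov_contraction _ _ _ _ rho))).
apply: (@Precov _ _ alpha _
  (pair_inner (hilbert_inner H) (defect_inner (@cov_contraction _ _ _ _ rho)))
  (fun a x => (pi a x.1, pi (alpha a) x.2)) (fun x => (V x.1, x.1))).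
- by move=> a c x y; congr pair; rewrite linearP.
- by move=> c a b x; congr pair; rewrite ?linearP rep_linear.
- by move=> a b x; congr pair; rewrite ?starhomM repM.
- move=> a x y /=; congr +%R; first exact: rep_star.
  rewrite /defect_form; congr (_ - _); first by rewrite rep_star starhom_star.
  by rewrite -!covariance rep_star.
- by move=> c x y; congr pair; rewrite /= linearP.
- move=> x; rewrite !nsq_pair /= nsq_defect !nsq_hilbert addrC subrK.
  by rewrite lerDl nsq_ge0.
- by move=> a x; congr pair; rewrite /= covariance.
Defined.

End OnHilbert.

Fact tgauge_fin (r : R) p : exists n, forall k, (n <= k)%N -> (r ^+ k)%:C *: p k = 0.
Proof. by have [n hn] := coef_fin p; exists n => k /hn ->; rewrite scaler0. Qed.
Definition tgauge r p := TwistedPoly alpha (tgauge_fin r p).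

(** Evaluating [tgauge r p] with contraction [V] is evaluating [p] with contraction [r V]. *)
Lemma tgauge_le (r : R) p : `|r| <= 1 ->
  semicrossed_norm (tgauge r p) <= semicrossed_norm p.
Proof.
move=> r1; apply: semicrossed_norm_le => [|H rho x]; first exact: semicrossed_norm_ge0.
have [n pn] := coef_fin p; have := peval_le (scaled_precov rho r1) x pn.
rewrite (@cov_evalE _ _ _ _ _ _ n) => [|k /pn]; last by rewrite /= => ->; rewrite scaler0.
rewrite /peval /= !nsq_hilbert -exprMn.
rewrite ler_pXn2r ?nnegrE ?mulr_ge0 ?rnorm_ge0 ?semicrossed_norm_ge0//.
congr (rnorm _ <= _); apply: eq_bigr => k _.
by rewrite iter_scaled repZ iter_covZ.
Qed.

Fact tshift_fin p : exists n, forall k, (n <= k)%N -> (if k is j.+1 then p j else 0) = 0.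
Proof. by have [n hn] := coef_fin p; exists n.+1 => -[|k]//; exact: hn. Qed.
Definition tshift p := TwistedPoly alpha (tshift_fin p).

(** The operator of [dilation_precov] preserves the norm of the first component, and that component
    of the value of [p] is its value in [rho]; applying one more power loses nothing. *)
Lemma tshift_ge p : semicrossed_norm p <= semicrossed_norm (tshift p).
Proof.
apply: semicrossed_norm_le => [|H rho x]; first exact: semicrossed_norm_ge0.
have [n pn] := coef_fin p.
have pn1 k : (n.+1 <= k)%N -> tshift p k = 0 by case: k => // k; exact: pn.
have := peval_le (dilation_precov rho) (x, 0) pn1.
set W := pc_V (dilation_precov rho).
have WD : {morph W : u v / u + v} := pcVD (dilation_precov rho).
have W0 : W 0 = 0 := pcV0 (dilation_precov rho).
have -> : peval (dilation_precov rho) (tshift p) n.+1 (x, 0) =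
    W (peval (dilation_precov rho) p n (x, 0)).
  rewrite /peval big_ord_recl pc0l add0r (big_morph W WD W0).
  by apply: eq_bigr => k _; rewrite -iterS.
set y := peval _ _ _ _.
have y1 : y.1 = cov_eval rho p x.
  rewrite (cov_evalE _ _ pn) /y /peval.
  rewrite (big_morph (fun u : H * H => u.1) (fun u v => erefl) erefl).
  apply: eq_bigr => k _; rewrite /=; set z := (_, _).
  by rewrite -[cov_rep rho (p k) x]/z.1; elim: (k : nat) => //= j ->.
rewrite nsq_pair /W /= nsq_defect nsq_hilbert addrC subrK y1.
rewrite nsq_pair nsq0 addr0 nsq_hilbert -exprMn.
by rewrite ler_pXn2r ?nnegrE ?mulr_ge0 ?rnorm_ge0 ?semicrossed_norm_ge0.
Qed.

End PolynomialNorms.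

(** * Fourier coefficients in the semicrossed product *)

Section CompletionDensity.
Variables (R : realType) (P : seminormedAlgType R).
Local Notation incl := (@completion_incl R P).

Lemma inclD p q : incl (p + q) = incl p + incl q.
Proof. by rewrite /completion_incl cclassD; exact: eq_cclass. Qed.
Lemma inclZ (c : R[i]) p : incl (c *: p) = c *: incl p.
Proof. by rewrite /completion_incl cclassZ; exact: eq_cclass. Qed.
Lemma inclM p q : incl (p ** q) = incl p ** incl q.
Proof. by rewrite /completion_incl cclassM; exact: eq_cclass. Qed.
Lemma incl1 : incl uone = uone. Proof. by []. Qed.

Lemma incl_dense (x : completion P) (e : R) : 0 < e -> exists p, rnorm (x - incl p) < e.
Proof.
by move=> /(completion_dense x)[p]; rewrite -rnormE ltcR; exists p.
Qed.

End CompletionDensity.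

Section StarHom.
Variables (R : realType) (A B : cstarAlgType R) (gamma : starHom A B).

(** A self-adjoint root of [|a|^2 - star a ** a + e] is mapped to a root of the same expression in
    [gamma a], which is therefore positive. *)
Lemma rnorm_starhom a : rnorm (gamma a) <= rnorm a.
Proof.
rewrite -(ler_pXn2r (n := 2)) ?nnegrE ?rnorm_ge0// -rnorm_cstar.
set t := rnorm a ^+ 2; apply: (@ler_small _ _ _ 1) => // e e0; rewrite mul1r.
have tp : pos (t%:C *: uone - star a ** a).
  by apply: pos_scalarB; [exact: (pos_star_mul a).1|rewrite rnorm_cstar].
have [b [[bs _] bb _]] := pos_root tp e0.
apply: pos_rnorm_le; [by rewrite addr_ge0 ?sqr_ge0// ltW|exact: pos_star_mul|].
have -> : (t + e)%:C *: uone - star (gamma a) ** gamma a = gamma b ** gamma b.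
  rewrite -starhomM bb !linearD linearN !linearZ /= starhom1 starhomM starhom_star.
  module.
by apply: pos_sq; rewrite -starhom_star bs.
Qed.

End StarHom.

(* The properties that characterize the completion of the twisted polynomials. *)
(* Working with an abstract model keeps terms of the quotient type from being  *)
(* unfolded during unification.                                               *)
Record semicrossed_model (R : realType) (A : cstarAlgType R) (alpha : starHom A A)
    (Y : banachAlgType R) := SemicrossedModel {
  sincl : twisted_poly alpha -> Y;
  sincl_linear : forall (c : R[i]) p q, sincl (c *: p + q) = c *: sincl p + sincl q;
  sinclM : forall p q, sincl (p ** q) = sincl p ** sincl q;
  sincl1 : sincl uone = uone;
  rnorm_sincl : forall p, rnorm (sincl p) = semicrossed_norm p;
  sincl_dense : forall y (e : R), 0 < e -> exists p, rnorm (y - sincl p) < e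
}.

Section StandardModel.
Variables (R : realType) (A : cstarAlgType R) (alpha : starHom A A).
Local Notation TP := (twisted_poly alpha).

Fact standard_linear (c : R[i]) (p q : TP) :
  completion_incl (c *: p + q) = c *: completion_incl p + completion_incl q.
Proof. by rewrite inclD inclZ. Qed.

Definition standard_model : semicrossed_model alpha (semicrossed_product alpha) :=
  @SemicrossedModel R A alpha (semicrossed_product alpha) (@completion_incl R TP)
    standard_linear (@inclM R TP) (@incl1 R TP) (@rnorm_incl R TP) (@incl_dense R TP).

End StandardModel.

Section Semicrossed.
Variables (R : realType) (A : cstarAlgType R) (alpha : starHom A A).
Variables (Y : banachAlgType R) (m : semicrossed_model alpha Y).
Local Notation TP := (twisted_poly alpha).
Local Notation sincl := (sincl m).
Implicit Types (a b : A) (p q : TP) (x y : Y).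

Lemma sinclD p q : sincl (p + q) = sincl p + sincl q.
Proof. by rewrite -[p]scale1r sincl_linear !scale1r. Qed.
Lemma sincl0 : sincl 0 = 0.
Proof. by apply: (addIr (sincl 0)); rewrite -sinclD !add0r. Qed.
Lemma sinclZ (c : R[i]) p : sincl (c *: p) = c *: sincl p.
Proof. by rewrite -[c *: p]addr0 sincl_linear sincl0 addr0. Qed.
Lemma sinclN p : sincl (- p) = - sincl p.
Proof. by rewrite -scaleN1r sinclZ scaleN1r. Qed.

Lemma dense_eq (W : normedZmodType R[i]) (L L' : Y -> W) (M : R) :
  (forall x y, rnorm (L x - L y) <= M * rnorm (x - y)) ->
  (forall x y, rnorm (L' x - L' y) <= M * rnorm (x - y)) ->
  (forall p, L (sincl p) = L' (sincl p)) -> forall x, L x = L' x.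
Proof.
move=> LM LM' LL x; apply/eqP; rewrite -subr_eq0; apply/eqP.
apply: (@rnorm_small _ _ _ (2 * `|M|)) => [|e e0]; first by rewrite mulr_ge0.
have [p /ltW xp] := sincl_dense m x e0.
have b : M * rnorm (x - sincl p) <= `|M| * e.
  apply: (le_trans (ler_norm _)); rewrite normrM ler_wpM2l//.
  by rewrite ger0_norm// rnorm_ge0.
have := rnorm_tri (L (sincl p)) (L x) (L' x); rewrite {2}LL (rnormB (L' _)).
have := LM x (sincl p); have := LM' x (sincl p); lra.
Qed.

Definition tconst a : TP := TwistedPoly alpha (tpolyC_fin a).
Definition tdrop_fin p : exists n, forall k, (n <= k)%N -> p k.+1 = 0.
Proof. by have [n pn] := coef_fin p; exists n => k /leqW /pn. Qed.
Definition tdrop p : TP := TwistedPoly alpha (tdrop_fin p).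
Definition tvar : TP := tshift (tconst uone).
Definition sconst a : Y := sincl (tconst a).
Definition svar : Y := sincl tvar.

Lemma tconstP c a b : tconst (c *: a + b) = c *: tconst a + tconst b.
Proof. by apply: twisted_polyP => -[|k] //=; rewrite scaler0 addr0. Qed.

Lemma tvarM p : tvar ** p = tshift p.
Proof.
have tE j : tvar j = if j == 1%N then uone else 0 by case: j => [|[]].
apply: twisted_polyP => -[|k]; first by rewrite /= big_ord1 umul0l.
rewrite -[LHS]/(\sum_(j < k.+2) iter j alpha (tvar (k.+1 - j)%N) ** p j).
under eq_bigr do rewrite tE.
rewrite 2!big_ord_recr /= subnn subSnn /= iter_starhom0 linear0 umul0l addr0 iter_starhom1.
rewrite umul1l big1 ?add0r// => j _; rewrite ifN ?iter_starhom0 ?umul0l//.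
by rewrite subSn 1?ltnW// eqSS subn_eq0 -ltnNge.
Qed.

Lemma tconstM a p k : (tconst a ** p) k = iter k alpha a ** p k.
Proof.
rewrite /= big_ord_recr /= subnn /= big1 ?add0r// => j _.
by rewrite subn_eq0 leqNgt ltn_ord /= iter_starhom0 umul0l.
Qed.

(** Peels off the constant term; the inductions of [Psi_poly] and [iso_poly] run on it. *)
Lemma tpoly_decomp p : p = tconst (p 0%N) + tvar ** tdrop p.
Proof.
by rewrite tvarM; apply: twisted_polyP => -[|k] /=; rewrite ?addr0 ?add0r.
Qed.

Lemma tconst_tvar a : tconst a ** tvar = tvar ** tconst (alpha a).
Proof.
rewrite tvarM; apply: twisted_polyP => k; rewrite tconstM.
by case: k => [|[|k]] /=; rewrite ?umul0r ?umul1r.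
Qed.

Lemma sconst_linear : linear sconst.
Proof. by move=> c a b; rewrite /sconst tconstP sinclD sinclZ. Qed.
HB.instance Definition _ := GRing.isLinear.Build R[i] A Y *:%R sconst sconst_linear.

Lemma sconstM a b : sconst (a ** b) = sconst a ** sconst b.
Proof.
rewrite -sinclM; congr sincl; apply: twisted_polyP => k; rewrite tconstM.
by case: k => [|k] /=; rewrite ?umul0r.
Qed.

Lemma sconst1 : sconst uone = uone. Proof. exact: sincl1. Qed.

Lemma sconst_svar a : sconst a ** svar = svar ** sconst (alpha a).
Proof. by rewrite -!sinclM tconst_tvar. Qed.

Lemma rnorm_sconst a : rnorm (sconst a) = rnorm a.
Proof.
apply/eqP; rewrite rnorm_sincl eq_le; apply/andP; split; last exact: (coef_le (tconst a) 0).
apply: semicrossed_norm_le => [|H rho x]; first exact: rnorm_ge0.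
rewrite (@cov_evalE _ _ _ _ _ _ 1) => [|[]//].
by rewrite big_ord1; exact: rep_contractive.
Qed.

Lemma rnorm_svar_le1 : rnorm svar <= 1.
Proof.
rewrite rnorm_sincl; apply: semicrossed_norm_le => // H rho x.
rewrite (@cov_evalE _ _ _ _ _ _ 2) => [|[|[]]//].
rewrite big_ord_recl big_ord1 /= rep0 add0r mul1r.
apply: le_trans (_ : rnorm (cov_rep rho uone x) <= _); first exact: rnorm_cov.
exact: rep1_contractive.
Qed.

Lemma rnorm_svarM y : rnorm (svar ** y) = rnorm y.
Proof.
apply/eqP; rewrite eq_le; apply/andP; split.
  apply: le_trans (rnormM _ _) _; rewrite ler_piMl ?rnorm_ge0//; exact: rnorm_svar_le1.
apply: (@ler_small _ _ _ 2) => // e e0; have [p /ltW yp] := sincl_dense m y e0.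
have h : rnorm (sincl p) <= rnorm (svar ** sincl p).
  by rewrite -sinclM !rnorm_sincl tvarM; exact: tshift_ge.
have h2 : rnorm (svar ** (sincl p - y)) <= e.
  apply: le_trans (rnormM _ _) _; rewrite rnormB.
  by apply: le_trans (ler_piMl (rnorm_ge0 _) rnorm_svar_le1) yp.
have E : svar ** sincl p = svar ** y + svar ** (sincl p - y).
  by rewrite -umulDr [y + _]addrC subrK.
have := rnormD (svar ** y) (svar ** (sincl p - y)); rewrite -E.
have := rnormD (y - sincl p) (sincl p); rewrite subrK; lra.
Qed.

(** Coefficients of polynomials tending to [y] converge by [coef_le]. Asking the inequality for all
    [p] pins down the limit and yields linearity and contractivity. *)
Lemma fcoef_ex k y : exists a : A, forall p, rnorm (a - p k) <= rnorm (y - sincl p).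
Proof.
have near (n : nat) : exists p, rnorm (y - sincl p) < n.+1%:R^-1.
  by apply: sincl_dense; rewrite invr_gt0 ltr0Sn.
pose u n := sval (cid (near n)).
have uP n : rnorm (y - sincl (u n)) < n.+1%:R^-1 := svalP (cid (near n)).
have small (e : R) : 0 < e -> exists n, forall i, (n <= i)%N -> rnorm (y - sincl (u i)) < e.
  move=> e0; exists (Num.bound e^-1) => i ni; apply: lt_trans (uP i) _.
  rewrite invf_plt ?posrE ?ltr0Sn//; apply: lt_le_trans (archi_boundP _) _.
    by rewrite invr_ge0 ltW.
  by rewrite ler_nat ltnW.
have ucoef p q : rnorm (p k - q k) <= rnorm (y - sincl p) + rnorm (y - sincl q).
  have h : rnorm (p k - q k) <= semicrossed_norm (p - q) := coef_le (p - q) k.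
  apply: le_trans h _; rewrite -(rnorm_sincl m) sinclD sinclN.
  by rewrite (rnormB y); exact: rnorm_tri.
have [e e0|a ha] := @rnorm_cvg _ _ (fun i => u i k : A).
  have [n hn] := small (e / 2) (divr_gt0 e0 (ltr0n _ 2)).
  exists n => i j /hn ni /hn nj; apply: le_lt_trans (ucoef (u i) (u j)) _; lra.
exists a => p; apply: (@ler_small _ _ _ 2) => // e e0.
have [n hn] := ha e e0; have [n' hn'] := small e e0.
have := rnorm_tri (u (maxn n n') k) a (p k); have := ucoef (u (maxn n n')) p.
have := hn _ (leq_maxl n n'); have := hn' _ (leq_maxr n n'); lra.
Qed.

Definition fcoef k y : A := sval (cid (fcoef_ex k y)).

Lemma fcoefP k y p : rnorm (fcoef k y - p k) <= rnorm (y - sincl p).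
Proof. exact: (svalP (cid (fcoef_ex k y))). Qed.

Lemma fcoef_incl k p : fcoef k (sincl p) = p k.
Proof.
apply/eqP; rewrite -subr_eq0; apply/eqP/rnorm0_eq0/eqP.
by rewrite eq_le rnorm_ge0 andbT; have := fcoefP k (sincl p) p; rewrite subrr rnorm0.
Qed.

Lemma fcoef_linear k : linear (fcoef k).
Proof.
move=> c x y; apply/eqP; rewrite -subr_eq0; apply/eqP.
apply: (@rnorm_small _ _ _ (2 * (rnorm c + 1))) => [|e e0].
  by rewrite mulr_ge0// addr_ge0// rnorm_ge0.
have [p /ltW xp] := sincl_dense m x e0; have [q /ltW yq] := sincl_dense m y e0.
have h1 : rnorm (fcoef k (c *: x + y) - (c *: p k + q k)) <= _ :=
  fcoefP k (c *: x + y) (c *: p + q).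
have h2 := fcoefP k x p; have h3 := fcoefP k y q.
have E1 : c *: x + y - sincl (c *: p + q) = c *: (x - sincl p) + (y - sincl q).
  by rewrite sinclD sinclZ; module.
have E2 : fcoef k (c *: x + y) - (c *: fcoef k x + fcoef k y) =
    (fcoef k (c *: x + y) - (c *: p k + q k)) -
    (c *: (fcoef k x - p k) + (fcoef k y - q k)).
  by module.
rewrite E1 in h1; rewrite E2.
have := rnormD (c *: (x - sincl p)) (y - sincl q).
have := rnormD (c *: (fcoef k x - p k)) (fcoef k y - q k).
have := rnormD (fcoef k (c *: x + y) - (c *: p k + q k))
  (- (c *: (fcoef k x - p k) + (fcoef k y - q k))).
rewrite rnormN !rnormZ; have c0 := rnorm_ge0 c.
have := ler_wpM2l c0 xp; have := ler_wpM2l c0 (le_trans h2 xp); lra.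
Qed.
HB.instance Definition _ k :=
  GRing.isLinear.Build R[i] Y A *:%R (fcoef k) (fcoef_linear k).

Lemma rnorm_fcoef k y : rnorm (fcoef k y) <= rnorm y.
Proof. by have := fcoefP k y 0; rewrite /= subr0 sincl0 subr0. Qed.

Lemma fcoef_sconst a : fcoef 0 (sconst a) = a.
Proof. exact: fcoef_incl. Qed.

Lemma lipschitz_linear (L : Y -> A) (M : R) : linear L ->
  (forall x, rnorm (L x) <= M * rnorm x) ->
  forall x y, rnorm (L x - L y) <= M * rnorm (x - y).
Proof.
move=> Ll LM x y; have -> : L x - L y = L (x - y).
  by rewrite -[in RHS](scaleN1r y) [in RHS]addrC Ll scaleN1r addrC.
exact: LM.
Qed.

(** Both sides are linear and Lipschitz in each variable and agree on polynomials; the constant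
    [k + 1] counts the summands. *)
Lemma fcoefM k x y : fcoef k (x ** y) =
  \sum_(j < k.+1) iter j alpha (fcoef (k - j) x) ** fcoef j y.
Proof.
have iter_le j a : rnorm (iter j alpha a) <= rnorm a.
  by elim: j => //= j; apply: le_trans; exact: rnorm_starhom.
have term_le x' y' (j : 'I_k.+1) : rnorm (iter j alpha (fcoef (k - j) x') ** fcoef j y')
    <= rnorm x' * rnorm y'.
  apply: le_trans (rnormM _ _) _; apply: ler_pM; rewrite ?rnorm_ge0//.
    by apply: le_trans (iter_le _ _) _; exact: rnorm_fcoef.
  exact: rnorm_fcoef.
have sum_le x' y' : rnorm (\sum_(j < k.+1) iter j alpha (fcoef (k - j) x') ** fcoef j y')
    <= k.+1%:R * rnorm x' * rnorm y'.
  rewrite -mulrA -[k.+1 in X in _ <= X]card_ord mulr_natl -sumr_const.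
  elim/big_rec2: _ => [|j u v _ h]; first by rewrite rnorm0.
  by apply: le_trans (rnormD _ _) (lerD _ h).
have prod_le x' y' : rnorm (fcoef k (x' ** y')) <= k.+1%:R * rnorm x' * rnorm y'.
  apply: le_trans (rnorm_fcoef _ _) _; apply: le_trans (rnormM _ _) _.
  by rewrite -mulrA ler_peMl ?mulr_ge0 ?rnorm_ge0// ler1n.
move: x; apply: (dense_eq (M := k.+1%:R * rnorm y)).
- apply: lipschitz_linear => [c x x'|x]; first by rewrite umulDl umulZl linearP.
  by rewrite mulrAC.
- apply: lipschitz_linear => [c x x'|x]; last by rewrite mulrAC.
  rewrite scaler_sumr -big_split; apply: eq_bigr => j _ /=.
  by rewrite linearP iter_starhomD iter_starhomZ umulDl umulZl.
move=> p; move: y; apply: (dense_eq (M := k.+1%:R * rnorm (sincl p))).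
- by apply: lipschitz_linear => [c y y'|y]; rewrite ?umulDr ?umulZr ?linearP.
- apply: lipschitz_linear => [c y y'|y] //.
  rewrite scaler_sumr -big_split; apply: eq_bigr => j _ /=.
  by rewrite linearP umulDr umulZr.
move=> q; rewrite -sinclM fcoef_incl /=; apply: eq_bigr => j _.
by rewrite !fcoef_incl.
Qed.

Lemma fcoef0M x y : fcoef 0 (x ** y) = fcoef 0 x ** fcoef 0 y.
Proof. by rewrite fcoefM big_ord1. Qed.

Lemma fcoef1M x y :
  fcoef 1 (x ** y) = fcoef 1 x ** fcoef 0 y + alpha (fcoef 0 x) ** fcoef 1 y.
Proof. by rewrite fcoefM big_ord_recr big_ord1. Qed.

Lemma fcoef_svar k : fcoef k svar = if k == 1%N then uone else 0.
Proof. by rewrite fcoef_incl; case: k => [|[]]. Qed.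

Lemma hnorm_gns_le (f : state A) a : hnorm (gns f) a <= rnorm a.
Proof.
rewrite hnorm_le ?rnorm_ge0// -[a]umul1r.
apply: le_trans (nsq_gnsM _ _ _) _; rewrite umul1r ler_piMr ?sqr_ge0//.
exact: nsq_gns1.
Qed.

(** Keeps places 0 and [k] of [orbit_le] and passes to the limit. *)
Lemma fcoef_pair_le (f : state A) k y : (0 < k)%N ->
  nsq (gns f) (fcoef 0 y) + nsq (gns f) (fcoef k y) <= rnorm y ^+ 2 * nsq (gns f) uone.
Proof.
move=> k0; pose s := pair_inner (gns f) (gns f).
rewrite -(nsq_pair _ _ (fcoef 0 y, fcoef k y)) -[nsq (gns f) uone]sqr_hnorm -exprMn.
rewrite -hnorm_le ?mulr_ge0 ?rnorm_ge0 ?hnorm_ge0//.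
set h1 := hnorm _ uone; have h1le : h1 <= 1.
  by apply: le_trans (hnorm_gns_le _ _) (rnorm1_le1 _).
have h10 : 0 <= h1 := hnorm_ge0 _ _.
(* Two of the three errors come from the coefficients, the third from [|p| <= |y| + e]. *)
apply: (@ler_small _ _ _ 3) => // e e0.
have [p /ltW yp] := sincl_dense m y e0.
have -> : (fcoef 0 y, fcoef k y) =
    (p 0%N, p k) + (fcoef 0 y - p 0%N, fcoef k y - p k) :> A * A.
  by congr pair; rewrite /= addrC subrK.
apply: le_trans (hnormD _ _ _) _.
have d : hnorm s (fcoef 0 y - p 0%N, fcoef k y - p k) <= 2 * e.
  rewrite hnorm_le ?mulr_ge0 ?(ltW e0)// nsq_pair /= -!sqr_hnorm.
  have := le_trans (hnorm_gns_le f _) (le_trans (fcoefP 0 y p) yp).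
  have := le_trans (hnorm_gns_le f _) (le_trans (fcoefP k y p) yp).
  have := hnorm_ge0 (gns f) (fcoef 0 y - p 0%N).
  have := hnorm_ge0 (gns f) (fcoef k y - p k); nra.
have : hnorm s (p 0%N, p k) <= rnorm (sincl p) * h1.
  rewrite rnorm_sincl hnorm_le ?mulr_ge0 ?seminorm_ge0// nsq_pair /= exprMn sqr_hnorm.
  have [n pn] := coef_fin p; pose N := maxn n k.+1.
  have pN j : (N <= j)%N -> p j = 0 by rewrite geq_max => /andP[/pn].
  have kN : (k < N)%N by rewrite leq_maxr.
  have := orbit_le f uone pN.
  rewrite (bigD1 (Ordinal (leq_ltn_trans (leq0n k) kN)))//=.
  rewrite (bigD1 (Ordinal kN)) /=; last by rewrite -val_eqE /= -lt0n.
  rewrite !umul1r addrA => h; apply: le_trans h; rewrite lerDl sumr_ge0// => i _.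
  exact: nsq_ge0.
have := rnormD (sincl p - y) y; rewrite subrK (rnormB (sincl p)); nra.
Qed.

Lemma normD5_le (u1 u2 u3 u4 u5 : Y) (e1 e2 e3 e4 e5 : R) :
  rnorm u1 <= e1 -> rnorm u2 <= e2 -> rnorm u3 <= e3 -> rnorm u4 <= e4 ->
  rnorm u5 <= e5 ->
  rnorm (u1 + (u2 + (u3 + (u4 + u5)))) <= e1 + (e2 + (e3 + (e4 + e5))).
Proof.
by move=> h1 h2 h3 h4 h5; do 4![apply: le_trans (rnormD _ _) (lerD _ _) => //].
Qed.

Lemma semicrossed_norm_le_sum p n : (forall k, (n <= k)%N -> p k = 0) ->
  semicrossed_norm p <= \sum_(k < n) rnorm (p k).
Proof.
move=> pn; apply: semicrossed_norm_le => [|H rho x]; last exact: cov_eval_le.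
by apply: sumr_ge0 => k _; exact: rnorm_ge0.
Qed.

(** Bernoulli's inequality gives [1 - r^k <= k d] for [r = 1 - d], and [d] is small against the
    degree bound times the sum of the coefficient norms. *)
Lemma tgauge_near p (e : R) : 0 < e ->
  exists2 r : R, 0 <= r < 1 & semicrossed_norm (tgauge r p - p) <= e.
Proof.
move=> e0; have [n pn] := coef_fin p; pose S := \sum_(k < n) rnorm (p k).
have S0 : 0 <= S by apply: sumr_ge0 => k _; exact: rnorm_ge0.
have nS : 0 < n%:R * S + 1 by rewrite ltr_wpDl// mulr_ge0.
pose d := Num.min 1 (e / (n%:R * S + 1)).
have d0 : 0 < d by rewrite lt_min ltr01 divr_gt0.
have d1 : d <= 1 by rewrite ge_min lexx.
have de : d * (n%:R * S + 1) <= e by rewrite -ler_pdivlMr// ge_min lexx orbT.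
exists (1 - d); first by rewrite subr_ge0 d1 gtrBl.
have bern k : 1 - k%:R * d <= (1 - d) ^+ k.
  elim: k => [|k IH]; first by rewrite mul0r subr0 expr0.
  have d1' : 0 <= 1 - d by rewrite subr_ge0.
  rewrite exprS -natr1; apply: le_trans (ler_wpM2l d1' IH).
  have -> : (1 - d) * (1 - k%:R * d) = 1 - (k%:R + 1) * d + k%:R * d ^+ 2 by ring.
  by rewrite lerDl mulr_ge0// sqr_ge0.
apply: (le_trans (@semicrossed_norm_le_sum _ n _)) => [k kn|].
  by rewrite /= pn// scaler0 subrr.
apply: (le_trans _ (_ : d * (n%:R * S) <= e)); last first.
  by apply: le_trans de; rewrite ler_pM2l// lerDl.
rewrite mulrA mulr_sumr; apply: ler_sum => k _.
have -> : (tgauge (1 - d) p - p : TP)%R k = ((1 - d) ^+ k - 1)%:C *: p k.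
  by rewrite /=; module.
rewrite rnormZr ler_wpM2r ?rnorm_ge0// distrC ger0_norm; last first.
  by rewrite subr_ge0 exprn_ile1// ?subr_ge0// gerBl ltW.
rewrite lerBlDr -lerBlDl; apply: le_trans (bern k); rewrite lerB// mulrC.
by rewrite ler_pM2l// ler_nat ltnW.
Qed.

Lemma tgaugeB r p q : tgauge r (p - q) = tgauge r p - tgauge r q :> TP.
Proof. by apply: twisted_polyP => k /=; rewrite scalerBr. Qed.

(** Abel summation: damping the approximating polynomials makes their small higher coefficients
    summable, so only the constant survives. *)
Lemma fcoef_const y : (forall k, (0 < k)%N -> fcoef k y = 0) -> y = sconst (fcoef 0 y).
Proof.
move=> yk; apply/eqP; rewrite -subr_eq0; apply/eqP.
apply: (@rnorm_small _ _ _ 6) => // e e0.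
have [p /ltW yp] := sincl_dense m y e0.
have [r /andP[r0 r1] rp] := tgauge_near p e0.
have r1p : 0 < 1 - r by rewrite subr_gt0.
(* [q] is chosen after [r]: its higher coefficients are at most [e (1 - r)], and the geometric
   series in [r] bounds its damped tail by [e]. *)
have d0 : 0 < Num.min e (e * (1 - r)) by rewrite lt_min e0 mulr_gt0.
have [q] := sincl_dense m y d0; rewrite lt_min => /andP[/ltW yq yq'].
have r1n : `|r| <= 1 by rewrite ger0_norm// ltW.
have tail : semicrossed_norm (tgauge r q - tconst (q 0%N)) <= e.
  have [n qn] := coef_fin q.
  apply: (le_trans (@semicrossed_norm_le_sum _ n.+1 _)) => [[|k] kn //|].
    by rewrite /= subr0 qn ?scaler0// ltnW.
  rewrite big_ord_recl [X in rnorm X](_ : _ = 0) ?rnorm0 ?add0r; last first.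
    by rewrite /= expr0 scale1r subrr.
  have geo j : (\sum_(k < j) r ^+ k.+1) * (1 - r) = r - r ^+ j.+1.
    elim: j => [|j IH]; first by rewrite big_ord0 mul0r expr1 subrr.
    by rewrite big_ord_recr mulrDl IH /= [r ^+ j.+2]exprS; ring.
  apply: le_trans (_ : \sum_(k < n) r ^+ k.+1 * (e * (1 - r)) <= _).
    apply: ler_sum => k _; rewrite /= subr0 rnormZr ger0_norm ?exprn_ge0//.
    rewrite ler_wpM2l ?exprn_ge0//; apply: le_trans (ltW yq').
    by have := fcoefP k.+1 y q; rewrite yk// sub0r rnormN.
  rewrite -mulr_suml mulrCA ler_piMr ?(ltW e0)// geo.
  by apply: le_trans (ltW r1); rewrite gerBl exprn_ge0.
have gpq : semicrossed_norm (tgauge r p - tgauge r q) <= e + e.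
  rewrite -tgaugeB; apply: le_trans (tgauge_le _ r1n) _.
  rewrite -(rnorm_sincl m) sinclD sinclN.
  have := rnorm_tri y (sincl p) (sincl q); rewrite (rnormB (sincl p) y); lra.
have h0 : rnorm (sconst (q 0%N - fcoef 0 y)) <= e.
  by rewrite rnorm_sconst rnormB; apply: le_trans (fcoefP 0 y q) yq.
have h1 : rnorm (sincl p - sincl (tgauge r p)) <= e.
  by rewrite rnormB -sinclN -sinclD rnorm_sincl.
have h2 : rnorm (sincl (tgauge r p) - sincl (tgauge r q)) <= e + e.
  by rewrite -sinclN -sinclD rnorm_sincl.
have h3 : rnorm (sincl (tgauge r q) - sconst (q 0%N)) <= e.
  by rewrite -sinclN -sinclD rnorm_sincl.
have -> : y - sconst (fcoef 0 y) = (y - sincl p) + ((sincl p - sincl (tgauge r p)) +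
    ((sincl (tgauge r p) - sincl (tgauge r q)) +
    ((sincl (tgauge r q) - sconst (q 0%N)) + sconst (q 0%N - fcoef 0 y)))).
  by rewrite linearB /=; module.
apply: (le_trans (normD5_le yp h1 h2 h3 h0)); lra.
Qed.

(** Dropping degrees 0 and 1 of an approximating polynomial costs at most twice the approximation
    error, because [y] has no such coefficients. *)
Lemma fcoef01_eq0 y (e : R) : fcoef 0 y = 0 -> fcoef 1 y = 0 -> 0 < e ->
  exists q : Y, rnorm (y - svar ** (svar ** q)) < e.
Proof.
move=> y0 y1 e0; have e3 : 0 < e / 3 by rewrite divr_gt0.
have [p yp] := sincl_dense m y e3.
exists (sincl (tdrop (tdrop p))).
have pE : sincl p = sconst (p 0%N) + svar ** (sconst (p 1%N) +
    svar ** sincl (tdrop (tdrop p))).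
  rewrite {1}(tpoly_decomp p) {1}(tpoly_decomp (tdrop p)).
  by rewrite !(sinclD, sinclM).
have E : y - svar ** (svar ** sincl (tdrop (tdrop p))) =
    (y - sincl p) + (sconst (p 0%N) + svar ** sconst (p 1%N)).
  by rewrite pE umulDr; module.
have := fcoefP 0 y p; have := fcoefP 1 y p; rewrite y0 y1 !sub0r !rnormN.
rewrite E; have := rnormD (y - sincl p) (sconst (p 0%N) + svar ** sconst (p 1%N)).
have := rnormD (sconst (p 0%N)) (svar ** sconst (p 1%N)).
rewrite rnorm_svarM !rnorm_sconst; lra.
Qed.

End Semicrossed.

(** * Unitaries: linear span, contractive inverses, polar decomposition *)

Section Unitaries.
Variables (R : realType) (A : cstarAlgType R).
Implicit Types a b d h t u x y : A.

Lemma unitary_rnorm_le1 u : unitary u -> rnorm u <= 1.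
Proof.
move=> [uu _]; have : rnorm u ^+ 2 <= 1 by rewrite -rnorm_cstar uu rnorm1_le1.
by rewrite expr_le1// rnorm_ge0.
Qed.

Lemma unitary_star u : unitary u -> unitary (star u).
Proof. by move=> [h1 h2]; split; rewrite starK. Qed.

(** A self-adjoint [h] with [|h| < 1] is the real part of the unitary [h + i sqrt(1 - h^2)]; linear
    combinations reach everything else. *)
Lemma unitary_span (P : A -> Prop) :
  (forall c x y, P x -> P y -> P (c *: x + y)) -> P 0 ->
  (forall u, unitary u -> P u) -> forall a, P a.
Proof.
move=> Plin P0 Pu; have PZ c x : P x -> P (c *: x).
  by move=> Px; rewrite -[c *: x]addr0; exact: Plin.
have PD x y : P x -> P y -> P (x + y) by rewrite -{2}[x]scale1r; exact: Plin.
have sa_small h : star h = h -> rnorm h < 1 -> P h.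
  move=> hs h1; have cs : star (h ** h) = h ** h by rewrite starM hs.
  have [|d [ds dd _ dh]] := sqrt1B cs.
    by rewrite rnorm_sq// exprn_ilt1// rnorm_ge0.
  have {}dh : h ** d = d ** h by apply: dh; rewrite umulA.
  pose u := h + 'i%C *: d.
  have us : star u = h - 'i%C *: d by rewrite starD starZ conj_i hs ds scaleNr.
  have unitu : unitary u.
    split; rewrite us /u; expand; rewrite dh !scalerA -expr2 sqr_i dd; module.
  have -> : h = (2^-1 : R[i]) *: (u + star u).
    apply: (@scalerI _ _ (2 : R[i])); first by rewrite pnatr_eq0.
    by rewrite scalerA divff ?pnatr_eq0// us /u; module.
  by apply/PZ/PD; apply: Pu => //; exact: unitary_star.
have sa h : star h = h -> P h.
  move=> hs; pose t := rnorm h + 1.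
  have t0 : 0 < t by rewrite ltr_wpDl// rnorm_ge0.
  have -> : h = t%:C *: ((t^-1)%:C *: h).
    by rewrite scalerA -rmorphM divff ?gt_eqF// scale1r.
  apply/PZ/sa_small; first by rewrite starZr hs.
  rewrite rnormZr ger0_norm ?invr_ge0 ?(ltW t0)// mulrC ltr_pdivrMr// mul1r.
  by rewrite ltrDl.
move=> a; have -> : a = (2^-1 : R[i]) *: ((a + star a) - 'i%C *: ('i%C *: (a - star a))).
  apply: (@scalerI _ _ (2 : R[i])); first by rewrite pnatr_eq0.
  by rewrite !scalerA divff ?pnatr_eq0// -expr2 sqr_i; module.
apply/PZ/PD; first by apply/sa; rewrite starD starK addrC.
rewrite -scalerN; apply/PZ/sa.
by rewrite starN starZ starB starK conj_i; module.
Qed.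

(** In each GNS space [N 1 <= N u], as [w] is a contraction, and [N (star u ** u) <= N u];
    expanding, [N (1 - star u ** u) <= N u - 2 N u + N u = 0]. *)
Lemma star_eq_inverse u w : u ** w = uone -> w ** u = uone ->
  rnorm u <= 1 -> rnorm w <= 1 -> w = star u.
Proof.
move=> uw wu u1 w1; pose x := uone - star u ** u.
have x0 : x = 0.
  apply: rnorm0_eq0; apply/eqP; rewrite eq_le rnorm_ge0 andbT.
  apply: rnorm_le_gns => // f; rewrite expr0n /=; set N := nsq (gns f).
  have le1 y z : rnorm y <= 1 -> N (y ** z) <= N z.
    move=> y1; apply: le_trans (nsq_gnsM f y z) _.
    by rewrite ler_piMl ?nsq_ge0// exprn_ile1// rnorm_ge0.
  have uN : N uone <= N u by rewrite -wu; exact: le1.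
  have suN : N (star u ** u) <= N u by apply: le1; rewrite rnorm_star.
  have E : complex.Re (gns f uone (star u ** u)) = N u.
    by rewrite -gns_left umul1r.
  rewrite /x /N nsqD nsqN formNr raddfN /= E -/N; lra.
have uu : star u ** u = uone by apply/eqP; rewrite eq_sym -subr_eq0 -/x x0.
by rewrite -[star u]umul1r -uw umulA uu umul1l.
Qed.

(** [u = t g] with [g] the inverse square root of [h = star t ** t]. The two relations make [x]
    commute with [h], hence with [g]. *)
Lemma polar_unitary t r : t ** r = uone -> r ** t = uone ->
  exists2 u, unitary u & forall x y,
    y ** t = t ** x -> star y ** t = t ** star x -> y ** u = u ** x.
Proof.
move=> tr rt; have [h hE] : exists h, h = star t ** t by eexists.
have [k kE] : exists k, k = r ** star r by eexists.
have hk : h ** k = uone.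
  by rewrite hE kE umulA -[star t ** t ** r]umulA tr umul1r -starM rt star1.
have kh : k ** h = uone.
  by rewrite hE kE umulA -[r ** star r ** _]umulA -starM tr star1 umul1r.
pose M := rnorm t ^+ 2 + 1; pose K := rnorm r ^+ 2 + 1.
have M0 : 0 < M by rewrite ltr_wpDl// sqr_ge0.
have K0 : 0 < K by rewrite ltr_wpDl// sqr_ge0.
have [c cE] : exists c, c = uone - (M^-1)%:C *: h by eexists.
have hs : star h = h by rewrite hE starM starK.
have cs : star c = c by rewrite cE starB star1 starZr hs.
(* [h] lies between [1 / K] and [M], so [1 - h / M] is a strict contraction; this is checked on GNS
   vectors. *)
have c1 : rnorm c < 1.
  have MK : 1 <= M * K by rewrite /M /K; have := sqr_ge0 (rnorm t); have := sqr_ge0 (rnorm r); nra.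
  have MK0 : 0 < M * K by rewrite mulr_gt0.
  have d1 : 0 <= 1 - (M * K)^-1 < 1.
    by rewrite subr_ge0 invf_le1// MK gtrBl invr_gt0.
  apply: (@le_lt_trans _ _ (Num.sqrt (1 - (M * K)^-1))); last first.
    by rewrite -[ltRHS]sqrtr1 ltr_sqrt//; case/andP: d1.
  apply: rnorm_le_gns => [|f]; first exact: sqrtr_ge0.
  rewrite sqr_sqrtr; last by case/andP: d1.
  set N := nsq (gns f).
  have N1 : N uone <= 1 := nsq_gns1 f.
  have hN : N h <= M * N t.
    rewrite hE; apply: le_trans (nsq_gnsM f _ _) _; rewrite rnorm_star.
    by rewrite ler_wpM2r ?nsq_ge0// lerDl.
  have tN : N uone <= K * N t.
    rewrite -rt; apply: le_trans (nsq_gnsM f _ _) _.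
    by rewrite ler_wpM2r ?nsq_ge0// lerDl.
  have E : complex.Re (gns f uone h) = N t by rewrite hE -gns_left umul1r.
  have -> : N c = N uone - 2 * M^-1 * N t + M^-1 ^+ 2 * N h.
    rewrite cE /N nsqD nsqN nsqZ rnorm_real real_normK ?num_real// -scalerN.
    rewrite formZr conj_real formNr -/N.
    have -> : complex.Re ((M^-1)%:C * - gns f uone h) = - (M^-1 * N t).
      by rewrite -E; case: (gns f uone h) => a b /=; ring.
    ring.
  have V0 : 0 < M^-1 by rewrite invr_gt0.
  have h1 : M^-1 ^+ 2 * N h <= M^-1 * N t.
    rewrite expr2 -mulrA ler_pM2l// mulrC ler_pdivrMr// mulrC//.
  have h2 : K^-1 * N uone <= N t by rewrite mulrC ler_pdivrMr// mulrC.
  have h3 : M^-1 * (K^-1 * N uone) <= M^-1 * N t by rewrite ler_pM2l.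
  have h4 : (1 - (M * K)^-1) * N uone <= 1 - (M * K)^-1.
    by case/andP: d1 => d1 _; rewrite ler_piMr.
  apply: le_trans h4; rewrite invfM; lra.
have [d [ds dd _ dc]] := sqrt1B cs c1.
have ddE : M%:C *: (d ** d) = h.
  by rewrite dd cE opprB addrC subrK scalerA -rmorphM divff ?gt_eqF// scale1r.
have dh x : x ** h = h ** x -> x ** d = d ** x.
  by move=> xh; apply: dc; rewrite cE; expand; rewrite xh.
have dk : d ** k = k ** d.
  have hd : h ** d = d ** h by apply: dh.
  by rewrite -[d ** k]umul1l -kh -umulA [h ** _]umulA hd -umulA hk umul1r.
pose q := Num.sqrt M; have qq : q%:C * q%:C = M%:C :> R[i].
  by rewrite -rmorphM -expr2 sqr_sqrtr ?ltW.
(* Since [h = M d^2] and [k] inverts [h], the square of [g] is [M d^2 k^2 = k]. *)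
have [g gE] : exists g, g = q%:C *: (d ** k) by eexists.
have gs : star g = g.
  by rewrite gE starZr starM ds {1}kE starM starK -kE dk.
have gg : g ** g = k.
  rewrite gE; expand; rewrite scalerA qq.
  have -> : d ** k ** d ** k = (d ** d) ** k ** k by rewrite -[d ** k ** d]umulA -dk umulA.
  by rewrite -umulZl -umulZl ddE hk umul1l.
exists (t ** g).
  split; rewrite starM gs.
    have -> : g ** star t ** (t ** g) = g ** h ** g by rewrite hE !umulA.
    have gh : g ** h = h ** g.
      by rewrite gE; expand; rewrite (dh h)// -!umulA hk kh.
    by rewrite gh -umulA gg.
  have -> : t ** g ** (g ** star t) = t ** (g ** g) ** star t by rewrite !umulA.
  by rewrite gg kE umulA tr umul1l -starM tr star1.
move=> x y yx syx.
have xh : x ** h = h ** x.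
  have -> : x ** h = star (t ** star x) ** t by rewrite starM starK hE umulA.
  by rewrite -syx starM starK -umulA yx hE umulA.
have xk : x ** k = k ** x.
  by rewrite -[x ** k]umul1l -kh -umulA [h ** _]umulA -xh -umulA hk umul1r.
have xg : x ** g = g ** x.
  by rewrite gE; expand; rewrite (dh _ xh) -umulA xk umulA.
by rewrite umulA yx -umulA xg umulA.
Qed.

End Unitaries.

(** * Isometric isomorphisms yield outer conjugacies *)

Section BanachIso.
Variables (R : realType).

Record banach_iso (X Y : banachAlgType R) := BanachIso {
  iso_fun :> X -> Y;
  iso_inv : Y -> X;
  iso_linear : forall (c : R[i]) x y, iso_fun (c *: x + y) = c *: iso_fun x + iso_fun y;
  isoM : forall x y, iso_fun (x ** y) = iso_fun x ** iso_fun y;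
  rnorm_iso : forall x, rnorm (iso_fun x) = rnorm x;
  isoK : cancel iso_fun iso_inv;
  iso_invK : cancel iso_inv iso_fun
}.

Variables (X Y : banachAlgType R) (phi : banach_iso X Y).

Fact iso_inv_linear (c : R[i]) x y :
  iso_inv phi (c *: x + y) = c *: iso_inv phi x + iso_inv phi y.
Proof. by apply: (can_inj (isoK phi)); rewrite iso_linear !iso_invK. Qed.
Fact iso_invM x y : iso_inv phi (x ** y) = iso_inv phi x ** iso_inv phi y.
Proof. by apply: (can_inj (isoK phi)); rewrite isoM !iso_invK. Qed.
Fact rnorm_iso_inv x : rnorm (iso_inv phi x) = rnorm x.
Proof. by rewrite -(rnorm_iso phi) iso_invK. Qed.

Definition iso_sym : banach_iso Y X :=
  BanachIso iso_inv_linear iso_invM rnorm_iso_inv (iso_invK phi) (isoK phi).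

Lemma isoD x y : phi (x + y) = phi x + phi y.
Proof. by rewrite -[x]scale1r iso_linear !scale1r. Qed.
Lemma iso0 : phi 0 = 0.
Proof. by apply: (addIr (phi 0)); rewrite -isoD !add0r. Qed.
Lemma isoZ (c : R[i]) x : phi (c *: x) = c *: phi x.
Proof. by rewrite -[c *: x]addr0 iso_linear iso0 addr0. Qed.
Lemma isoN x : phi (- x) = - phi x.
Proof. by rewrite -scaleN1r isoZ scaleN1r. Qed.
Lemma iso1 : phi uone = uone.
Proof. by rewrite -[LHS]umul1r -[X in _ ** X](iso_invK phi) -isoM umul1l iso_invK. Qed.

End BanachIso.

(** * The isomorphism restricts to the coefficient algebras *)

Section Diagonal.
Variables (R : realType) (A B : cstarAlgType R).
Variables (alpha : starHom A A) (beta : starHom B B) (X Y : banachAlgType R).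
Variables (mX : semicrossed_model alpha X) (mY : semicrossed_model beta Y).
Variable phi : banach_iso X Y.

(* If [u] and its inverse are contractions then, on the orbit representations, *)
(* the zeroth coefficient of [u] is already isometric, so there is no room for *)
(* the other coefficients.                                                    *)
Lemma iso_unitary a : unitary a ->
  phi (sconst mX a) = sconst mY (fcoef mY 0 (phi (sconst mX a))).
Proof.
move=> ua; set u := phi _; pose w := phi (sconst mX (star a)).
have wu : w ** u = uone by rewrite -isoM -sconstM ua.1 sconst1 iso1.
have u1 : rnorm u <= 1 by rewrite rnorm_iso rnorm_sconst unitary_rnorm_le1.
have w1 : rnorm w <= 1.
  by rewrite rnorm_iso rnorm_sconst unitary_rnorm_le1//; exact: unitary_star.
apply: fcoef_const => k k0; apply: rnorm0_eq0; apply/eqP; rewrite eq_le rnorm_ge0 andbT.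
apply: rnorm_le_gns => // f; rewrite expr0n /=; set N := nsq (gns f).
have h1 : N (fcoef mY 0 u) + N (fcoef mY k u) <= N uone.
  apply: le_trans (fcoef_pair_le mY f u k0) _.
  by rewrite ler_piMl ?nsq_ge0// exprn_ile1// rnorm_ge0.
have h2 : N uone <= N (fcoef mY 0 u).
  have <- : fcoef mY 0 w ** fcoef mY 0 u = uone.
    by rewrite -fcoef0M wu -(sconst1 mY) fcoef_sconst.
  apply: le_trans (nsq_gnsM f _ _) _; rewrite ler_piMl ?nsq_ge0//.
  by rewrite exprn_ile1 ?rnorm_ge0// (le_trans (rnorm_fcoef _ _ _)).
lra.
Qed.

Definition diag a : B := fcoef mY 0 (phi (sconst mX a)).

Fact diag_linear : linear diag.
Proof. by move=> c x y; rewrite /diag [sconst _ _]linearP iso_linear linearP. Qed.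
HB.instance Definition _ := GRing.isLinear.Build R[i] A B *:%R diag diag_linear.

Lemma iso_sconst a : phi (sconst mX a) = sconst mY (diag a).
Proof.
move: a; apply: unitary_span => [c x y Px Py||u]; last exact: iso_unitary.
  by rewrite [sconst mX _]linearP iso_linear Px Py [X in _ = sconst mY X]linearP [RHS]linearP.
by rewrite [diag 0]linear0 !linear0 iso0.
Qed.

Fact diag1 : diag uone = uone.
Proof. by rewrite /diag sconst1 iso1 -(sconst1 mY) fcoef_sconst. Qed.
Fact diagM a b : diag (a ** b) = diag a ** diag b.
Proof. by rewrite /diag sconstM isoM fcoef0M. Qed.

Lemma rnorm_diag a : rnorm (diag a) <= rnorm a.
Proof.
by apply: le_trans (rnorm_fcoef _ _ _) _; rewrite rnorm_iso rnorm_sconst.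
Qed.

(** For unitary [u], [diag (star u)] is a contractive inverse of the contraction [diag u], so
    [star_eq_inverse] identifies it; such [u] span. *)
Fact diag_star a : diag (star a) = star (diag a).
Proof.
move: a; apply: unitary_span => [c x y Px Py||u [uu uu']].
- by rewrite starD starZ !linearP /= Px Py starD starZ.
- by rewrite star0 linear0 star0.
have u1 : unitary u by [].
apply: star_eq_inverse; rewrite -?diagM ?uu ?uu' ?diag1//.
  by apply: le_trans (rnorm_diag _) _; exact: unitary_rnorm_le1.
by apply: le_trans (rnorm_diag _) _; apply: unitary_rnorm_le1; exact: unitary_star.
Qed.
HB.instance Definition _ := isStarHom.Build R A B diag diag1 diagM diag_star.

End Diagonal.

(** * The image of the generator and the invertibility of its first coefficient *)

Section Forward.
Variables (R : realType) (A B : cstarAlgType R).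
Variables (alpha : starHom A A) (beta : starHom B B) (X Y : banachAlgType R).
Variables (mX : semicrossed_model alpha X) (mY : semicrossed_model beta Y).
Variable phi : banach_iso X Y.
Local Notation psi := (iso_sym phi).
Local Notation gamma := (diag mX mY phi).
Local Notation gammaV := (diag mY mX psi).
Local Notation CA := (sconst mX).
Local Notation CB := (sconst mY).

Lemma diagK : cancel gamma gammaV.
Proof.
move=> a; rewrite -[LHS](fcoef_sconst mX) -iso_sconst -iso_sconst.
by rewrite [psi _](isoK phi) fcoef_sconst.
Qed.

Lemma diagVK : cancel gammaV gamma.
Proof.
move=> b; rewrite -[LHS](fcoef_sconst mY) -iso_sconst -iso_sconst.
by rewrite [phi _](iso_invK phi) fcoef_sconst.
Qed.

Let T := phi (svar mX).
Let W := svar mY.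
Let t0 := fcoef mY 0 T.
Let t1 := fcoef mY 1 T.

(** The covariance relation of the first product, transported by [phi]; its coefficients of degree 0
    and 1 are [t0_cov] and [t1_cov]. *)
Lemma T_cov a : CB (gamma a) ** T = T ** CB (gamma (alpha a)).
Proof. by rewrite -!iso_sconst -!isoM sconst_svar. Qed.

Lemma t0_cov a : gamma a ** t0 = t0 ** gamma (alpha a).
Proof. by have := congr1 (fcoef mY 0) (T_cov a); rewrite !fcoef0M !fcoef_sconst. Qed.

Lemma fcoef1_sconst b : fcoef mY 1 (CB b) = 0.
Proof. by rewrite fcoef_incl. Qed.

Lemma t1_cov a : beta (gamma a) ** t1 = t1 ** gamma (alpha a).
Proof.
have := congr1 (fcoef mY 1) (T_cov a); rewrite !fcoef1M !fcoef_sconst !fcoef1_sconst.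
by rewrite umul0l add0r umul0r addr0.
Qed.

Lemma rnormTM y : rnorm (T ** y) = rnorm y.
Proof.
rewrite -[y](iso_invK phi) -isoM !rnorm_iso; exact: rnorm_svarM.
Qed.

Section NormT0.

Let s := gamma (fcoef mX 0 (psi W)).

Lemma s_cov b : b ** s = s ** beta b.
Proof.
have := congr1 (fcoef mX 0) (congr1 psi (sconst_svar mY b)).
rewrite !isoM !fcoef0M -!/(gammaV _) => /(congr1 gamma).
by rewrite !diagM !diagVK.
Qed.

Lemma s_le1 : rnorm s <= 1.
Proof.
apply: le_trans (rnorm_diag _ _ _ _) _; apply: le_trans (rnorm_fcoef _ _ _) _.
by rewrite rnorm_iso; exact: rnorm_svar_le1.
Qed.

(** The projection of the first product onto its diagonal, seen from [Y]: multiplicative, the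
    identity on [B], it sends [W] to [s] and kills [T]. *)
Let Psi y := gamma (fcoef mX 0 (psi y)).

Lemma PsiB x y : Psi (x - y) = Psi x - Psi y.
Proof. by rewrite /Psi isoD isoN !linearB. Qed.

Lemma Psi_le y : rnorm (Psi y) <= rnorm y.
Proof.
apply: le_trans (rnorm_diag _ _ _ _) _; apply: le_trans (rnorm_fcoef _ _ _) _.
by rewrite rnorm_iso.
Qed.

Lemma Psi_poly n (p : twisted_poly beta) : (forall k, (n <= k)%N -> p k = 0) ->
  Psi (sincl mY p) = \sum_(k < n) upow s k ** p k.
Proof.
elim: n p => [|n IH] p pn.
  have -> : p = 0 by apply: twisted_polyP => k; rewrite pn.
  by rewrite /Psi sincl0 iso0 !linear0 big_ord0.
rewrite [p in sincl _ p]tpoly_decomp sinclD sinclM /Psi isoD isoM.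
rewrite linearD /= fcoef0M [diag _ _ _ (_ + _)]linearD /= diagM big_ord_recl /= umul1l.
congr +%R; first exact: diagVK.
rewrite -/s -/(Psi _) IH => [|k nk]; last exact: pn.
rewrite umul_sumr; apply: eq_bigr => k _ /=; by rewrite umulA.
Qed.

(* Schwarz-Pick: [r |-> Psi (gauge_r T)] is a contraction that takes the value *)
(* [t0] at [0] and vanishes at [1].                                           *)
Lemma rnorm_t0_lt1 : rnorm t0 < 1.
Proof.
have PsiT : Psi T = 0.
  by rewrite /Psi [psi _](isoK phi) fcoef_svar linear0.
(* As [Psi] vanishes at [T], two errors of 1/8 keep [Psi] of the damped [p] within 1/4. *)
have e0 : 0 < 8^-1 :> R by rewrite invr_gt0.
have [p /ltW Tp] := sincl_dense mY T e0.
have [r /andP[r0 r1] rp] := tgauge_near p e0.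
have Psip : rnorm (Psi (sincl mY (tgauge r p))) <= 1 / 4.
  have h1 := rnorm_tri (sincl mY p) (sincl mY (tgauge r p)) T.
  have h2 : rnorm (sincl mY (tgauge r p) - sincl mY p) <= 8^-1.
    by rewrite -sinclN -sinclD rnorm_sincl.
  have h3 := Psi_le (sincl mY (tgauge r p) - T).
  rewrite PsiB PsiT subr0 in h3; rewrite (rnormB (sincl mY p)) in h1; lra.
pose d := Num.sqrt (1 - r ^+ 2).
have r2 : r ^+ 2 < 1 by rewrite exprn_ilt1.
have dd : d ^+ 2 = 1 - r ^+ 2 by rewrite sqr_sqrtr// subr_ge0 ltW.
have d0 : 0 < d ^+ 2 by rewrite dd subr_gt0.
have d1 : d ^+ 2 <= 1 by rewrite dd gerBl sqr_ge0.
rewrite ltNge; apply/negP => t1le.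
(* [q] is chosen after [r]: the Schwarz estimate gains [(9/64) d^2], while the errors cost only
   [(1 + e)^2 - (1 - e)^2 = 4 e = (4/64) d^2]. *)
have e1 : 0 < d ^+ 2 / 64 by rewrite divr_gt0.
have [q /ltW Tq] := sincl_dense mY T e1; set e := d ^+ 2 / 64 in e1 Tq.
have q0 : 1 - e <= rnorm (q 0%N).
  have := fcoefP mY 0 T q; rewrite -/t0.
  have := rnormD (t0 - q 0%N) (q 0%N); rewrite subrK; lra.
have Psiq : rnorm (Psi (sincl mY (tgauge r q))) <= 1 / 2.
  have h1 : rnorm (Psi (sincl mY (tgauge r q)) - Psi (sincl mY (tgauge r p))) <= 4^-1.
    rewrite -PsiB; apply: le_trans (Psi_le _) _.
    rewrite -sinclN -sinclD rnorm_sincl -tgaugeB.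
    apply: le_trans (tgauge_le _ _) _; first by rewrite ger0_norm// ltW.
    rewrite -(rnorm_sincl mY) sinclD sinclN.
    have := rnorm_tri T (sincl mY q) (sincl mY p); rewrite (rnormB (sincl mY q) T).
    have : e <= 64^-1 by rewrite /e ler_piMl// invr_ge0. 
    lra.
  have := rnormD (Psi (sincl mY (tgauge r q)) - Psi (sincl mY (tgauge r p)))
    (Psi (sincl mY (tgauge r p))).
  rewrite subrK; lra.
have [n qn] := coef_fin q.
have qn1 k : (n < k)%N -> q k = 0 by move=> /ltnW /qn.
pose G := \sum_(k < n) (r ^+ k)%:C *: (upow s k.+1 ** q k.+1).
have PsiG : Psi (sincl mY (tgauge r q)) = q 0%N + r%:C *: G.
  rewrite (@Psi_poly n.+1) => [|k kn]; last by rewrite /= qn1// scaler0.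
  rewrite big_ord_recl /= umul1l expr0 scale1r; congr +%R.
  rewrite /G scaler_sumr; apply: eq_bigr => k _.
  by rewrite scalerA -rmorphM -exprS /bump /= umulZr.
have [f fq] := norming_state (q 0%N).
have {}fq : rnorm (q 0%N) <= hnorm (gns f) (q 0%N).
  rewrite -(ler_pXn2r (n := 2)) ?nnegrE ?rnorm_ge0 ?hnorm_ge0// sqr_hnorm.
  by rewrite -lecR -nsqE.
have rd : r ^+ 2 + d ^+ 2 <= 1 by rewrite dd addrC subrK.
have := schwarz_le s_le1 s_cov f rd qn1; rewrite -/G -(rnorm_sincl mY).
have Tq' : rnorm (sincl mY q) <= 1 + e.
  have := rnormD (sincl mY q - T) T; rewrite subrK (rnormB _ T).
  rewrite rnorm_iso; have := rnorm_svar_le1 mX; lra.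
have hG : hnorm (gns f) (q 0%N) - 1 / 2 <= hnorm (gns f) G.
  have h1 : hnorm (gns f) (r%:C *: G) <= hnorm (gns f) G.
    rewrite hnormZ rnorm_real ger0_norm// ler_piMl ?hnorm_ge0// ltW//.
  have h2 := le_trans (hnorm_gns_le f _) Psiq.
  have := hnormD (gns f) (q 0%N + r%:C *: G) (- (r%:C *: G)).
  rewrite addrK hnormN; rewrite PsiG in h2; lra.
rewrite -!sqr_hnorm; move: fq hG q0 Tq'; set a := hnorm _ _; set g := hnorm _ _.
set N := rnorm (sincl mY q); have N0 : 0 <= N := rnorm_ge0 _.
move=> fq hG q0 Tq' main.
have e64 : 64 * e = d ^+ 2 by rewrite /e; field.
have a78 : 7 / 8 <= a by lra.
have g38 : 3 / 8 <= g by lra.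
have g2 : 9 / 64 <= g ^+ 2 by nra.
have a2 : (1 - e) ^+ 2 <= a ^+ 2 by nra.
have N2 : N ^+ 2 <= (1 + e) ^+ 2 by nra.
have : d ^+ 2 * (9 / 64) <= d ^+ 2 * g ^+ 2 by rewrite ler_pM2l.
nra.
Qed.

End NormT0.

Let D := T - CB t0.

Lemma fcoef0_D : fcoef mY 0 D = 0.
Proof. by rewrite linearB /= fcoef_sconst subrr. Qed.

Lemma fcoef1_D : fcoef mY 1 D = t1.
Proof. by rewrite linearB /= fcoef1_sconst subr0. Qed.

(** Left multiplication by [T = D + t0] preserves [B + D Y], because [T_cov] and [t0_cov] give
    [t0 D = D b] with [b] in [B]. *)
Lemma iso_poly n (p : twisted_poly alpha) : (forall k, (n <= k)%N -> p k = 0) ->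
  exists b q, phi (sincl mX p) = CB b + D ** q.
Proof.
elim: n p => [|n IH] p pn.
  have -> : p = 0 by apply: twisted_polyP => k; rewrite pn.
  by exists 0, 0; rewrite sincl0 iso0 linear0 umul0r addr0.
have [k nk|b [q E]] := IH (tdrop p); first exact: pn.
have TE u : T ** u = D ** u + CB t0 ** u by rewrite -umulDl subrK.
have t0D : CB t0 ** D = D ** CB (gamma (alpha (gammaV t0))).
  have t0c : t0 ** t0 = t0 ** gamma (alpha (gammaV t0)).
    by rewrite -t0_cov diagVK.
  rewrite {1}/D umulDr umulNr -{1}[t0]diagVK T_cov /D umulDl umulNl.
  by rewrite -!sconstM t0c.
exists (gamma (p 0%N) + t0 ** b).
exists (CB b + D ** q + CB (gamma (alpha (gammaV t0))) ** q).
rewrite [p in sincl _ p]tpoly_decomp sinclD sinclM isoD isoM (iso_sconst mX mY) E -/T.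
rewrite linearD /= sconstM (umulDr T) !TE (umulA (CB t0) D) t0D !(umulDr D).
by rewrite -(umulA D (CB _) q); module.
Qed.

Lemma iso_approx y (e : R) : 0 < e -> exists q, rnorm (y - (CB (fcoef mY 0 y) + D ** q)) < e.
Proof.
move=> e0; have e2 : 0 < e / 2 by rewrite divr_gt0.
have [p yp] := sincl_dense mX (psi y) e2; have [n pn] := coef_fin p.
have [b [q E]] := iso_poly pn; exists q.
have Ey : y - phi (sincl mX p) = phi (psi y - sincl mX p).
  by rewrite isoD isoN (iso_invK phi).
have h : rnorm (y - phi (sincl mX p)) < e / 2 by rewrite Ey rnorm_iso.
have hb : rnorm (fcoef mY 0 y - b) < e / 2.
  have -> : fcoef mY 0 y - b = fcoef mY 0 (y - phi (sincl mX p)).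
    by rewrite linearB /= E linearD /= fcoef0M fcoef0_D umul0l addr0 fcoef_sconst.
  by apply: le_lt_trans (rnorm_fcoef _ _ _) h.
have -> : y - (CB (fcoef mY 0 y) + D ** q) =
    (y - phi (sincl mX p)) - CB (fcoef mY 0 y - b).
  by rewrite E linearB /=; module.
apply: le_lt_trans (rnormD _ _) _; rewrite rnormN rnorm_sconst; lra.
Qed.

Let delta := 1 - rnorm t0.
Let delta0 : 0 < delta. Proof. by rewrite subr_gt0 rnorm_t0_lt1. Qed.

(** [T] is isometric, while [t0] multiplies norms by at most [|t0| < 1]. *)
Lemma D_below y : delta * rnorm y <= rnorm (D ** y).
Proof.
have E : T ** y = D ** y + CB t0 ** y by rewrite -umulDl subrK.
have h1 := rnormD (D ** y) (CB t0 ** y); have h2 := rnormM (CB t0) y.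
rewrite -E rnormTM in h1; rewrite rnorm_sconst in h2.
rewrite /delta mulrBl mul1r; lra.
Qed.

Lemma svar_approx (e : R) : 0 < e -> exists q, rnorm (W - D ** q) < e.
Proof.
move=> /(iso_approx W)[q]; rewrite fcoef_svar /= linear0 add0r; by exists q.
Qed.

(* [(T - t0) x - W t1 x] has no coefficients in degree 0 and 1, hence is close *)
(* to [W^2 q], hence to [(T - t0) q' W q]; cancelling [T - t0] leaves [x] close *)
(* to an element without constant coefficient, up to the norm of [t1 x].      *)
Lemma t1_below x : delta * rnorm x <= rnorm (t1 ** x).
Proof.
(* One error for [z - W^2 q], one for [(W - D q') W q]. *)
apply: (@ler_small _ _ _ 2) => // e e0.
pose z := D ** CB x - W ** CB (t1 ** x).
have z0 : fcoef mY 0 z = 0.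
  by rewrite linearB /= !fcoef0M fcoef0_D fcoef_svar !umul0l subr0.
have z1 : fcoef mY 1 z = 0.
  rewrite linearB /= !fcoef1M fcoef0_D fcoef1_D !fcoef_svar /= !fcoef1_sconst.
  by rewrite !fcoef_sconst !umul0r !addr0 umul1l subrr.
have [q zq] := fcoef01_eq0 z0 z1 e0.
have c0 : 0 < rnorm (W ** q) + 1 by rewrite ltr_wpDl// rnorm_ge0.
have [q' Wq] := svar_approx (divr_gt0 e0 c0).
have h1 : rnorm ((W - D ** q') ** (W ** q)) <= e.
  apply: le_trans (rnormM _ _) _.
  apply: le_trans (ler_wpM2r (rnorm_ge0 _) (ltW Wq)) _.
  by rewrite mulrAC ler_pdivrMr// ler_pM2l// lerDl.
pose y := CB x - q' ** (W ** q).
have y0 : fcoef mY 0 y = x.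
  by rewrite linearB /= !fcoef0M fcoef_svar fcoef_sconst umul0l umul0r subr0.
have Dy : D ** y = (z - W ** (W ** q)) + (W - D ** q') ** (W ** q) + W ** CB (t1 ** x).
  by rewrite /y /z !(umulDl, umulDr, umulNl, umulNr) !umulA; module.
have h2 := rnormD ((z - W ** (W ** q)) + (W - D ** q') ** (W ** q)) (W ** CB (t1 ** x)).
have h3 := rnormD (z - W ** (W ** q)) ((W - D ** q') ** (W ** q)).
rewrite -Dy rnorm_svarM rnorm_sconst in h2.
have h4 : delta * rnorm x <= delta * rnorm y.
  by rewrite ler_pM2l// -{1}y0; exact: rnorm_fcoef.
have := D_below y; lra.
Qed.

(** The degree 1 coefficient of [W - D q] is [1 - t1 q_0], so [t1] has approximate right inverses.
    By [t1_below] they form a Cauchy sequence, and [t1] can be cancelled on the left in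
    [t1 (r t1 - 1) = 0]. *)
Lemma t1_inverse : exists2 r, t1 ** r = uone & r ** t1 = uone.
Proof.
have near (n : nat) : exists b, rnorm (uone - t1 ** b) < n.+1%:R^-1.
  have [|q Wq] := @svar_approx n.+1%:R^-1; first by rewrite invr_gt0 ltr0Sn.
  exists (fcoef mY 0 q); apply: le_lt_trans Wq.
  have -> : uone - t1 ** fcoef mY 0 q = fcoef mY 1 (W - D ** q).
    by rewrite linearB /= fcoef1M fcoef1_D fcoef0_D fcoef_svar linear0 umul0l addr0.
  exact: rnorm_fcoef.
pose u n := sval (cid (near n)).
have uP n : rnorm (uone - t1 ** u n) < n.+1%:R^-1 := svalP (cid (near n)).
have small (e : R) : 0 < e -> exists n, forall i, (n <= i)%N -> rnorm (uone - t1 ** u i) < e.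
  move=> e0; exists (Num.bound e^-1) => i ni; apply: lt_trans (uP i) _.
  rewrite invf_plt ?posrE ?ltr0Sn//; apply: lt_le_trans (archi_boundP _) _.
    by rewrite invr_ge0 ltW.
  by rewrite ler_nat ltnW.
have [e e0|r hr] := @rnorm_cvg _ _ u.
  have [|n hn] := small (delta * (e / 2)); first by rewrite mulr_gt0// divr_gt0.
  exists n => i j /hn ni /hn nj; rewrite -(ltr_pM2l delta0).
  apply: le_lt_trans (t1_below _) _.
  have -> : t1 ** (u i - u j) = (uone - t1 ** u j) - (uone - t1 ** u i).
    by rewrite umulDr umulNr; module.
  apply: le_lt_trans (rnormD _ _) _; rewrite rnormN [e in ltRHS]splitr mulrDr.
  by rewrite addrC ltrD.
have tr : t1 ** r = uone.
  apply/eqP; rewrite eq_sym -subr_eq0; apply/eqP.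
  apply: (@rnorm_small _ _ _ (1 + rnorm t1)) => [|e e0].
    by rewrite addr_ge0// rnorm_ge0.
  have [n hn] := small e e0; have [n' hn'] := hr e e0.
  have {}hn := hn _ (leq_maxl n n'); have {}hn' := hn' _ (leq_maxr n n').
  have -> : uone - t1 ** r = (uone - t1 ** u (maxn n n')) - t1 ** (r - u (maxn n n')).
    by rewrite umulDr umulNr; module.
  apply: le_trans (rnormD _ _) _; rewrite rnormN mulrDl mul1r; apply: lerD (ltW hn) _.
  by apply: le_trans (rnormM _ _) _; rewrite ler_wpM2l ?rnorm_ge0// ltW.
exists r => //; apply/eqP; rewrite -subr_eq0; apply/eqP/rnorm0_eq0/eqP.
rewrite eq_le rnorm_ge0 andbT -(ler_pM2l delta0) mulr0; apply: le_trans (t1_below _) _.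
by rewrite umulDr umulNr umul1r umulA tr umul1l subrr rnorm0.
Qed.

(** The unitary part [u] of [t1] satisfies [beta (gamma a) u = u gamma (alpha a)]; solving for
    [alpha a] puts [gammaV (star u)] in the place of [v]. *)
Theorem outer_conjugate_of_iso : outer_conjugate alpha beta.
Proof.
have [r tr rt] := t1_inverse; have [u [uu uu'] uc] := polar_unitary tr rt.
exists (diag mX mY phi : starHom A B), gammaV, (gammaV (star u)); split.
- exact: diagK.
- exact: diagVK.
- by split; rewrite -diag_star starK -diagM ?uu ?uu' diag1.
move=> a; have sc : star (beta (gamma a)) ** t1 = t1 ** star (gamma (alpha a)).
  rewrite -[star (beta _)]starhom_star -!diag_star -[star (alpha _)]starhom_star.
  exact: t1_cov.
have ua := uc _ _ (t1_cov a) sc.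
rewrite -diag_star starK -!diagM -umulA ua umulA uu umul1l.
by rewrite diagK.
Qed.

End Forward.

(** * Outer conjugacies yield isometric isomorphisms *)

Section IsometricExtension.
Variables (R : realType) (P Q : seminormedAlgType R) (F : bounded_linear P Q).
Hypotheses (FM : forall p q, F (p ** q) = F p ** F q)
  (F_norm : forall p, seminorm (F p) = seminorm p)
  (F_surj : forall q, exists p, F p = q).

Lemma rnorm_isometric_extend (x : completion P) : rnorm (extend F x) = rnorm x.
Proof.
rewrite !rnorm_completion; elim/completionW: x => u; rewrite extend_cclass.
have h := @cvg_seminorm _ _ u; have := @cvg_seminorm _ _ (bl_cseq F u).
have -> : (fun n => seminorm (bl_cseq F u n)) = (fun n => seminorm (u n)).
  by apply/funext => n /=; exact: F_norm.
move=> h'; exact: (cvg_unique _ h' h).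
Qed.

(** Surjectivity survives completion because preimages of a Cauchy sequence under an isometric
    linear map are Cauchy. *)
Lemma isometric_extension : isometrically_isomorphic (completion P) (completion Q).
Proof.
exists (extend F : {linear completion P -> completion Q}).
have extM x y : extend F (x ** y) = extend F x ** extend F y.
  elim/completionW: x => u; elim/completionW: y => w.
  by rewrite cclassM !extend_cclass cclassM; apply: eq_cclass => n /=; rewrite FM.
have ext_inj : injective (extend F).
  move=> x y xy; apply/eqP; rewrite -subr_eq0; apply/eqP/rnorm0_eq0.
  by rewrite -rnorm_isometric_extend linearB /= xy subrr rnorm0.
have ext_surj y : exists x, extend F x = y.
  elim/completionW: y => t.
  pose p n := sval (cid (F_surj (t n))).
  have pt n : F (p n) = t n := svalP (cid (F_surj (t n))).
  have pC : cauchy_seq p.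
    move=> e /(cseqP t)[n hn]; exists n => i j ni nj.
    by rewrite -F_norm blB !pt; exact: hn.
  by exists (cclass (CSeq pC)); rewrite extend_cclass; apply: eq_cclass => n /=.
split=> [||x] //; last by rewrite -!rnormE rnorm_isometric_extend.
exists (fun y => sval (cid (ext_surj y))) => [x|y].
  by apply: ext_inj; exact: (svalP (cid (ext_surj (extend F x)))).
exact: (svalP (cid (ext_surj y))).
Qed.

End IsometricExtension.

(** * Change of generator along an outer conjugacy *)

Section Backward.
Variables (R : realType) (A B : cstarAlgType R).
Variables (alpha : starHom A A) (beta : starHom B B).
Variables (gamma : starHom A B) (gammaV : B -> A) (v : A).
Hypotheses (gammaK : cancel gamma gammaV) (gammaVK : cancel gammaV gamma).
Hypotheses (vu : unitary v) (v_conj : forall a, alpha a = v ** gammaV (beta (gamma a)) ** star v).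

Let u := star (gamma v).

Let gvu : u ** gamma v = uone.
Proof. by rewrite /u -starhom_star -starhomM vu.1 starhom1. Qed.

Let guv : gamma v ** u = uone.
Proof. by rewrite /u -starhom_star -starhomM vu.2 starhom1. Qed.

Let u_cov a : beta (gamma a) ** u = u ** gamma (alpha a).
Proof.
by rewrite v_conj !starhomM gammaVK starhom_star -/u !umulA gvu umul1l.
Qed.

(** Determined by [(W u)^k = W^k (cocycle k)] for the generator [W]: moving each [u] to the right
    past powers of [W] applies powers of [beta]. *)
Fixpoint cocycle k : B := if k is j.+1 then iter j beta u ** cocycle j else uone.

Lemma cocycle_cov k a :
  iter k beta (gamma a) ** cocycle k = cocycle k ** gamma (iter k alpha a).
Proof.
elim: k a => [|k IH] a; first by rewrite /= umul1l umul1r.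
rewrite iterSr [iter k.+1 alpha a]iterSr /= umulA -iter_starhomM u_cov.
by rewrite iter_starhomM -umulA IH umulA.
Qed.

Lemma cocycleD i j : iter j beta (cocycle i) ** cocycle j = cocycle (i + j).
Proof.
elim: i => [|i IH]; first by rewrite iter_starhom1 umul1l.
by rewrite /= iter_starhomM -umulA IH -iterD addnC.
Qed.

Lemma cocycle_unitary k : cocycle k ** star (cocycle k) = uone.
Proof.
elim: k => [|k IH]; first by rewrite star1 umul1l.
rewrite /= starM umulA -[_ ** _ ** star (cocycle k)]umulA IH umul1r -iter_star.
by rewrite -iter_starhomM /u starK gvu iter_starhom1.
Qed.

Fact twist_fin (p : twisted_poly alpha) :
  exists n, forall k, (n <= k)%N -> cocycle k ** gamma (p k) = 0.
Proof. by have [n pn] := coef_fin p; exists n => k /pn ->; rewrite linear0 umul0r. Qed.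
Definition twist p : twisted_poly beta := TwistedPoly beta (twist_fin p).

Lemma twist_linear (c : R[i]) p q : twist (c *: p + q) = c *: twist p + twist q.
Proof. by apply: twisted_polyP => k /=; rewrite linearP umulDr umulZr. Qed.

Lemma twistM p q : twist (p ** q) = twist p ** twist q.
Proof.
apply: twisted_polyP => k /=; rewrite linear_sum umul_sumr; apply: eq_bigr => j _ /=.
rewrite starhomM iter_starhomM umulA.
rewrite -{1}(subnK (ltnSE (ltn_ord j))) -cocycleD -!umulA; congr (_ ** _).
by rewrite [RHS]umulA cocycle_cov umulA.
Qed.

Lemma twist_surj q : exists p, twist p = q.
Proof.
have fin : exists n, forall k, (n <= k)%N -> gammaV (star (cocycle k) ** q k) = 0.
  have [n qn] := coef_fin q; exists n => k /qn ->.
  by apply: (can_inj gammaK); rewrite gammaVK umul0r linear0.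
exists (TwistedPoly alpha fin); apply: twisted_polyP => k /=.
by rewrite gammaVK umulA cocycle_unitary umul1l.
Qed.

Section PullBack.
Variables (H : hilbertType R) (rho : covariant_rep beta H).
Local Notation V := (cov_op rho).
Local Notation pi := (cov_rep rho).

(** Evaluating [twist p] in [rho] is evaluating [p] here: [V (pi u)] represents the new generator
    [W u]. *)
Definition pullback_precov : precov alpha (hilbert_inner H).
apply: (@Precov _ _ alpha _ (hilbert_inner H) (fun a => pi (gamma a)) (fun x => V (pi u x))).
- by move=> a c x y; rewrite linearP.
- by move=> c a b x; rewrite linearP rep_linear.
- by move=> a b x; rewrite starhomM repM.
- by move=> a x y; rewrite starhom_star; exact: rep_star.
- by move=> c x y; rewrite !linearP.
- move=> x; rewrite !nsq_hilbert lerXn2r ?nnegrE ?rnorm_ge0//.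
  apply: le_trans (rnorm_cov _ _) _; apply: le_trans (rep_contractive _ _ _) _.
  rewrite ler_piMl ?rnorm_ge0// /u rnorm_star; apply: le_trans (rnorm_starhom _ _) _.
  exact: unitary_rnorm_le1.
- by move=> a x; rewrite covariance -!repM u_cov.
Defined.

Lemma pullback_iter k b x :
  iter k (fun x => V (pi u x)) (pi b x) = iter k V (pi (cocycle k ** b) x).
Proof.
elim: k => [|k IH]; first by rewrite umul1l.
by rewrite !iterS IH rep_iter_cov -repM umulA.
Qed.

End PullBack.

Section PushForward.
Variables (H : hilbertType R) (rho : covariant_rep alpha H).
Local Notation V := (cov_op rho).
Local Notation pi := (cov_rep rho).

Let gammaVP c a b : gammaV (c *: a + b) = c *: gammaV a + gammaV b.
Proof. by apply: (can_inj gammaK); rewrite linearP /= !gammaVK. Qed.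
Let gammaVM a b : gammaV (a ** b) = gammaV a ** gammaV b.
Proof. by apply: (can_inj gammaK); rewrite starhomM !gammaVK. Qed.
Let gammaV_star a : gammaV (star a) = star (gammaV a).
Proof. by apply: (can_inj gammaK); rewrite starhom_star !gammaVK. Qed.
Let v_cov b : alpha (gammaV b) ** v = v ** gammaV (beta b).
Proof. by rewrite v_conj gammaVK -umulA vu.1 umul1r. Qed.

Definition pushforward_precov : precov beta (hilbert_inner H).
apply: (@Precov _ _ beta _ (hilbert_inner H) (fun b => pi (gammaV b)) (fun x => V (pi v x))).
- by move=> a c x y; rewrite linearP.
- by move=> c a b x; rewrite gammaVP rep_linear.
- by move=> a b x; rewrite gammaVM repM.
- by move=> a x y; rewrite gammaV_star; exact: rep_star.
- by move=> c x y; rewrite !linearP.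
- move=> x; rewrite !nsq_hilbert lerXn2r ?nnegrE ?rnorm_ge0//.
  apply: le_trans (rnorm_cov _ _) _; apply: le_trans (rep_contractive _ _ _) _.
  by rewrite ler_piMl ?rnorm_ge0//; exact: unitary_rnorm_le1.
- by move=> a x; rewrite covariance -!repM v_cov.
Defined.

(** The factors [v] cancel the cocycle one by one, through [v ** gammaV u = uone]. As [pi] may be
    degenerate, the vector is required to be fixed by [pi uone]. *)
Lemma pushforward_iter k x : pi uone x = x ->
  iter k (fun x => V (pi v x)) (pi (gammaV (cocycle k)) x) = iter k V x.
Proof.
elim: k x => [|k IH] x x1.
  rewrite /= -[RHS]x1; congr (pi _ x).
  by apply: (can_inj gammaK); rewrite gammaVK starhom1.
rewrite !iterSr -addn1 -cocycleD /= umul1r gammaVM repM -[pi v _]repM -v_cov.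
rewrite repM -[pi v (pi _ x)]repM.
have -> : v ** gammaV u = uone.
  by apply: (can_inj gammaK); rewrite starhomM gammaVK guv starhom1.
rewrite x1 -covariance; apply: IH.
by rewrite covariance starhom1 x1.
Qed.

End PushForward.

(** Each inequality evaluates in a pair transported from the other system; in the second one the
    vectors [pi (p k) x] are fixed by [pi uone]. *)
Lemma twist_norm p : semicrossed_norm (twist p) = semicrossed_norm p.
Proof.
have [n pn] := coef_fin p.
have qn k : (n <= k)%N -> twist p k = 0 by move=> /pn /= ->; rewrite linear0 umul0r.
apply/eqP; rewrite eq_le; apply/andP; split;
  (apply: semicrossed_norm_le => [|H rho x]; first exact: semicrossed_norm_ge0).
- have := peval_le (pullback_precov rho) x pn; rewrite !nsq_hilbert -exprMn.
  rewrite ler_pXn2r ?nnegrE ?mulr_ge0 ?rnorm_ge0 ?semicrossed_norm_ge0//.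
  congr (rnorm _ <= _); rewrite (cov_evalE _ _ qn); apply: eq_bigr => k _.
  exact: pullback_iter.
have := peval_le (pushforward_precov rho) x qn; rewrite !nsq_hilbert -exprMn.
rewrite ler_pXn2r ?nnegrE ?mulr_ge0 ?rnorm_ge0 ?semicrossed_norm_ge0//.
congr (rnorm _ <= _); rewrite (cov_evalE _ _ pn); apply: eq_bigr => k _ /=.
have -> : gammaV (cocycle k ** gamma (p k)) = gammaV (cocycle k) ** p k.
  by apply: (can_inj gammaK); rewrite starhomM !gammaVK.
by rewrite repM pushforward_iter// -repM umul1l.
Qed.

Fact twist_bound : exists2 M : R, 0 <= M & forall p, seminorm (twist p) <= M * seminorm p.
Proof.
by exists 1 => // p; rewrite mul1r le_eqVlt [seminorm _]twist_norm eqxx.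
Qed.

Definition twist_bl : bounded_linear (twisted_poly alpha) (twisted_poly beta) :=
  BoundedLinear twist_linear twist_bound.

Lemma iso_of_conjugate :
  isometrically_isomorphic (semicrossed_product alpha) (semicrossed_product beta).
Proof. exact: (@isometric_extension _ _ _ twist_bl twistM twist_norm twist_surj). Qed.

End Backward.

Theorem theorem1p1 (R : realType) (A B : cstarAlgType R)
    (alpha : starHom A A) (beta : starHom B B)
    (alpha_inj_or_surj :
      injective alpha \/ (forall b : A, exists a : A, alpha a = b)) :
  isometrically_isomorphic (semicrossed_product alpha) (semicrossed_product beta)
  <-> outer_conjugate alpha beta.
Proof.
split=> [[phi [[psi phiK psiK] phiM phi_norm]]|[gamma [gammaV [v [gK gVK vu vc]]]]].
  have phi_rnorm x : rnorm (phi x) = rnorm x by rewrite /rnorm phi_norm.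
  exact: (outer_conjugate_of_iso (standard_model alpha) (standard_model beta)
    (BanachIso (linearP phi) phiM phi_rnorm phiK psiK)).
exact: (iso_of_conjugate gK gVK vu vc).
Qed.
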